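(* Let $X=\lambda^p(A)$ (with $1\le p<\infty$) or $X=c_0(A)$ be a Köthe sequence space with a continuous norm. If $X$ is non-normable then $X$ does not satisfy the Hereditary Invariant Subset Property.
   Context: Let $A=(a_{j,k})_{j\ge 1,k\ge 0}$ be a matrix of non-negative real numbers such that for every $k$ there exists $j$ with $a_{j,k}>0$ and such that for every $k$ the sequence $(a_{j,k})_j$ is non-decreasing. With $\mathbb{K}=\mathbb{R}$ or $\mathbb{C}$ and sequences indexed by $k\ge 0$, the Köthe sequence spaces are the Fréchet spaces $$\lambda^p(A)=\Big\{(x_k)_k\in \mathbb{K}^{\mathbb{N}} : p_j((x_k)_k)=\Big(\sum_{k=0}^{\infty}|x_ka_{j,k}|^p\Big)^{1/p}<\infty \text{ for all } j\ge 1\Big\}\quad(1\le p<\infty)$$ and $$c_0(A)=\Big\{(x_k)_k\in \mathbb{K}^{\mathbb{N}}: \lim_{k\to \infty}|x_k|a_{j,k}=0 \text{ for all } j\ge 1\Big\},\qquad p_j((x_k)_k)= \max_k|x_k|a_{j,k},$$ with the topologies induced by the seminorms $(p_j)_{j\ge1}$. ''With a continuous norm'' means that there is a norm on $X$ continuous for its topology; ''non-normable'' means that $X$ is not a Banach space (its topology is not induced by a single norm). A continuous linear operator $T:Y\to Y$ on a Fréchet space $Y$ possesses a non-trivial invariant subset if there exists a non-empty closed subset $M$ of $Y$, different from $\{0\}$ and $Y$, such that $TM\subset M$. The space $Y$ satisfies the Invariant Subset Property if every continuous linear operator on $Y$ possesses a non-trivial invariant subset. The space $X$ satisfies the Hereditary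 Invariant Subset Property if every closed infinite-dimensional subspace of $X$ satisfies the Invariant Subset Property. *)

(* Defs.v *)
From HB Require Import structures.
From mathcomp Require Import all_boot all_order all_algebra.
From mathcomp Require Import all_classical all_reals all_analysis.
From mathcomp Require Import complex.

Set Implicit Arguments.
Unset Strict Implicit.
Unset Printing Implicit Defensive.

Import Order.TTheory GRing.Theory Num.Theory.
Import numFieldNormedType.Exports.

Local Open Scope classical_set_scope.
Local Open Scope ring_scope.
Local Open Scope convex_scope.

Variant scalar_kind := RealScalars | ComplexScalars.

Definition scalars (R : realType) (s : scalar_kind) : numFieldType :=
  match s with
  | RealScalars => R
  | ComplexScalars => R[i]%C
  end.

(* The library norm of [R[i]] is [R[i]]-valued; [modulus] is its real-valued
   version. *)
Definition modulus (R : realType) (s : scalar_kind) : scalars R s -> R :=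
  match s with
  | RealScalars => fun x : R => `|x|
  | ComplexScalars => fun z : R[i]%C => Normc.normc z
  end.

Section Modulus.
Variables (R : realType) (s : scalar_kind).
Local Notation K := (scalars R s).
Implicit Types x y : K.

Lemma modulus_ge0 x : 0 <= modulus x.
Proof.
by case: s x => /= [x|[a b]]; [exact: normr_ge0|exact: Num.Theory.sqrtr_ge0].
Qed.

Lemma modulus0 : modulus (0 : K) = 0.
Proof. by case: s; [exact: normr0|exact: Normc.normc0]. Qed.

Lemma modulus1 : modulus (1 : K) = 1.
Proof. by case: s; [exact: normr1|exact: Normc.normc1]. Qed.

Lemma modulusM x y : modulus (x * y) = modulus x * modulus y.
Proof. by case: s x y => x y; [exact: normrM|exact: Normc.normcM]. Qed.

Lemma modulusD x y : modulus (x + y) <= modulus x + modulus y.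
Proof. by case: s x y => x y; [exact: ler_normD|exact: le_normcD]. Qed.

Lemma modulus_convex x : 0 <= x -> x <= 1 -> modulus x + modulus (1 - x) = 1.
Proof.
case: s x => [x x0 x1|[a b]].
  by rewrite /= !ger0_norm ?subr_ge0// addrC subrK.
rewrite !lecE/= => /andP[/eqP-> a0] /andP[_ a1].
rewrite subr0 expr0n/= !addr0 !sqrtr_sqr.
by rewrite !ger0_norm ?subr_ge0// addrC subrK.
Qed.

Lemma near_modulus (z : K^o) (e : R) : 0 < e ->
  \forall w \near z, modulus (w - z : K) < e.
Proof.
case: s z => z e0.
  apply/nbhs_ballP; exists e => // w /=.
  by rewrite -ball_normE/= distrC.
apply/nbhs_ballP; exists (e%:C)%C => /=; first by rewrite ltcR.
by move=> w; rewrite -ball_normE/= distrC normc_def ltcR; case: (w - z).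
Qed.

End Modulus.

Section SeminormTopology.
Variables (R : realType) (s : scalar_kind).
Local Notation K := (scalars R s).

Record is_seminorm (V : lmodType K) (N : V -> R) : Prop := IsSeminorm {
  seminorm_ge0 : forall x, 0 <= N x;
  seminormD : forall x y, N (x + y) <= N x + N y;
  seminormZ : forall a x, N (a *: x) = modulus a * N x }.

Definition is_norm (V : lmodType K) (N : V -> R) : Prop :=
  is_seminorm N /\ forall x, N x = 0 -> x = 0.

Definition seminorms_ball (V : lmodType K) (p : nat -> V -> R) (x : V)
    (ne : nat * R) : set V :=
  [set y | forall j, (j <= ne.1)%N -> p j (y - x) < ne.2].

Definition seminorms_nbhs (V : lmodType K) (p : nat -> V -> R) (x : V) :
    set_system V :=
  filter_from [set ne : nat * R | 0 < ne.2] (seminorms_ball p x).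

Section Facts.
Variables (V : lmodType K) (p : nat -> V -> R).
Hypothesis hp : forall j, is_seminorm (p j).

Let p0 j : p j 0 = 0.
Proof. by rewrite -(scale0r 0) (seminormZ (hp j)) modulus0 mul0r. Qed.

Let ball_center x ne : 0 < ne.2 -> seminorms_ball p x ne x.
Proof. by move=> e0 j _; rewrite subrr p0. Qed.

Let ball_sub x n m (e d : R) : (m <= n)%N -> e <= d ->
  seminorms_ball p x (n, e) `<=` seminorms_ball p x (m, d).
Proof.
by move=> mn ed y xy j jm; apply: lt_le_trans ed; exact/xy/(leq_trans jm mn).
Qed.

Lemma seminorms_nbhs_filter x : ProperFilter (seminorms_nbhs p x).
Proof.
apply: filter_from_proper => [|ne ne0]; last by exists x; exact: ball_center.
apply: filter_from_filter; first by exists (0%N, 1); rewrite /= ltr01.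
move=> [n e] [m d] /= e0 d0.
exists (maxn n m, Num.min e d); first by rewrite /= lt_min e0.
move=> y xy; split; apply: ball_sub xy; rewrite ?leq_maxl ?leq_maxr//.
- by rewrite ge_min lexx.
- by rewrite ge_min lexx orbT.
Qed.

Lemma seminorms_nbhs_singleton x A : seminorms_nbhs p x A -> A x.
Proof. by move=> [ne ne0]; apply; exact: ball_center. Qed.

Let slack (n : nat) (f : nat -> R) (e : R) : (forall j, (j <= n)%N -> f j < e) ->
  exists2 d, 0 < d & forall j, (j <= n)%N -> f j + d <= e.
Proof.
elim: n => [|n ih] fe.
  exists (e - f 0%N); first by rewrite subr_gt0 fe.
  by move=> j; rewrite leqn0 => /eqP ->; rewrite addrC subrK.
have [j jn|d d0 hd] := ih; first by apply: fe; rewrite leqW.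
exists (Num.min d (e - f n.+1)); first by rewrite lt_min d0 subr_gt0 fe.
move=> j; rewrite leq_eqVlt => /predU1P[->|].
  by rewrite -lerBrDl ge_min lexx orbT.
by rewrite ltnS => /hd; apply: le_trans; rewrite lerD2l ge_min lexx.
Qed.

Lemma seminorms_ball_open x ne y : seminorms_ball p x ne y ->
  seminorms_nbhs p y (seminorms_ball p x ne).
Proof.
case: ne => n e xy.
have [d d0 hd] := slack xy.
exists (n, d) => // z yz j jn /=.
have -> : z - x = (y - x) + (z - y) by rewrite [RHS]addrC addrA subrK.
apply: le_lt_trans (seminormD (hp j) _ _) _.
by apply: lt_le_trans (hd _ jn); rewrite ltrD2l yz.
Qed.

Lemma seminorms_nbhs_nbhs x A : seminorms_nbhs p x A ->
  seminorms_nbhs p x (seminorms_nbhs p ^~ A).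
Proof.
move=> [ne ne0 neA]; exists ne => // y /seminorms_ball_open[ne' ne'0 yA].
by exists ne' => // z /yA /neA.
Qed.

End Facts.

Section TvsFacts.
Variables (E : preTopologicalLmodType K) (p : nat -> E -> R).
Hypothesis hp : forall j, is_seminorm (p j).
Hypothesis nbhsp : forall x : E, nbhs x = seminorms_nbhs p x.

Let near_ball (x : E) n e : 0 < e ->
  nbhs x (seminorms_ball p x (n, e)).
Proof. by move=> e0; rewrite nbhsp; exists (n, e). Qed.

Lemma seminorms_add_continuous : continuous (fun x : E * E => x.1 + x.2).
Proof.
move=> [x y] A /= xyA0; have : nbhs (x + y) A := xyA0; rewrite nbhsp => -[[n e] /= e0 xyA].
have e20 : 0 < e / 2 by rewrite divr_gt0.
exists (seminorms_ball p x (n, e / 2), seminorms_ball p y (n, e / 2)) => /=.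
  by split; exact: near_ball.
move=> [u v] [/= xu yv]; apply: xyA => j jn /=.
rewrite opprD addrACA; apply: le_lt_trans (seminormD (hp j) _ _) _.
by rewrite (splitr e); apply: ltrD; [exact: xu|exact: yv].
Qed.

Lemma seminorms_scale_continuous :
  continuous (fun z : K^o * E => z.1 *: z.2).
Proof.
move=> [a x] A /= axA0; have : nbhs (a *: x) A := axA0; rewrite nbhsp => -[[n e] /= e0 axA].
pose M := 1 + \sum_(j < n.+1) p j x.
have pM j : (j <= n)%N -> p j x <= M.
  move=> jn; rewrite /M (bigD1 (Ordinal (jn : j < n.+1)%N))//= addrCA.
  rewrite lerDl addr_ge0// sumr_ge0// => i _.
  exact: seminorm_ge0.
have M0 : 0 < M.
  by rewrite ltr_pwDl// sumr_ge0// => i _; exact: seminorm_ge0.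
pose d := e / 2 / M.
pose m := modulus a + d.
have d0 : 0 < d by rewrite !divr_gt0.
have m0 : 0 < m by rewrite ltr_wpDl// modulus_ge0.
exists ([set b | modulus (b - a : K) < d], seminorms_ball p x (n, e / 2 / m)).
  split => /=; first exact: near_modulus.
  by apply: near_ball; rewrite !divr_gt0.
move=> [b y] [/= ab xy]; apply: axA => j jn /=.
have -> : b *: y - a *: x = b *: (y - x) + (b - a) *: x.
  by rewrite scalerBr scalerBl addrA subrK.
apply: le_lt_trans (seminormD (hp j) _ _) _; rewrite !(seminormZ (hp j)).
have bm : modulus (b : K) <= m.
  have {1}-> : b = a + (b - a) by rewrite addrC subrK.
  by apply: le_trans (modulusD _ _) _; rewrite lerD2l ltW.
rewrite (splitr e); apply: ltr_leD.
  apply: le_lt_trans (ler_wpM2r _ bm) _; first exact: seminorm_ge0.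
  by rewrite mulrC -ltr_pdivlMr// xy.
have -> : e / 2 = d * M by rewrite divfK// gt_eqF.
by apply: ler_pM;
  [exact: modulus_ge0|exact: seminorm_ge0|exact: ltW|exact: pM].
Qed.

Lemma seminorms_locally_convex : exists2 B : set_system E,
  (forall b, b \in B -> convex_set b) & basis B.
Proof.
exists [set b | exists x ne, b = seminorms_ball p x ne].
  move=> b /[!inE] -[x [[n e] ->]] y z l.
  rewrite !inE => xy xz j jn /=.
  set a := l%:num.
  have -> : (y : convex_lmodType _) <| l |> z - x
      = a *: (y - x) + (1 - a) *: (z - x).
    rewrite !scalerBr addrACA -opprD -scalerDl (addrC a) subrK scale1r.
    by [].
  apply: (le_lt_trans (seminormD (hp j) _ _)); rewrite !(seminormZ (hp j)).
  have a1 : modulus a + modulus (1 - a) = 1.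
    by apply: modulus_convex; rewrite /a.
  have : 0 <= modulus a by exact: modulus_ge0.
  rewrite le_eqVlt => /predU1P[a0|a0].
    by move: a1; rewrite -a0 add0r => ->; rewrite mul0r add0r mul1r xz.
  rewrite -[e]mul1r -a1 mulrDl; apply: ltr_leD; first by rewrite ltr_pM2l ?xy.
  by rewrite ler_wpM2l ?modulus_ge0// ltW ?xz.
split.
  move=> b [x [ne ->]]; rewrite openE => y xy; rewrite /interior nbhsp.
  exact: seminorms_ball_open xy.
move=> x A; rewrite nbhsp => -[ne ne0 neA].
exists (seminorms_ball p x ne) => //; split; first by exists x, ne.
by apply: (seminorms_nbhs_singleton hp); exists ne.
Qed.

End TvsFacts.
End SeminormTopology.

(* Row [j] stands for the seminorm of index [j + 1] of the usual indexing by
   positive integers. *)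
Record koethe_matrix (R : realType) := KoetheMatrix {
  koethe_entry :> nat -> nat -> R;
  koethe_ge0 : forall j k, 0 <= koethe_entry j k;
  koethe_neq0 : forall k, exists j, 0 < koethe_entry j k;
  koethe_nondecreasing :
    forall k i j, (i <= j)%N -> koethe_entry i k <= koethe_entry j k }.

Section KoetheSpaces.
Variables (R : realType) (s : scalar_kind) (A : koethe_matrix R).
Local Notation K := (scalars R s).
Implicit Types x y : nat -> K^o.

Definition lp_eseminorm (p : R) (j : nat) x : \bar R :=
  ((\sum_(0 <= k <oo) ((modulus (x k) * A j k) `^ p)%:E) `^ p^-1)%E.

Definition koethe_lp_set (p : R) : set (nat -> K^o) :=
  [set x | forall j, (lp_eseminorm p j x < +oo)%E].

Definition koethe_c0_set : set (nat -> K^o) :=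
  [set x | forall j, (fun k => modulus (x k) * A j k) @ \oo --> (0 : R)].

Lemma lp_eseminorm_ge0 p j x : (0 <= lp_eseminorm p j x)%E.
Proof. exact: poweR_ge0. Qed.

Lemma lp_eseminormE p j x : 1 <= p -> lp_eseminorm p j x =
  Lnorm counting p%:E (EFin \o (fun k => modulus (x k) * A j k)).
Proof.
move=> p1; rewrite Lnorm_counting ?(lt_le_trans ltr01)//.
congr (_ `^ _)%E; apply: eq_eseriesr => k _ /=.
by rewrite ger0_norm// mulr_ge0 ?modulus_ge0 ?koethe_ge0.
Qed.

Lemma lp_eseminormZ p j (a : K) x : 1 <= p ->
  lp_eseminorm p j (a *: x) = ((modulus a)%:E * lp_eseminorm p j x)%E.
Proof.
move=> p1; have p0 : 0 < p by exact: lt_le_trans p1.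
rewrite /lp_eseminorm.
under eq_eseriesr => k _.
  rewrite [modulus _]modulusM -mulrA powRM ?mulr_ge0 ?modulus_ge0 ?koethe_ge0//.
  rewrite EFinM.
  over.
rewrite nneseriesZl; last by move=> k _; rewrite lee_fin powR_ge0.
rewrite poweRM ?lee_fin ?powR_ge0//; last first.
  by apply: nneseries_ge0 => k _ _; rewrite lee_fin powR_ge0.
by rewrite poweR_EFin -powRrM divff ?gt_eqF// powRr1 ?modulus_ge0.
Qed.

Lemma lp_eseminormD p j x y : 1 <= p ->
  (lp_eseminorm p j (x + y)%R <= lp_eseminorm p j x + lp_eseminorm p j y)%E.
Proof.
move=> p1; rewrite (lp_eseminormE j x p1) (lp_eseminormE j y p1).
apply: le_trans (eminkowski _ _ _ _) => //.
have p0 : 0 < p by exact: lt_le_trans p1.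
have m0 (z : nat -> K^o) k : 0 <= modulus (z k) * A j k.
  by rewrite mulr_ge0 ?modulus_ge0 ?koethe_ge0.
rewrite Lnorm_counting//; apply: gt0_ler_poweR.
- by rewrite invr_ge0 ltW.
- by rewrite in_itv/= leey andbT nneseries_ge0// => k _ _; rewrite lee_fin powR_ge0.
- by rewrite in_itv/= leey andbT nneseries_ge0// => k _ _; rewrite poweR_ge0.
apply: lee_nneseries => k _; first by rewrite lee_fin powR_ge0.
rewrite /= lee_fin ger0_norm ?addr_ge0//; apply: ge0_ler_powR.
- exact: ltW.
- by rewrite nnegrE.
- by rewrite nnegrE addr_ge0.
by rewrite -mulrDl; apply: ler_wpM2r; [exact: koethe_ge0|exact: modulusD].
Qed.

Lemma koethe_lp_submod p : 1 <= p -> submod_closed (mem (koethe_lp_set p)).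
Proof.
move=> p1; split.
  rewrite inE => j; rewrite -(scale0r 0) lp_eseminormZ// modulus0 mul0e.
  exact: ltry.
move=> a x y; rewrite !inE => hx hy j.
apply: le_lt_trans (lp_eseminormD _ _ _ p1) _.
rewrite lte_add_pinfty// lp_eseminormZ// lte_mul_pinfty//.
by rewrite lee_fin modulus_ge0.
Qed.

Lemma koethe_c0_submod : submod_closed (mem koethe_c0_set).
Proof.
split.
  rewrite inE => j; apply: cvg_near_cst; near=> k.
  by rewrite [modulus _]modulus0 mul0r.
move=> a x y; rewrite !inE => hx hy j.
apply: (@squeeze_cvgr _ _ _ _ (fun=> 0)
    (fun k => modulus a * (modulus (x k) * A j k) + modulus (y k) * A j k)).
- near=> k; rewrite mulr_ge0 ?modulus_ge0 ?koethe_ge0//= mulrA -mulrDl.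
  rewrite ler_wpM2r ?koethe_ge0//.
  by apply: le_trans (modulusD _ _) _; rewrite [modulus (_ *: _)]modulusM.
- exact: cvg_cst.
- rewrite -[X in _ --> X](addr0 (0 : R)) -[X in _ --> X + _](mulr0 (modulus a)).
  by apply: cvgD (hy j); apply: cvgMr; exact: hx.
Unshelve. all: by end_near. Qed.

End KoetheSpaces.

(* The proof of [1 <= p] is a parameter of the type so that the vector space
   and topological structures, which depend on it, can be inferred. *)
Record koethe_lp (R : realType) (s : scalar_kind) (A : koethe_matrix R) (p : R)
    (p1 : 1 <= p) := KoetheLp {
  koethe_lp_val :> nat -> (scalars R s)^o;
  koethe_lpP : koethe_lp_val \in koethe_lp_set A p }.

Section KoetheLp.
Variables (R : realType) (s : scalar_kind) (A : koethe_matrix R) (p : R).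
Variable (p1 : 1 <= p).
Local Notation K := (scalars R s).
Local Notation X := (koethe_lp s A p1).

HB.instance Definition _ := [isSub for @koethe_lp_val R s A p p1].
HB.instance Definition _ := [Choice of X by <:].
HB.instance Definition _ := GRing.SubChoice_isSubLmodule.Build
  K (nat -> K^o) (mem (koethe_lp_set A p)) X
  (GRing.submod_closed_semi (koethe_lp_submod s A p1)).

Definition lp_seminorm (j : nat) (x : X) : R := fine (lp_eseminorm A p j x).

Let lp_seminormE j (x : X) : (lp_seminorm j x)%:E = lp_eseminorm A p j x.
Proof.
rewrite /lp_seminorm fineK// ge0_fin_numE ?lp_eseminorm_ge0//.
by have := koethe_lpP x; rewrite inE; exact.
Qed.

Lemma lp_seminorm_is_seminorm j : is_seminorm (lp_seminorm j).
Proof.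
split=> [x|x y|a x].
- by rewrite -lee_fin lp_seminormE lp_eseminorm_ge0.
- by rewrite -lee_fin EFinD !lp_seminormE; exact: lp_eseminormD.
- by apply: EFin_inj; rewrite EFinM !lp_seminormE; exact: lp_eseminormZ.
Qed.

HB.instance Definition _ := hasNbhs.Build X (seminorms_nbhs lp_seminorm).
HB.instance Definition _ := Nbhs_isNbhsTopological.Build X
  (seminorms_nbhs_filter lp_seminorm_is_seminorm)
  (seminorms_nbhs_singleton lp_seminorm_is_seminorm)
  (seminorms_nbhs_nbhs lp_seminorm_is_seminorm).
(* This factory only produces the uniform structure. *)
HB.instance Definition _ := PreTopologicalLmod_isTvs.Build K X
  (seminorms_add_continuous lp_seminorm_is_seminorm (fun=> erefl))
  (seminorms_scale_continuous lp_seminorm_is_seminorm (fun=> erefl))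
  (seminorms_locally_convex lp_seminorm_is_seminorm (fun=> erefl)).
HB.instance Definition _ := PreTopologicalNmodule_isTopologicalNmodule.Build X
  (seminorms_add_continuous lp_seminorm_is_seminorm (fun=> erefl)).
HB.instance Definition _ := TopologicalNmodule_isTopologicalLmodule.Build K X
  (seminorms_scale_continuous lp_seminorm_is_seminorm (fun=> erefl)).
HB.instance Definition _ := Uniform_isTvs.Build K X
  (seminorms_locally_convex lp_seminorm_is_seminorm (fun=> erefl)).

End KoetheLp.

Record koethe_c0 (R : realType) (s : scalar_kind) (A : koethe_matrix R) :=
  KoetheC0 {
  koethe_c0_val :> nat -> (scalars R s)^o;
  koethe_c0P : koethe_c0_val \in koethe_c0_set A }.

Section KoetheC0.
Variables (R : realType) (s : scalar_kind) (A : koethe_matrix R).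
Local Notation K := (scalars R s).
Local Notation X := (koethe_c0 s A).

HB.instance Definition _ := [isSub for @koethe_c0_val R s A].
HB.instance Definition _ := [Choice of X by <:].
HB.instance Definition _ := GRing.SubChoice_isSubLmodule.Build
  K (nat -> K^o) (mem (koethe_c0_set A)) X
  (GRing.submod_closed_semi (koethe_c0_submod s A)).

(* The supremum is a maximum: the terms are nonnegative and tend to [0]. *)
Definition c0_seminorm (j : nat) (x : X) : R :=
  sup (range (fun k => modulus (x k : K) * A j k)).

Let term_ge0 j (x : X) k : 0 <= modulus (x k : K) * A j k.
Proof. by rewrite mulr_ge0 ?modulus_ge0 ?koethe_ge0. Qed.

Let range_sup j (x : X) : has_sup (range (fun k => modulus (x k : K) * A j k)).
Proof.
split; first by exists (modulus (x 0%N : K) * A j 0%N); exists 0%N.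
have := koethe_c0P x; rewrite inE => /(_ j) /cvgP /cvg_seq_bounded.
move=> [M [_ hM]]; exists (M + 1) => _ [k _ <-].
by apply: le_trans (ler_norm _) _; apply: hM => //; rewrite ltrDl.
Qed.

Let c0_ub j (x : X) k : modulus (x k : K) * A j k <= c0_seminorm j x.
Proof. by apply: sup_upper_bound => //; exists k. Qed.

Let c0_le j (x : X) M :
  (forall k, modulus (x k : K) * A j k <= M) -> c0_seminorm j x <= M.
Proof.
move=> hM; apply: sup_le_ub; first by case: (range_sup j x).
by move=> _ [k _ <-].
Qed.

Lemma c0_seminorm_is_seminorm j : is_seminorm (c0_seminorm j).
Proof.
have c0_ge0 x : 0 <= c0_seminorm j x by apply: le_trans (c0_ub j x 0%N).
have leZ a x : c0_seminorm j (a *: x) <= modulus a * c0_seminorm j x.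
  apply: c0_le => k; rewrite [modulus _]modulusM -mulrA.
  by apply: ler_wpM2l; [exact: modulus_ge0|exact: c0_ub].
split=> // [x y|a x].
- apply: c0_le => k; apply: le_trans (lerD (c0_ub j x k) (c0_ub j y k)).
  by rewrite -mulrDl; apply: ler_wpM2r; [exact: koethe_ge0|exact: modulusD].
- apply/eqP; rewrite eq_le leZ/=.
  have [->|a0] := eqVneq a 0; first by rewrite modulus0 mul0r.
  have := leZ a^-1 (a *: x); rewrite scalerA mulVf// scale1r => h.
  apply: le_trans (ler_wpM2l (modulus_ge0 a) h) _.
  by rewrite mulrA -modulusM mulfV// modulus1 mul1r.
Qed.

HB.instance Definition _ := hasNbhs.Build X (seminorms_nbhs c0_seminorm).
HB.instance Definition _ := Nbhs_isNbhsTopological.Build X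
  (seminorms_nbhs_filter c0_seminorm_is_seminorm)
  (seminorms_nbhs_singleton c0_seminorm_is_seminorm)
  (seminorms_nbhs_nbhs c0_seminorm_is_seminorm).
HB.instance Definition _ := PreTopologicalLmod_isTvs.Build K X
  (seminorms_add_continuous c0_seminorm_is_seminorm (fun=> erefl))
  (seminorms_scale_continuous c0_seminorm_is_seminorm (fun=> erefl))
  (seminorms_locally_convex c0_seminorm_is_seminorm (fun=> erefl)).
HB.instance Definition _ := PreTopologicalNmodule_isTopologicalNmodule.Build X
  (seminorms_add_continuous c0_seminorm_is_seminorm (fun=> erefl)).
HB.instance Definition _ := TopologicalNmodule_isTopologicalLmodule.Build K X
  (seminorms_scale_continuous c0_seminorm_is_seminorm (fun=> erefl)).
HB.instance Definition _ := Uniform_isTvs.Build K X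
  (seminorms_locally_convex c0_seminorm_is_seminorm (fun=> erefl)).

End KoetheC0.

Section LinearSubspaces.
Variables (K : numFieldType) (X : preTopologicalLmodType K).

Definition linear_subspace (Y : set X) : Prop := submod_closed (mem Y).

Record subspace_type (Y : set X) (hY : linear_subspace Y) := SubspaceType {
  subspace_val :> X;
  subspaceP : subspace_val \in Y }.

Variables (Y : set X) (hY : linear_subspace Y).

HB.instance Definition _ := [isSub for @subspace_val Y hY].
HB.instance Definition _ := [Choice of subspace_type hY by <:].
HB.instance Definition _ := GRing.SubChoice_isSubLmodule.Build
  K X (mem Y) (subspace_type hY) (GRing.submod_closed_semi hY).
HB.instance Definition _ := Topological.copy (subspace_type hY)
  (initial_topology (@subspace_val Y hY)).

End LinearSubspaces.

Section InvariantSubsets.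
Variable K : numFieldType.

Definition finite_dimensional (E : lmodType K) : Prop :=
  exists (n : nat) (v : 'I_n -> E),
    forall y : E, exists c : 'I_n -> K, y = \sum_(i < n) c i *: v i.

Definition has_nontrivial_invariant_subset (Y : preTopologicalLmodType K)
    (T : Y -> Y) : Prop :=
  exists M : set Y,
    [/\ M !=set0, closed M, M <> [set 0], M <> setT & T @` M `<=` M].

Definition invariant_subset_property (Y : preTopologicalLmodType K) : Prop :=
  forall T : {linear Y -> Y}, continuous T -> has_nontrivial_invariant_subset T.

Definition hereditary_invariant_subset_property
    (X : preTopologicalLmodType K) : Prop :=
  forall (Y : set X) (hY : linear_subspace Y), closed Y ->
    ~ finite_dimensional (subspace_type hY) ->
    invariant_subset_property (subspace_type hY).

End InvariantSubsets.

Section Norms.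
Variables (R : realType) (s : scalar_kind).
Local Notation K := (scalars R s).

Definition has_continuous_norm (X : preTopologicalLmodType K) : Prop :=
  exists N : X -> R, is_norm N /\ continuous N.

Definition normable (X : preTopologicalLmodType K) : Prop :=
  exists N : X -> R, is_norm N /\
    forall x : X, nbhs x =
      filter_from [set e : R | 0 < e] (fun e => [set y | N (y - x) < e]).

End Norms.

(* Main.v *)
Require Import Defs.
From HB Require Import structures.
From mathcomp Require Import all_boot all_order all_algebra.
From mathcomp Require Import all_classical all_reals all_analysis.
From mathcomp Require Import complex.
From mathcomp Require Import zify ring lra.

(** A continuous norm on the space forces the weights [a l k] to be positive
    from some index [l] on, and non-normability prevents any seminorm from
    dominating all the others. Thinning out the seminorms, one may assume that
    all the weights are positive and that [a l.+1 k / a l k] is unbounded in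
    [k] for every [l] ([ks_good_subsequence]). It then suffices to find a closed
    subspace of infinite dimension and a continuous operator on it for which
    all nonzero vectors have a dense orbit: a closed invariant set that contains
    a nonzero vector is the whole subspace.

    The subspace is the closed span of vectors [v n], each of which is a
    combination of two unit vectors of the space; no unit vector serves twice.
    The finite combinations of the [v n] are identified with the polynomials by
    a basis [fan_poly Q n] of monic polynomials of degree [n], and the
    operator is the multiplication by the variable. The indices are cut into
    blocks. Inside block [k] the basis polynomial is ['X^n], except at
    the end of the block, in the fan, where it is ['X^j * ('X^c - Q k)] with
    [c = fan_start k]. The vectors of the fan are tiny for the seminorms of
    index at most [foc k], so that the power ['X^c] acts nearly as the
    multiplication by [Q k]. Every pair of an index and a polynomial with
    rational coefficients is [(foc k, Q k)] for infinitely many [k]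
    ([schedule_exists]).

    The orbit of [1] is therefore dense ([orbit_one_dense]), and it remains to
    return from an arbitrary nonzero vector [x] to the vicinity of [1]
    ([orbit_near_one]). A fan with [Q k = 1] makes some power ['X^a] close to
    [1]. Let [P] be the truncation of [x] after this fan. One of the
    coefficients of low degree of [P] is not negligible, so there is a
    polynomial [U] without constant term such that [U * P] is ['X^a], up to
    small coefficients and to terms of large degree ([approx_inverse]). A later
    fan with [Q k] close to [U] provides a power ['X^c] that acts nearly as [U]
    on [P], so ['X^c * P] is close to [U * P], hence to ['X^a] and to [1].
    The bound on [U] depends only on what has been chosen before the truncation,
    and the weights of the later indices are chosen after it: this is why
    ['X^c] sends the rest of [x] to a small vector ([jump_tail]).

    The last point rests on [shift_le]: on the basis vectors of a late block the
    multiplication by a low power of the variable is bounded, with a small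
    constant, from the norm of index [l.+1] to the norm of index [l]. The
    requirements conflict: the basis vectors must be small at the beginning of
    the block and in the fan, but huge just before the fan, where a
    power of the variable brings [Q k] back. As consecutive
    seminorms have unbounded ratios, the weights of a component of a [v n] can
    be made negligible up to any prescribed level and huge from the next one on
    ([selection]). The level of the second components decreases from [k] to [0]
    along the block, by one from each window to the next, so that a shift
    never loses more than one index; the first components, which are negligible
    up to level [k], give the lower bounds to which the other weights are
    compared ([weights_for_schedule]). *)

Set Implicit Arguments.
Unset Strict Implicit.
Unset Printing Implicit Defensive.

Import Order.TTheory GRing.Theory Num.Theory.
Import numFieldNormedType.Exports.

Local Open Scope ring_scope.

(** * The modulus of a scalar *)

Section ModulusFacts.
Variables (R : realType) (s : scalar_kind).
Local Notation K := (scalars R s).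
Implicit Types x y z : K.

Lemma modulusN x : modulus (- x) = modulus x.
Proof.
by case: s x => x /=; [exact: normrN|case: x => a b /=; rewrite !sqrrN].
Qed.

Lemma modulusB x y : modulus (x - y) <= modulus x + modulus y.
Proof. by apply: le_trans (modulusD _ _) _; rewrite modulusN. Qed.

Lemma modulusBC x y : modulus (x - y) = modulus (y - x).
Proof. by rewrite -modulusN opprB. Qed.

Lemma modulus_eq0 x : modulus x = 0 -> x = 0.
Proof. by case: s x => x /=; [exact: normr0_eq0|exact: Normc.eq0_normc]. Qed.

Lemma modulus_gt0 x : x != 0 -> 0 < modulus x.
Proof.
move=> x0; rewrite lt_neqAle modulus_ge0 andbT eq_sym.
by apply: contra_neq x0; exact: modulus_eq0.
Qed.

Lemma modulusV x : x != 0 -> modulus x^-1 = (modulus x)^-1.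
Proof.
move=> x0; apply: (mulfI (lt0r_neq0 (modulus_gt0 x0))).
by rewrite -modulusM !divff ?modulus1// lt0r_neq0// modulus_gt0.
Qed.

Lemma modulus_sum (I : Type) (r : seq I) (P : pred I) (F : I -> K) :
  modulus (\sum_(i <- r | P i) F i) <= \sum_(i <- r | P i) modulus (F i).
Proof.
elim/big_rec2: _ => [|i y x _ h]; first by rewrite modulus0.
by apply: le_trans (modulusD _ _) _; rewrite lerD2l.
Qed.

Lemma modulus_surj (r : R) : 0 <= r -> exists c : K, modulus c = r.
Proof.
move=> r0; case: s; first by exists r; rewrite /= ger0_norm.
by exists (r%:C)%C; rewrite /= expr0n/= addr0 sqrtr_sqr ger0_norm.
Qed.

(** The codes have the same type for both fields, so that the schedule below
    does not depend on the field; over the reals the second rational is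
    dropped. *)
Definition scalar_of_rats (q : rat * rat) : K :=
  match s with
  | RealScalars => ratr q.1
  | ComplexScalars => (ratr q.1 +i* ratr q.2)%C
  end.

Lemma normc_le_norms (a b : R) : Normc.normc (a +i* b)%C <= `|a| + `|b|.
Proof.
rewrite /= -(ger0_norm (addr_ge0 (normr_ge0 a) (normr_ge0 b))) -sqrtr_sqr.
rewrite ler_wsqrtr// sqrrD !real_normK ?num_real// -addrA lerD2l lerDr.
by rewrite mulrn_wge0// mulr_ge0.
Qed.

Lemma norm_Re_le_normc (a b : R) : `|a| <= Normc.normc (a +i* b)%C.
Proof. by rewrite /= -sqrtr_sqr ler_wsqrtr// lerDl sqr_ge0. Qed.

Lemma norm_Im_le_normc (a b : R) : `|b| <= Normc.normc (a +i* b)%C.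
Proof. by rewrite /= -sqrtr_sqr ler_wsqrtr// lerDr sqr_ge0. Qed.

Lemma rat_approx (x e : R) : 0 < e -> exists q : rat, `|x - ratr q| < e.
Proof.
move=> e0; have [|q +] := @rat_in_itvoo _ (x - e) (x + e).
  by lra.
by rewrite in_itv /= -ltr_distlC => h; exists q.
Qed.

Lemma scalar_of_rats_dense x (e : R) : 0 < e ->
  exists q, modulus (x - scalar_of_rats q) < e.
Proof.
rewrite /scalar_of_rats; case: s x => x e0.
  by have [q hq] := rat_approx x e0; exists (q, 0).
case: x => a b; have e20 : 0 < e / 2 by rewrite divr_gt0.
have [q hq] := rat_approx a e20; have [r hr] := rat_approx b e20.
exists (q, r) => /=; apply: le_lt_trans (normc_le_norms _ _) _.
by rewrite (splitr e) ltrD.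
Qed.

Lemma scalar_of_rats0 : scalar_of_rats (0, 0) = 0.
Proof. by rewrite /scalar_of_rats; case: s; rewrite /= raddf0. Qed.

Lemma scalar_of_rats1 : scalar_of_rats (1, 0) = 1.
Proof. by rewrite /scalar_of_rats; case: s; rewrite /= rmorph1 ?raddf0. Qed.

Lemma real_cauchy (u : nat -> R) :
  (forall e : R, 0 < e -> exists N, forall m n, (N <= m)%N -> (N <= n)%N ->
    `|u m - u n| <= e) ->
  exists l : R, forall e : R, 0 < e -> exists N, forall n, (N <= n)%N ->
    `|u n - l| <= e.
Proof.
move=> h; have /cvg_ex[z uz] : cvgn u.
  apply/cauchy_cvgP/cauchy_exP => e e0.
  have [N hN] := h _ (divr_gt0 e0 (ltr0n R 2)).
  exists (u N); exists N => // n /= Nn; rewrite -ball_normE /=.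
  by apply: le_lt_trans (hN _ _ (leqnn N) Nn) _; rewrite ltr_pdivrMr// ltr_pMr// ltr1n.
exists z => e e0; move/cvgrPdist_le : uz => /(_ _ e0)[N _ hN].
by exists N => n Nn; rewrite distrC; exact: hN.
Qed.

Lemma scalar_cauchy (u : nat -> K) :
  (forall e : R, 0 < e -> exists N, forall m n, (N <= m)%N -> (N <= n)%N ->
    modulus (u m - u n) <= e) ->
  exists z, forall e, 0 < e -> exists N, forall n, (N <= n)%N ->
    modulus (u n - z) <= e.
Proof.
case: s u => u h; first exact: real_cauchy.
have [a ha] : exists a, forall e, 0 < e -> exists N, forall n, (N <= n)%N ->
    `|complex.Re (u n) - a| <= e.
  apply: real_cauchy => e e0; have [N hN] := h _ e0; exists N => m n Nm Nn.
  move: (hN m n Nm Nn); case: (u m) (u n) => [a b] [c d] /=.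
  exact/le_trans/norm_Re_le_normc.
have [b hb] : exists b, forall e, 0 < e -> exists N, forall n, (N <= n)%N ->
    `|complex.Im (u n) - b| <= e.
  apply: real_cauchy => e e0; have [N hN] := h _ e0; exists N => m n Nm Nn.
  move: (hN m n Nm Nn); case: (u m) (u n) => [a' b] [c d] /=.
  exact/le_trans/norm_Im_le_normc.
exists (a +i* b)%C => e e0; have e20 : 0 < e / 2 by rewrite divr_gt0.
have [N hN] := ha _ e20; have [N' hN'] := hb _ e20.
exists (maxn N N') => n; rewrite geq_max => /andP[/hN hn /hN' hn'].
move: hn hn'; case: (u n) => [c d] /= hn hn'.
by apply: le_trans (normc_le_norms _ _) _; rewrite (splitr e) lerD.
Qed.

End ModulusFacts.

(** * Blocks of indices *)

Section Blocks.
Local Open Scope nat_scope.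

Definition window_of (M k : nat) := M.+1 + k.+1 * (2 * M).+1.

(** Block [k] is the interval of indices after [block_end k] up to
    [block_end k.+1]. It starts with [k.+1] windows of length
    [2 * block_end k + 1] and ends with a fan of [block_end k + 1] indices:
    the fan is long enough to hold a translated copy of everything that
    precedes the block, and a window is longer than any shift by at most
    [2 * block_end k]. *)
Fixpoint block_end (k : nat) : nat :=
  if k is k'.+1 then window_of (block_end k') k' + block_end k' else 0.

Definition fan_start (k : nat) := window_of (block_end k) k.

Lemma block_endS k : block_end k.+1 = fan_start k + block_end k.
Proof. by []. Qed.

Lemma fan_startE k :
  fan_start k = (block_end k).+1 + k.+1 * (2 * block_end k).+1.
Proof. by []. Qed.

Lemma fan_start_gt k : 3 * block_end k + 1 < fan_start k.
Proof. rewrite fan_startE; nia. Qed.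

Lemma block_end_lt k : block_end k < block_end k.+1.
Proof. rewrite block_endS; have := fan_start_gt k; lia. Qed.

Lemma block_end_mono k l : k <= l -> block_end k <= block_end l.
Proof.
by move/subnK<-; elim: (l - k) => // n /leq_trans; apply; exact/ltnW/block_end_lt.
Qed.

Lemma leq_block_end k : k <= block_end k.
Proof. by elim: k => // k /leq_ltn_trans; apply; exact: block_end_lt. Qed.

Lemma block_of_subproof n : exists k, n <= block_end k.+1.
Proof. by exists n; exact: leq_trans (leq_block_end n) (ltnW (block_end_lt n)). Qed.

Definition block_of (n : nat) := ex_minn (block_of_subproof n).

Lemma block_ofP n : 0 < n ->
  block_end (block_of n) < n <= block_end (block_of n).+1.
Proof.
rewrite /block_of; case: ex_minnP => -[|k] -> kmin n0; rewrite andbT//.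
by rewrite ltnNge; apply/negP => /kmin; rewrite ltnn.
Qed.

Lemma block_ofE k n : block_end k < n <= block_end k.+1 -> block_of n = k.
Proof.
move=> /andP[kn nk]; rewrite /block_of; case: ex_minnP => m nm mmin.
have mk := mmin _ nk; apply/eqP; rewrite eqn_leq mk leqNgt; apply/negP => lt_mk.
by have := leq_trans (leq_trans kn nm) (block_end_mono lt_mk); rewrite ltnn.
Qed.

Lemma block_case n : [\/ n = 0,
  exists2 k, block_of n = k & block_end k < n < fan_start k |
  exists k j, [/\ block_of n = k, j <= block_end k & n = fan_start k + j]].
Proof.
case: (posnP n) => [->|n0]; [exact: Or31|].
have /andP[h1 h2] := block_ofP n0.
case: (ltnP n (fan_start (block_of n))) => h.
  by apply: Or32; exists (block_of n) => //; rewrite h1.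
apply: Or33; exists (block_of n), (n - fan_start (block_of n)); split=> //.
  by rewrite leq_subLR -block_endS.
by rewrite subnKC.
Qed.

End Blocks.

Arguments block_end : simpl never.

(** * Coefficient norm of a polynomial *)

Section CoefNorm.
Variables (R : realType) (s : scalar_kind).
Local Notation K := (scalars R s).
Implicit Types f g : {poly K}.

Lemma seminorm0 (V : lmodType K) (N : V -> R) : is_seminorm N -> N 0 = 0.
Proof.
by move=> hN; rewrite -(scale0r 0) (seminormZ hN) modulus0 mul0r.
Qed.

Lemma seminormN (V : lmodType K) (N : V -> R) x : is_seminorm N ->
  N (- x) = N x.
Proof.
by move=> hN; rewrite -scaleN1r (seminormZ hN) modulusN modulus1 mul1r.
Qed.

Lemma seminormB (V : lmodType K) (N : V -> R) x y : is_seminorm N ->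
  N (x - y) <= N x + N y.
Proof.
by move=> hN; apply: le_trans (seminormD hN _ _) _; rewrite (seminormN _ hN).
Qed.

Lemma seminorm_sum (V : lmodType K) (N : V -> R) (I : Type) (r : seq I)
    (P : pred I) (F : I -> V) : is_seminorm N ->
  N (\sum_(i <- r | P i) F i) <= \sum_(i <- r | P i) N (F i).
Proof.
move=> hN; elim/big_rec2: _ => [|i y x _ h]; first by rewrite (seminorm0 hN).
by apply: le_trans (seminormD hN _ _) _; rewrite lerD2l.
Qed.

Definition coef_norm f : R := \sum_(i < size f) modulus f`_i.

Lemma coef_normE f n : (size f <= n)%N ->
  coef_norm f = \sum_(i < n) modulus f`_i.
Proof.
move=> fn; rewrite /coef_norm (big_ord_widen n (fun i => modulus f`_i)) //.
rewrite big_mkcond; apply: eq_bigr => i _; case: ltnP => // h.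
by rewrite nth_default// modulus0.
Qed.

Lemma modulus_coef_le f i : modulus f`_i <= coef_norm f.
Proof.
case: (ltnP i (size f)) => [h|h]; last first.
  by rewrite nth_default// modulus0 sumr_ge0// => j _; exact: modulus_ge0.
rewrite /coef_norm (bigD1 (Ordinal h))//= lerDl sumr_ge0// => j _.
exact: modulus_ge0.
Qed.

Lemma coef_norm_is_seminorm : is_seminorm coef_norm.
Proof.
split=> [f|f g|a f].
- by apply: sumr_ge0 => i _; exact: modulus_ge0.
- have h := size_polyD f g.
  rewrite (coef_normE h) (coef_normE (leq_maxl _ (size g))).
  rewrite (coef_normE (leq_maxr (size f) _)) -big_split/=; apply: ler_sum => i _.
  by rewrite coefD modulusD.
- rewrite (coef_normE (size_scale_leq a f)) /coef_norm mulr_sumr.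
  by apply: eq_bigr => i _; rewrite coefZ modulusM.
Qed.

Lemma coef_norm_ge0 f : 0 <= coef_norm f.
Proof. exact: seminorm_ge0 coef_norm_is_seminorm f. Qed.

Lemma poly_sumE f n : (size f <= n)%N -> f = \sum_(i < n) f`_i *: 'X^i.
Proof.
move=> fn; rewrite -poly_def; apply/polyP => i; rewrite coef_poly.
by case: ltnP => // h; rewrite nth_default// (leq_trans fn).
Qed.

(** Only the powers of the variable that occur in [f] matter: the lemma is used
    with polynomials of bounded degree, some of which have no constant term. *)
Lemma seminorm_mul_le (N : {poly K} -> R) f g D : is_seminorm N ->
  (forall i, (i < size f)%N -> f`_i != 0 -> N ('X^i * g) <= D) ->
  N (f * g) <= coef_norm f * D.
Proof.
move=> hN hD; rewrite {1}(@poly_sumE f _ (leqnn _)) mulr_suml.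
apply: le_trans (seminorm_sum _ _ _ hN) _; rewrite mulr_suml.
apply: ler_sum => i _; rewrite -scalerAl (seminormZ hN).
have [->|fi] := eqVneq f`_i 0; first by rewrite modulus0 !mul0r.
by rewrite ler_wpM2l ?modulus_ge0// hD.
Qed.

Lemma coef_norm_XnM f n : coef_norm ('X^n * f) = coef_norm f.
Proof.
have [->|f0] := eqVneq f 0; first by rewrite mulr0.
rewrite /coef_norm mulrC size_mulXn// big_split_ord/=.
rewrite [X in X + _]big1 ?add0r => [|i _]; last by rewrite coefMXn ltn_ord modulus0.
by apply: eq_bigr => i _; rewrite coefMXn ltnNge leq_addr/= addKn.
Qed.

Lemma coef_normM f g : coef_norm (f * g) <= coef_norm f * coef_norm g.
Proof.
apply: seminorm_mul_le coef_norm_is_seminorm _ => i _ _.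
by rewrite coef_norm_XnM.
Qed.

Lemma coef_norm1 : coef_norm 1 = 1.
Proof. by rewrite /coef_norm size_poly1 big_ord1 coef1 modulus1. Qed.

Lemma coef_norm_le_sum f n M : (size f <= n)%N ->
  (forall i, (i < n)%N -> modulus f`_i <= M) -> coef_norm f <= n%:R * M.
Proof.
move=> fn hM; rewrite (coef_normE fn); apply: le_trans (ler_sum _ _) _.
  by move=> i _; apply: hM.
by rewrite sumr_const card_ord mulr_natl.
Qed.

Lemma coef_norm_take n f : coef_norm (take_poly n f) <= coef_norm f.
Proof.
rewrite (@coef_normE _ (maxn n (size f))) ?leq_max ?size_take_poly//.
rewrite [leRHS](coef_normE (leq_maxr n _)); apply: ler_sum => i _.
by rewrite coef_take_poly; case: ifP => // _; rewrite modulus0 modulus_ge0.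
Qed.

Lemma coef_norm_drop n f : coef_norm (drop_poly n f) <= coef_norm f.
Proof.
rewrite (@coef_normE _ (size f)) ?size_drop_poly ?leq_subr//.
rewrite (@coef_normE f (n + size f)) ?leq_addl// big_split_ord/= -[leLHS]add0r.
apply: lerD; first by rewrite sumr_ge0// => i _; exact: modulus_ge0.
by apply: ler_sum => i _; rewrite coef_drop_poly addnC.
Qed.

End CoefNorm.

(** * The basis of fan polynomials *)

Section FanBasis.
Variables (R : realType) (s : scalar_kind).
Local Notation K := (scalars R s).
Variable Q : nat -> {poly K}.
Hypothesis size_Q : forall k, (size (Q k) <= (block_end k).+1)%N.
Implicit Types f g : {poly K}.

Definition fan_poly (n : nat) : {poly K} :=
  let k := block_of n in
  if (fan_start k <= n)%N
  then 'X^(n - fan_start k) * ('X^(fan_start k) - Q k) else 'X^n.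

Lemma fan_poly0 : fan_poly 0 = 1.
Proof.
by rewrite /fan_poly leqNgt (leq_ltn_trans (leq0n _) (fan_start_gt _)) expr0.
Qed.

Lemma fan_poly_pure k n : (block_end k < n < fan_start k)%N ->
  fan_poly n = 'X^n.
Proof.
move=> /andP[kn nk]; rewrite /fan_poly.
rewrite (@block_ofE k) ?kn ?block_endS ?(leq_trans (ltnW nk)) ?leq_addr//.
by rewrite (leqNgt (fan_start k)) nk.
Qed.

Lemma fan_poly_fan k j : (j <= block_end k)%N ->
  fan_poly (fan_start k + j) = 'X^j * ('X^(fan_start k) - Q k).
Proof.
move=> jk; have h := fan_start_gt k; rewrite /fan_poly.
have -> : block_of (fan_start k + j) = k.
  by apply: block_ofE; rewrite block_endS; apply/andP; split; lia.
by rewrite leq_addr addKn.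
Qed.

Lemma fan_start_polyE k : 'X^(fan_start k) = Q k + fan_poly (fan_start k).
Proof.
by rewrite -[X in fan_poly X]addn0 fan_poly_fan// expr0 mul1r addrC subrK.
Qed.

Lemma XfanE k j : (j <= block_end k)%N ->
  'X^(fan_start k + j) = fan_poly (fan_start k + j) + 'X^j * Q k.
Proof. by move=> jk; rewrite fan_poly_fan// mulrBr subrK addnC exprD. Qed.

Lemma fan_poly_monic n : fan_poly n \is monic /\ size (fan_poly n) = n.+1.
Proof.
case: (block_case n) => [->|[k _ h]|[k [j [_ jk ->]]]].
- by rewrite fan_poly0 monic1 size_poly1.
- by rewrite (fan_poly_pure h) monicXn size_polyXn.
rewrite (fan_poly_fan jk).
have sQ : (size (- Q k) < size ('X^(fan_start k) : {poly K})%R)%N.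
  rewrite size_polyN size_polyXn ltnS; apply: leq_trans (size_Q k) _.
  have := fan_start_gt k; lia.
have mX : 'X^(fan_start k) - Q k \is monic.
  by rewrite monicE lead_coefDl// lead_coefXn.
split; first by rewrite monicMl ?monicXn.
by rewrite mulrC size_mulXn ?monic_neq0// size_polyDl// size_polyXn addnS addnC.
Qed.

Lemma size_fan_poly n : size (fan_poly n) = n.+1.
Proof. by case: (fan_poly_monic n). Qed.

Lemma fan_poly_lead n : (fan_poly n)`_n = 1.
Proof.
case: (fan_poly_monic n) => /monicP + sz.
by rewrite /lead_coef sz.
Qed.

Definition of_coords f := \sum_(n < size f) f`_n *: fan_poly n.

Lemma of_coordsE f L : (size f <= L)%N ->
  of_coords f = \sum_(n < L) f`_n *: fan_poly n.
Proof.
move=> fL; rewrite /of_coords.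
rewrite (big_ord_widen L (fun n => f`_n *: fan_poly n))// big_mkcond.
by apply: eq_bigr => i _; case: ltnP => // h; rewrite nth_default// scale0r.
Qed.

Lemma of_coordsD f g : of_coords (f + g) = of_coords f + of_coords g.
Proof.
rewrite (of_coordsE (size_polyD f g)) (of_coordsE (leq_maxl _ (size g))).
rewrite (of_coordsE (leq_maxr (size f) _)) -big_split/=.
by apply: eq_bigr => i _; rewrite coefD scalerDl.
Qed.

Lemma of_coordsZ a f : of_coords (a *: f) = a *: of_coords f.
Proof.
rewrite (of_coordsE (size_scale_leq a f)) scaler_sumr.
by apply: eq_bigr => i _; rewrite coefZ scalerA.
Qed.

Lemma of_coords_inj f : of_coords f = 0 -> f = 0.
Proof.
move=> f0; apply/eqP; apply: contra_eqT f0 => fn0.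
have sf : (0 < size f)%N by rewrite size_poly_gt0.
apply/eqP => /(congr1 (fun g : {poly K} => g`_(size f).-1)).
rewrite coef0 /of_coords coef_sum -(prednK sf) big_ord_recr/= big1 => [|i _].
  rewrite add0r coefZ fan_poly_lead mulr1 => /eqP.
  by rewrite -lead_coefE lead_coef_eq0 (negPf fn0).
by rewrite coefZ [X in _ * X]nth_default ?mulr0// size_fan_poly ltn_ord.
Qed.

Lemma of_coordsXn n : of_coords 'X^n = fan_poly n.
Proof.
rewrite /of_coords size_polyXn big_ord_recr/= big1 => [|i _].
  by rewrite coefXn eqxx scale1r add0r.
by rewrite coefXn (ltn_eqF (ltn_ord i)) scale0r.
Qed.

(** The new basis is triangular with respect to the powers of the variable. *)
Lemma coords_Xn m : exists e : {poly K},
  (size e <= m.+1)%N /\ 'X^m = of_coords e.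
Proof.
elim/ltn_ind: m => m ih.
case: (block_case m) => [m0|[k _ h]|[k [j [_ jk mE]]]].
- by exists 'X^m; rewrite size_polyXn of_coordsXn m0 fan_poly0.
- by exists 'X^m; rewrite size_polyXn of_coordsXn (fan_poly_pure h).
have hfan := fan_start_gt k.
have low (f : {poly K}) : (size f <= m)%N ->
    exists e : {poly K}, (size e <= m)%N /\ f = of_coords e.
  move=> fm; rewrite (poly_sumE fm).
  suff low n : (n <= m)%N -> exists e : {poly K},
      (size e <= m)%N /\ \sum_(i < n) f`_i *: 'X^i = of_coords e by exact: low.
  elim: n => [_|n ihn nm].
    by exists 0; rewrite size_poly0 big_ord0 /of_coords size_poly0 big_ord0.
  have [e [se eE]] := ihn (ltnW nm); have [e' [se' e'E]] := ih n nm.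
  exists (e + f`_n *: e'); split.
    rewrite (leq_trans (size_polyD _ _))// geq_max se.
    by rewrite (leq_trans (size_scale_leq _ _))// (leq_trans se').
  by rewrite of_coordsD of_coordsZ -eE -e'E big_ord_recr.
have [|e [se eE]] := low ('X^j * Q k).
  have [->|Q0] := eqVneq (Q k) 0; first by rewrite mulr0 size_poly0.
  by rewrite mulrC size_mulXn//; have := size_Q k; lia.
exists ('X^m + e); split.
  by rewrite (leq_trans (size_polyD _ _))// geq_max size_polyXn leqnn leqW.
by rewrite of_coordsD of_coordsXn -eE mE -XfanE.
Qed.

Definition Xn_coords (m : nat) : {poly K} := projT1 (cid (coords_Xn m)).

Lemma size_Xn_coords m : (size (Xn_coords m) <= m.+1)%N.
Proof. by rewrite /Xn_coords; case: cid => e []. Qed.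

Lemma Xn_coordsK m : of_coords (Xn_coords m) = 'X^m.
Proof. by rewrite /Xn_coords; case: cid => e []. Qed.

Definition coords f : {poly K} := \sum_(m < size f) f`_m *: Xn_coords m.

Lemma coordsK f : of_coords (coords f) = f.
Proof.
rewrite {2}(@poly_sumE _ _ f _ (leqnn _)) /coords.
elim/big_rec2: _ => [|i g h _ <-]; first by rewrite /of_coords size_poly0 big_ord0.
by rewrite of_coordsD of_coordsZ Xn_coordsK.
Qed.

Lemma of_coordsK f : coords (of_coords f) = f.
Proof.
apply/eqP; rewrite -subr_eq0; apply/eqP/of_coords_inj.
by rewrite of_coordsD -scaleN1r of_coordsZ coordsK scaleN1r subrr.
Qed.

Lemma coordsD f g : coords (f + g) = coords f + coords g.
Proof. by rewrite -[in LHS](coordsK f) -[in LHS](coordsK g) -of_coordsD of_coordsK. Qed.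

Lemma coordsZ a f : coords (a *: f) = a *: coords f.
Proof. by rewrite -[in LHS](coordsK f) -of_coordsZ of_coordsK. Qed.

Lemma coords_fan_poly n : coords (fan_poly n) = 'X^n.
Proof. by rewrite -of_coordsXn of_coordsK. Qed.

Lemma size_coords f : (size (coords f) <= size f)%N.
Proof.
apply: leq_trans (size_sum _ _ _) _; apply/bigmax_leqP => i _.
exact: leq_trans (leq_trans (size_scale_leq _ _) (size_Xn_coords _)) (ltn_ord i).
Qed.

Lemma coordsE f L : (size f <= L)%N ->
  coords f = \sum_(m < L) f`_m *: Xn_coords m.
Proof.
move=> fL; rewrite /coords.
rewrite (big_ord_widen L (fun m => f`_m *: Xn_coords m))// big_mkcond.
by apply: eq_bigr => i _; case: ltnP => // h; rewrite nth_default// scale0r.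
Qed.

Lemma size_fan_sum (x : nat -> K) L :
  (size (\sum_(n < L) x n *: fan_poly n)%R <= L)%N.
Proof.
apply: leq_trans (size_sum _ _ _) _; apply/bigmax_leqP => i _.
by rewrite (leq_trans (size_scale_leq _ _))// size_fan_poly.
Qed.

Lemma coords_fan_sum (x : nat -> K) L :
  coords (\sum_(n < L) x n *: fan_poly n) = \poly_(n < L) x n.
Proof.
rewrite -[RHS]of_coordsK; congr coords.
rewrite (of_coordsE (size_poly _ _)); apply: eq_bigr => i _.
by rewrite coef_poly ltn_ord.
Qed.

Section CoordNorm.
Variable b : nat -> R.
Hypothesis b_ge0 : forall n, 0 <= b n.

(** Norms of type [l^1] serve for all the spaces at once: the seminorms of a
    vector bound its weighted coordinates, and the estimates below leave a
    factor [(2 ^+ n)^-1] with which bounded sequences become summable. *)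
Definition coord_norm f : R :=
  \sum_(n < size (coords f)) modulus (coords f)`_n * b n.

Lemma coord_normE f L : (size (coords f) <= L)%N ->
  coord_norm f = \sum_(n < L) modulus (coords f)`_n * b n.
Proof.
move=> fL; rewrite /coord_norm.
rewrite (big_ord_widen L (fun n => modulus (coords f)`_n * b n))// big_mkcond.
apply: eq_bigr => i _; case: ltnP => // h.
by rewrite nth_default// modulus0 mul0r.
Qed.

Lemma coord_norm_is_seminorm : is_seminorm coord_norm.
Proof.
split=> [f|f g|a f].
- by apply: sumr_ge0 => i _; rewrite mulr_ge0// modulus_ge0.
- pose L := maxn (size (coords f)) (size (coords g)).
  have h : (size (coords (f + g)) <= L)%N by rewrite coordsD size_polyD.
  rewrite (coord_normE h) (@coord_normE f L) ?leq_maxl//.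
  rewrite (@coord_normE g L) ?leq_maxr// -big_split/=; apply: ler_sum => i _.
  by rewrite coordsD coefD -mulrDl ler_wpM2r// modulusD.
- have h : (size (coords (a *: f)) <= size (coords f))%N.
    by rewrite coordsZ size_scale_leq.
  rewrite (coord_normE h) /coord_norm mulr_sumr.
  by apply: eq_bigr => i _; rewrite coordsZ coefZ modulusM mulrA.
Qed.

Lemma coord_norm_fan n : coord_norm (fan_poly n) = b n.
Proof.
rewrite /coord_norm coords_fan_poly size_polyXn big_ord_recr/= big1 => [|i _].
  by rewrite coefXn eqxx modulus1 mul1r add0r.
by rewrite coefXn (ltn_eqF (ltn_ord i)) modulus0 mul0r.
Qed.

End CoordNorm.

Lemma le_coord_norm (b b' : nat -> R) f : (forall n, b n <= b' n) ->
  coord_norm b f <= coord_norm b' f.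
Proof. by move=> h; apply: ler_sum => i _; rewrite ler_wpM2l ?modulus_ge0. Qed.

Lemma eq_coord_norm (b b' : nat -> R) f :
  (forall n, (n < size f)%N -> b n = b' n) -> coord_norm b f = coord_norm b' f.
Proof.
move=> h; apply: eq_bigr => i _; rewrite h//.
exact: leq_trans (ltn_ord i) (size_coords f).
Qed.

End FanBasis.

(** * Polynomials with rational coefficients *)

Section RationalPolynomials.
Variables (R : realType) (s : scalar_kind).
Local Notation K := (scalars R s).

Definition poly_of_rats (q : seq (rat * rat)) : {poly K} :=
  Poly (map (@scalar_of_rats R s) q).

Lemma size_poly_of_rats q : (size (poly_of_rats q) <= size q)%N.
Proof. by rewrite (leq_trans (size_Poly _))// size_map. Qed.

Lemma poly_of_rats1 : poly_of_rats [:: (1, 0)] = 1.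
Proof.
apply/polyP => i; rewrite coef_Poly coef1 /= scalar_of_rats1.
by case: i => [|[|i]].
Qed.

Lemma poly_of_rats_dense (f : {poly K}) (e : R) : 0 < e ->
  exists q, [/\ (size q <= size f)%N, f`_0 = 0 -> (poly_of_rats q)`_0 = 0 &
    coef_norm (f - poly_of_rats q) <= e].
Proof.
move=> e0; pose d := e / (size f).+1%:R.
have d0 : 0 < d by rewrite divr_gt0// ltr0n.
have /choice[r hr] : forall i, exists q, modulus (f`_i - scalar_of_rats R s q) <= d
    /\ (f`_i = 0 -> scalar_of_rats R s q = 0 :> K).
  move=> i; have [->|fi0] := eqVneq f`_i 0.
    by exists (0, 0); rewrite scalar_of_rats0 subrr modulus0 ltW.
  have [q hq] := scalar_of_rats_dense f`_i d0.
  by exists q; split; [exact: ltW|move/eqP; rewrite (negPf fi0)].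
have coefr i : (poly_of_rats (mkseq r (size f)))`_i
    = if (i < size f)%N then scalar_of_rats R s (r i) else 0.
  rewrite coef_Poly; case: ltnP => h.
    by rewrite (nth_map (0, 0)) ?size_mkseq// nth_mkseq.
  by rewrite nth_default// size_map size_mkseq.
exists (mkseq r (size f)); split; first by rewrite size_mkseq.
  by move=> f0; rewrite coefr; case: ifP => // _; apply: (hr 0%N).2.
apply: le_trans (@coef_norm_le_sum _ _ _ (size f) d _ _) _.
- rewrite (leq_trans (size_polyD _ _))// geq_max leqnn size_polyN.
  by rewrite (leq_trans (size_poly_of_rats _))// size_mkseq.
- by move=> i fi; rewrite coefB coefr fi; case: (hr i).
rewrite /d mulrCA ler_piMr ?(ltW e0)// ler_pdivrMr ?ltr0n// mul1r.
by rewrite ler_nat.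
Qed.

End RationalPolynomials.

(** * Inverting polynomials up to a power of the variable *)

Section ApproxInverse.
Variables (R : realType) (s : scalar_kind).
Local Notation K := (scalars R s).
Implicit Types P Q U : {poly K}.

Lemma unit_inverse (M : nat) (rho B : R) : 0 < rho -> 0 <= B ->
  exists2 G : R, 0 <= G & forall P, coef_norm P <= B -> rho <= modulus P`_0 ->
    exists U, [/\ (size U <= M.+1)%N, coef_norm U <= G &
      forall d, (d <= M)%N -> (U * P)`_d = (d == 0%N)%:R].
Proof.
move=> rho0 B0; pose z := rho^-1 * B + 1.
have z0 : 0 <= z by rewrite addr_ge0// mulr_ge0// invr_ge0 ltW.
exists (rho^-1 * \sum_(j < M.+1) z ^+ j).
  rewrite mulr_ge0 ?invr_ge0 ?(ltW rho0)// sumr_ge0// => j _.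
  exact: exprn_ge0.
move=> P PB rP.
have P00 : P`_0 != 0.
  by apply: contraTneq rP => ->; rewrite modulus0 -ltNge.
(* The geometric series of 1 - P / P(0), which has no constant term. *)
pose Z := 1 - (P`_0)^-1 *: P.
pose V := (P`_0)^-1 *: \sum_(j < M.+1) Z ^+ j.
have inv_le : modulus (P`_0)^-1 <= rho^-1.
  by rewrite modulusV// lef_pV2// posrE ?modulus_gt0.
have Zz : coef_norm Z <= z.
  apply: le_trans (seminormB _ _ (coef_norm_is_seminorm _ _)) _.
  rewrite coef_norm1 addrC lerD2r (seminormZ (coef_norm_is_seminorm _ _)).
  by rewrite ler_pM ?modulus_ge0 ?coef_norm_ge0.
have ZXz j : coef_norm (Z ^+ j) <= z ^+ j.
  elim: j => [|j ih]; first by rewrite !expr0 coef_norm1.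
  rewrite !exprS; apply: le_trans (coef_normM _ _) _.
  by rewrite ler_pM ?coef_norm_ge0.
have Z00 : Z`_0 = 0.
  by rewrite coefB coef1 coefZ mulVf ?subrr.
have VP : V * P = 1 - Z ^+ M.+1.
  have {1}-> : P = P`_0 *: (1 - Z) by rewrite opprB addrC subrK scalerA divff ?scale1r.
  rewrite /V -scalerAr -scalerAl scalerA divff// scale1r mulrC.
  rewrite -[X in _ = X - _](expr1n _ M.+1) subrXX; congr (_ * _).
  by apply: eq_bigr => i _; rewrite expr1n mul1r.
exists (take_poly M.+1 V); split; first exact: size_take_poly.
  apply: le_trans (coef_norm_take _ _) _.
  rewrite (seminormZ (coef_norm_is_seminorm _ _)).
  rewrite ler_pM ?modulus_ge0 ?coef_norm_ge0//.
  apply: le_trans (seminorm_sum _ _ _ (coef_norm_is_seminorm _ _)) _.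
  exact: ler_sum.
move=> d dM; have -> : (take_poly M.+1 V * P)`_d = (V * P)`_d.
  rewrite -{2}(poly_take_drop M.+1 V) mulrDl coefD -mulrA ['X^_ * _]mulrC mulrA.
  by rewrite coefMXn ltnS dM addr0.
have [W ZW] : exists W, Z = 'X * W.
  exists (drop_poly 1 Z); rewrite -{1}(poly_take_drop 1 Z) mulrC.
  suff -> : take_poly 1 Z = 0 by rewrite add0r expr1.
  by apply/polyP => -[|i]; rewrite coef_take_poly coef0.
rewrite VP ZW coefB coef1 exprMn mulrC coefMXn ltnS dM subr0.
by case: d {dM}.
Qed.

(** When the coefficients of degree less than [r] of [P] are negligible, the
    previous lemma applies to the quotient of [P] by ['X^r]. Otherwise one of
    them is not negligible, and one argues by induction on [r]. What counts as
    negligible depends on the bound given by the previous lemma, and the bound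
    on [Q] is uniform in [P] because there are finitely many cases. *)
Lemma approx_inverse (M a r : nat) (rho B eta : R) : (M < a)%N -> (r <= M)%N ->
  0 < rho -> 0 <= B -> 0 < eta ->
  exists2 G : R, 0 <= G & forall P, coef_norm P <= B -> rho <= modulus P`_r ->
    exists Q, [/\ (size Q <= (a + M).+1)%N, Q`_0 = 0, coef_norm Q <= G &
      forall d, (d <= a + M)%N -> modulus (Q * P - 'X^a)`_d <= eta].
Proof.
move=> Ma rM rho0 B0 eta0; elim/ltn_ind: r => r ih in rM rho rho0 *.
have [G0 G00 hG0] := unit_inverse M rho0 B0.
pose rho' := eta / (G0 * r%:R + 1).
have den0 : 0 < G0 * r%:R + 1 by rewrite ltr_wpDl// mulr_ge0.
have rho'0 : 0 < rho' by rewrite divr_gt0.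
have /choice[G1 hG1] : forall d : 'I_r, exists G : R, 0 <= G /\
    forall P, coef_norm P <= B -> rho' <= modulus P`_d ->
    exists Q, [/\ (size Q <= (a + M).+1)%N, Q`_0 = 0, coef_norm Q <= G &
      forall d, (d <= a + M)%N -> modulus (Q * P - 'X^a)`_d <= eta].
  move=> d; have [G G_ge0 hG] := ih d (ltn_ord d)
    (leq_trans (ltnW (ltn_ord d)) rM) rho' rho'0.
  by exists G.
exists (G0 + \sum_d G1 d).
  by rewrite addr_ge0// sumr_ge0// => d _; case: (hG1 d).
move=> P PB rP.
case: (pselect (exists d : 'I_r, rho' <= modulus P`_d)) => [[d dP]|low].
  have [Q [sQ Q0 QG hQ]] := (hG1 d).2 P PB dP; exists Q; split=> //.
  apply: le_trans QG _; rewrite (bigD1 d)//= addrCA lerDl addr_ge0//.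
  by rewrite sumr_ge0// => d' _; case: (hG1 d').
have {}low d : (d < r)%N -> modulus P`_d <= rho'.
  move=> dr; rewrite leNgt; apply/negP => h; apply: low.
  by exists (Ordinal dr); exact: ltW.
pose P1 := drop_poly r P.
have PE : P = take_poly r P + P1 * 'X^r by rewrite poly_take_drop.
have [||U [sU UG hU]] := hG0 P1.
- exact: le_trans (coef_norm_drop _ _) PB.
- by rewrite coef_drop_poly add0n.
have UQ : coef_norm ('X^(a - r) * U) = coef_norm U by rewrite coef_norm_XnM.
exists ('X^(a - r) * U); split.
- have [->|U0] := eqVneq U 0; first by rewrite mulr0 size_poly0.
  by rewrite mulrC size_mulXn//; lia.
- by rewrite mulrC coefMXn; case: ltnP => //; lia.
- by rewrite UQ (le_trans UG)// lerDl sumr_ge0// => d _; case: (hG1 d).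
move=> d daM.
have -> : 'X^(a - r) * U * P - 'X^a
    = 'X^(a - r) * U * take_poly r P + (U * P1 - 1) * 'X^a.
  rewrite {1}PE mulrDr -addrA; congr (_ + _).
  rewrite mulrBl mul1r; congr (_ - _).
  have {2}-> : a = ((a - r) + r)%N by lia.
  by rewrite exprD; ring.
rewrite coefD coefMXn coefB coef1.
rewrite [X in _ + X](_ : _ = 0) ?addr0; last first.
  by case: ltnP => // ad; rewrite hU ?subrr//; lia.
apply: le_trans (modulus_coef_le _ _) _; apply: le_trans (coef_normM _ _) _.
have rlow : coef_norm (take_poly r P) <= r%:R * rho'.
  apply: coef_norm_le_sum => [|i ir]; first exact: size_take_poly.
  by rewrite coef_take_poly ir low.
rewrite UQ; apply: le_trans (ler_pM (coef_norm_ge0 _) (coef_norm_ge0 _) UG rlow) _.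
rewrite /rho' !mulrA ler_pdivrMr// mulrC ler_pM2l//.
by rewrite lerDl.
Qed.

End ApproxInverse.

(** * Estimates for multiplication by powers of the variable *)

(** Comparisons of reals abound below, and are of no use to [lia]. *)
Ltac nat_lia :=
  repeat match goal with
  | H : is_true (@Order.le _ _ _ _) |- _ => clear H
  | H : is_true (@Order.lt _ _ _ _) |- _ => clear H
  end; lia.

Section Estimates.
Variables (R : realType) (s : scalar_kind).
Local Notation K := (scalars R s).
Variable Q : nat -> {poly K}.
Hypothesis size_Q : forall k, (size (Q k) <= (block_end k).+1)%N.
Variable foc : nat -> nat.
Implicit Types (b : nat -> nat -> R) (lam : nat -> R) (f g : {poly K}).
Local Notation A := (fan_poly Q).
Local Notation nu b l := (coord_norm size_Q (b l)).

(** The constant [lam k] stands for a number that is huge with respect to all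
    that precedes block [k]. The chain condition makes a shift inside a block
    cost one index and gain [lam k]. The first window of a block receives what
    leaves the fan of the previous block and that of the block itself, and the
    vectors of the fan are the errors of the approximations by powers of the
    variable; so all these vectors are negligible. The vectors just before the
    fan are huge from index [1] on, since a shift turns them into multiples of
    [Q k]. The vectors of the fan are huge at index [(foc k).+1], so that the
    coordinates in the fan of a given vector are negligible. *)
Record good_weights b lam : Prop := GoodWeights {
  weight_gt0 : forall l n, 0 < b l n;
  weight_mono : forall l l' n, (l <= l')%N -> b l n <= b l' n;
  weight_chain : forall k n m l, (block_end k < n)%N -> (n < m)%N ->
    (m <= block_end k.+1)%N -> (m <= n + block_end k)%N -> (l <= k)%N ->
    b l m * lam k <= b l.+1 n;
  weight_start : forall k n m, (block_end k < m <= 3 * block_end k)%N ->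
    (n <= block_end k)%N || (fan_start k <= n <= block_end k.+1)%N ->
    b k m * lam k <= b 0%N n;
  weight_start1 : forall k m, (block_end k < m <= 3 * block_end k)%N ->
    b k m * lam k <= 1;
  weight_fan : forall k n j, (j <= block_end k)%N -> (n <= block_end k)%N ->
    b (foc k) (fan_start k + j)%N * lam k <= b 0%N n;
  weight_fan1 : forall k j, (j <= block_end k)%N ->
    b (foc k) (fan_start k + j)%N * lam k <= 1;
  weight_before_fan : forall k n, (fan_start k <= n + block_end k)%N ->
    (n < fan_start k)%N -> lam k <= b 1%N n;
  weight_in_fan : forall k j, (j <= block_end k)%N ->
    lam k <= b (foc k).+1 (fan_start k + j)%N }.

Definition initial_norm b k : R :=
  1 + \sum_(m < (block_end k).+1) nu b k 'X^m.

Definition block_const b k : R :=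
  (2 + coef_norm (Q k)) ^+ 2 * initial_norm b k.

Definition fan_size k : R := \sum_(n < (block_end k).+1) coef_norm (A n).

Definition trunc_size b k : R :=
  k%:R * \sum_(n < (block_end k).+1) coef_norm (A n) / b 0%N n.

Definition coords_size k : R :=
  1 + \sum_(m < (block_end k).+1) coef_norm (Xn_coords size_Q m).

(** The constants [gam k] bound the approximate inverses that the orbits use
    before block [k]. *)
Record large_constants b (gam lam : nat -> R) : Prop := LargeConstants {
  gam_ge0 : forall k, 0 <= gam k;
  gam_mono : forall k k', (k <= k')%N -> gam k <= gam k';
  lam_mono : forall k k', (k <= k')%N -> lam k <= lam k';
  lam_block : forall k, block_const b k * (1 + gam k + coef_norm (Q k)) *
    (1 + fan_size k) * (k.+1%:R * 2 ^+ block_end k.+1) <= lam k;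
  lam_trunc : forall k, (1 + gam k) * (1 + trunc_size b k) * k.+1%:R <= lam k;
  lam_coords : forall k, 2 * k.+1%:R ^+ 2 * coords_size k <= lam k }.

Variables (b : nat -> nat -> R) (gam lam : nat -> R).
Hypothesis gb : good_weights b lam.
Hypothesis lc : large_constants b gam lam.
Hypothesis foc_le : forall k, (foc k <= k)%N.

Let b_ge0 l n : 0 <= b l n. Proof. exact/ltW/(weight_gt0 gb). Qed.
Let nu_sn l : is_seminorm (nu b l).
Proof. exact: coord_norm_is_seminorm. Qed.
Let nu_ge0 l f : 0 <= nu b l f. Proof. exact: seminorm_ge0. Qed.
Let nu_fan l n : nu b l (A n) = b l n. Proof. exact: coord_norm_fan. Qed.
Let nu_mono l l' f : (l <= l')%N -> nu b l f <= nu b l' f.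
Proof. by move=> ll; apply: le_coord_norm => n; exact: weight_mono gb _ _ _ ll. Qed.
Let q_ge0 k : 0 <= coef_norm (Q k). Proof. exact: coef_norm_ge0. Qed.

Lemma initial_norm_ge1 k : 1 <= initial_norm b k.
Proof. by rewrite lerDl sumr_ge0. Qed.

Lemma block_const_ge1 k : 1 <= block_const b k.
Proof.
rewrite /block_const mulr_ege1 ?initial_norm_ge1// exprn_ege1//.
by have := q_ge0 k; lra.
Qed.

Lemma block_const_ge k : 1 + coef_norm (Q k) ^+ 2 * initial_norm b k +
  coef_norm (Q k) * initial_norm b k + coef_norm (Q k) <= block_const b k.
Proof.
rewrite /block_const; have := initial_norm_ge1 k; have := q_ge0 k.
move: (coef_norm _) (initial_norm _ _) => q G q0 G1.
have : 0 <= q * (G - 1) by rewrite mulr_ge0// subr_ge0.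
by rewrite expr2; nra.
Qed.

Lemma fan_size_ge0 k : 0 <= fan_size k.
Proof. by apply: sumr_ge0 => i _; exact: coef_norm_ge0. Qed.

Lemma trunc_size_ge0 k : 0 <= trunc_size b k.
Proof.
by rewrite mulr_ge0// sumr_ge0// => i _; rewrite divr_ge0 ?coef_norm_ge0.
Qed.

Lemma coords_size_ge1 k : 1 <= coords_size k.
Proof. by rewrite lerDl sumr_ge0// => i _; exact: coef_norm_ge0. Qed.

Lemma lam_ge k : k.+1%:R <= lam k.
Proof.
apply: le_trans (lam_trunc lc k); rewrite ler_peMl ?ler0n//.
by rewrite mulr_ege1// lerDl ?(gam_ge0 lc) ?trunc_size_ge0.
Qed.

Lemma lam_gt0 k : 0 < lam k.
Proof. by apply: lt_le_trans (lam_ge k); rewrite ltr0n. Qed.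

Lemma lam_ge1 k : 1 <= lam k.
Proof. by apply: le_trans (lam_ge k); rewrite ler1n. Qed.

Lemma nu_Xn_early l k m : (l <= k)%N -> (m <= 3 * block_end k)%N ->
  nu b l 'X^m <= initial_norm b k.
Proof.
move=> lk mk; case: (ltnP (block_end k) m) => h.
  have hf := fan_start_gt k.
  rewrite -(@fan_poly_pure _ _ Q k) ?h /=; last by nat_lia.
  rewrite nu_fan; apply: le_trans (initial_norm_ge1 k).
  have hm : (block_end k < m <= 3 * block_end k)%N by rewrite h.
  apply: le_trans (weight_mono gb m lk) _.
  by apply: le_trans (weight_start1 gb hm); rewrite ler_peMr ?lam_ge1.
apply: le_trans (nu_mono _ lk) _; rewrite /initial_norm.
rewrite (bigD1 (Ordinal (h : (m < (block_end k).+1)%N)))//= addrCA lerDl.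
by rewrite addr_ge0// sumr_ge0.
Qed.

Lemma nu_Xn_start l k m n : (l <= k)%N ->
  (block_end k < m <= 3 * block_end k)%N ->
  (n <= block_end k)%N || (fan_start k <= n <= block_end k.+1)%N ->
  nu b l 'X^m <= b 0%N n / lam k.
Proof.
move=> lk mk hn; have hf := fan_start_gt k.
rewrite -(@fan_poly_pure _ _ Q k); last by case/andP: mk => -> /=; nat_lia.
rewrite nu_fan ler_pdivlMr ?lam_gt0//; apply: le_trans (weight_start gb mk hn).
by rewrite ler_wpM2r ?(weight_mono gb)// ltW ?lam_gt0.
Qed.

Let b0_le l n : b 0%N n <= b l n. Proof. exact: weight_mono gb _ _ _ (leq0n l). Qed.

Let chain_div k n m l : (block_end k < n)%N -> (n < m)%N ->
    (m <= block_end k.+1)%N -> (m <= n + block_end k)%N -> (l <= k)%N ->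
  b l m <= b l.+1 n / lam k.
Proof.
by move=> *; rewrite ler_pdivlMr ?lam_gt0//; exact: weight_chain gb _ _ _ _ _ _ _ _ _.
Qed.

(** Inside the block the multiplication is a shift of the basis. A vector that
    enters the fan leaves a multiple of [Q k] behind, which is dominated by the
    large weight of the vector. A vector that leaves the fan falls in the first
    window of the next block and, because of the term [Q k], in the first window
    of the same block. *)
Lemma shift_le k n d l : (block_end k < n <= block_end k.+1)%N ->
  (0 < d <= block_end k)%N -> (l <= k)%N ->
  nu b l ('X^d * A n) <= block_const b k / lam k * b l.+1 n.
Proof.
move=> hn /andP[d0 dk] lk; have hf := fan_start_gt k.
have lam0 := lam_gt0 k; have bge := block_const_ge k.
have q0 := q_ge0 k; have G1 := initial_norm_ge1 k.
have G0 : 0 <= initial_norm b k by exact: le_trans G1.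
have qG0 : 0 <= coef_norm (Q k) * initial_norm b k by rewrite mulr_ge0.
have qqG0 : 0 <= coef_norm (Q k) ^+ 2 * initial_norm b k.
  by rewrite mulr_ge0// sqr_ge0.
have D1 := block_const_ge1 k.
rewrite mulrAC ler_pdivlMr//.
have lamN x y : x <= y / lam k -> x * lam k <= y by rewrite ler_pdivlMr.
case: (block_case n) hn => [->|[k' bk' hn']|[k' [j [bk' jk nE]]]]; first by nat_lia.
- move=> hn; have kk : k' = k by rewrite -bk' (block_ofE hn).
  rewrite {k' bk'}kk in hn'; case/andP: (hn') => kn nc.
  rewrite (fan_poly_pure Q hn') -exprD.
  case: (ltnP (d + n) (fan_start k)) => dn.
    rewrite -(@fan_poly_pure _ _ Q k) ?dn ?andbT; last by nat_lia.
    rewrite nu_fan; apply: le_trans (_ : b l.+1 n <= _); last by rewrite ler_peMl.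
    by apply: lamN; apply: chain_div; rewrite ?block_endS//; nat_lia.
  have [j dnE] : exists j, (d + n = fan_start k + j)%N.
    by exists (d + n - fan_start k)%N; nat_lia.
  have jk : (j <= block_end k)%N by nat_lia.
  rewrite dnE (XfanE Q jk).
  apply: le_trans (ler_wpM2r (ltW lam0) (seminormD (nu_sn l) _ _)) _.
  rewrite mulrDl nu_fan.
  have h1 : b l (fan_start k + j) * lam k <= b l.+1 n.
    by apply: lamN; apply: chain_div; rewrite ?block_endS//; nat_lia.
  have h2 : nu b l ('X^j * Q k) <= coef_norm (Q k) * initial_norm b k.
    rewrite mulrC; apply: seminorm_mul_le (nu_sn l) _ => e ek _.
    by rewrite -exprD; apply: nu_Xn_early => //; have := size_Q k; nat_lia.
  have h3 : lam k <= b l.+1 n.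
    apply: le_trans (weight_before_fan gb _ nc) (weight_mono gb _ _) => //.
    by nat_lia.
  apply: le_trans (lerD h1 (ler_pM (nu_ge0 _ _) (ltW lam0) h2 h3)) _.
  rewrite -{1}[b l.+1 n]mul1r -mulrDl ler_wpM2r//.
  by apply: le_trans bge; lra.
move=> hn; have kk : k' = k by rewrite -bk' (block_ofE hn).
rewrite {k' bk'}kk in jk nE; subst n.
case: (leqP (j + d) (block_end k)) => jd.
  have -> : 'X^d * A (fan_start k + j) = A (fan_start k + (j + d))%N.
    by rewrite !fan_poly_fan// mulrA -exprD addnC.
  rewrite nu_fan; apply: le_trans (_ : b l.+1 (fan_start k + j)%N <= _).
    by apply: lamN; apply: chain_div; rewrite ?block_endS//; nat_lia.
  by rewrite ler_peMl.
have -> : 'X^d * A (fan_start k + j) =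
    'X^(fan_start k + j + d) - 'X^(j + d) * Q k.
  by rewrite fan_poly_fan// !exprD; ring.
set n := (fan_start k + j)%N in hn *.
apply: le_trans (ler_wpM2r (ltW lam0) (seminormB _ _ (nu_sn l))) _.
rewrite mulrDl.
have nfan : (n <= block_end k)%N || (fan_start k <= n <= block_end k.+1)%N.
  by rewrite /n block_endS leq_add2l jk leq_addr orbT.
have h1 : nu b l 'X^(n + d) * lam k <= b l.+1 n.
  apply: le_trans (b0_le _ n); apply: lamN.
  apply: le_trans (_ : b 0%N n / lam k.+1 <= _).
    have nk1 : (n <= block_end k.+1)%N by case/andP: hn.
    apply: (@nu_Xn_start _ k.+1); [exact: leqW| |by rewrite nk1].
    by rewrite block_endS /n; nat_lia.
  by rewrite ler_wpM2l// lef_pV2 ?posrE ?lam_gt0// (lam_mono lc).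
have h2 : nu b l ('X^(j + d) * Q k) * lam k <= coef_norm (Q k) * b l.+1 n.
  rewrite -ler_pdivlMr// -mulrA ['X^_ * _]mulrC.
  apply: seminorm_mul_le (nu_sn l) _ => e ek _; rewrite -exprD.
  apply: le_trans (_ : b 0%N n / lam k <= _).
    by apply: nu_Xn_start => //; have := size_Q k; nat_lia.
  by rewrite ler_wpM2r// invr_ge0 ltW.
apply: le_trans (lerD h1 h2) _; rewrite -{1}[b l.+1 n]mul1r -mulrDl ler_wpM2r//.
by apply: le_trans bge; lra.
Qed.

Lemma block_ratio_le k :
  block_const b k * (1 + gam k + coef_norm (Q k)) * (1 + fan_size k) / lam k
    <= k.+1%:R^-1 * (2 ^+ block_end k.+1)^-1.
Proof.
rewrite -invfM -[leRHS]mul1r ler_pdivlMr ?mulr_gt0 ?exprn_gt0 ?ltr0n//.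
by rewrite mulrAC ler_pdivrMr ?lam_gt0// mul1r; exact: lam_block lc k.
Qed.

Let half_le n m : (n <= m)%N -> (2 ^+ m : R)^-1 <= (2 ^+ n)^-1.
Proof. by move=> nm; rewrite lef_pV2 ?posrE ?exprn_gt0// ler_weXn2l// ler1n. Qed.

Let inv_le k k' : (k <= k')%N -> k'.+1%:R^-1 <= k.+1%:R^-1 :> R.
Proof. by move=> kk; rewrite lef_pV2 ?posrE ?ltr0n// ler_nat. Qed.

(** The factor [2 ^+ block_end k.+1] in [lam_block] makes the constants of a
    block summable over the indices of the block. *)
Let block_small k n k1 z : (block_end k < n <= block_end k.+1)%N ->
  (k1 <= k)%N ->
  z <= block_const b k * (1 + gam k + coef_norm (Q k)) * (1 + fan_size k) ->
  z / lam k <= k1.+1%:R^-1 * (2 ^+ n)^-1.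
Proof.
move=> /andP[_ nk] kk zle; apply: le_trans (ler_wpM2r _ zle) _.
  by rewrite invr_ge0 ltW ?lam_gt0.
apply: le_trans (block_ratio_le k) _.
by rewrite ler_pM ?invr_ge0 ?exprn_ge0// ?inv_le ?half_le.
Qed.

Lemma shift_continuous l : exists2 C : R, 0 <= C &
  forall n, nu b l ('X * A n) <= C * (2 ^+ n)^-1 * b l.+1 n.
Proof.
pose t n : R := nu b l ('X * A n) * 2 ^+ n / b l.+1 n.
have t0 n : 0 <= t n by rewrite divr_ge0// mulr_ge0// exprn_ge0.
exists (1 + \sum_(n < (block_end l.+1).+1) t n).
  by rewrite addr_ge0// sumr_ge0.
move=> n; case: (leqP n (block_end l.+1)) => h.
  apply: le_trans (_ : t n * (2 ^+ n)^-1 * b l.+1 n <= _).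
    rewrite /t -[leRHS]mulrA [_ / _ * _]mulrAC -!mulrA mulVKf ?gt_eqF ?exprn_gt0//.
    by rewrite divff ?mulr1// gt_eqF// (weight_gt0 gb).
  rewrite !ler_wpM2r ?invr_ge0 ?exprn_ge0//.
  rewrite (bigD1 (Ordinal (h : (n < (block_end l.+1).+1)%N)))//= addrCA lerDl.
  by rewrite addr_ge0// sumr_ge0.
have n0 : (0 < n)%N by nat_lia.
have hn := block_ofP n0; set k := block_of n in hn.
have lk : (l.+1 <= k)%N.
  rewrite ltnNge; apply/negP => kl.
  have := block_end_mono (kl : (k.+1 <= l.+1)%N); nat_lia.
have k1 := leq_block_end k.
rewrite -['X]expr1; apply: le_trans (shift_le hn _ (ltnW lk)) _; first by nat_lia.
rewrite ler_wpM2r//; apply: le_trans (block_small hn (leqnn k) _) _.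
  rewrite -[leLHS]mulr1 -mulrA ler_wpM2l ?(le_trans _ (block_const_ge1 k))//.
  have g0 := gam_ge0 lc k; have q0 := q_ge0 k.
  by rewrite mulr_ege1 ?lerDl ?fan_size_ge0// -addrA lerDl addr_ge0.
rewrite ler_wpM2r ?invr_ge0 ?exprn_ge0//.
apply: le_trans (_ : 1 <= _); first by rewrite invf_le1 ?ltr0n// ler1n.
by rewrite lerDl sumr_ge0.
Qed.

(** The power ['X^(fan_start k)] is neither low nor high with respect to the
    indices [n] to which it is applied, which may lie before the block of the
    fan, in it or after it. Where [shift_le] does not apply to the power itself,
    it applies to [Q k], which is substituted for the power, or else the product
    falls in the first window of the next block. The multiplication by [Q k] is
    small because [Q k] has no constant term. *)
Lemma jump_tail k0 k n : (k0 < k)%N ->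
  (size (Q k) <= (block_end k0.+1).+1)%N -> (Q k)`_0 = 0 ->
  coef_norm (Q k) <= 1 + gam k0.+1 -> (foc k <= k0)%N ->
  (block_end k0.+1 < n)%N ->
  nu b (foc k) ('X^(fan_start k) * A n)
    <= 2 * k0.+1%:R^-1 * (2 ^+ n)^-1 * b (foc k).+1 n.
Proof.
move=> k0k sQ Q0 Qg ik0 Nn; set i := foc k.
have n0 : (0 < n)%N by nat_lia.
have hn := block_ofP n0; set k' := block_of n in hn.
have k0k' : (k0 < k')%N.
  rewrite ltnNge; apply/negP => kl.
  have := block_end_mono (kl : (k'.+1 <= k0.+1)%N); nat_lia.
have q0 := q_ge0 k; have D1 := block_const_ge1 k; have W0 := fan_size_ge0 k.
have g0 := gam_ge0 lc k.
have D1' := block_const_ge1 k'; have W0' := fan_size_ge0 k'.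
have g0' := gam_ge0 lc k'; have q0' := q_ge0 k'.
set y := k0.+1%:R^-1 * (2 ^+ n)^-1 * b i.+1 n.
have y0 : 0 <= y by rewrite !mulr_ge0 ?invr_ge0 ?exprn_ge0.
have -> : 2 * k0.+1%:R^-1 * (2 ^+ n)^-1 * b i.+1 n = 2 * y by rewrite /y; ring.
have to_y kk z : kk = k' -> 
    z <= block_const b kk * (1 + gam kk + coef_norm (Q kk)) * (1 + fan_size kk) ->
    z / lam kk * b i.+1 n <= y.
  move=> -> hz; rewrite /y ler_wpM2r//; apply: block_small hn _ hz.
  exact: ltnW.
have y2 : y <= 2 * y by rewrite ler_peMl// ler1n.
have bD kk : 0 <= block_const b kk by apply: le_trans (block_const_ge1 kk).
have leD kk z : 0 <= z -> z <= 1 + gam kk + coef_norm (Q kk) ->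
    block_const b kk * z <=
    block_const b kk * (1 + gam kk + coef_norm (Q kk)) * (1 + fan_size kk).
  move=> z0 hz; rewrite -[leLHS]mulr1; apply: ler_pM.
  - exact: mulr_ge0 (bD kk) z0.
  - exact: ler01.
  - exact: ler_wpM2l.
  - by rewrite lerDl fan_size_ge0.
case: (ltngtP k' k) => kk.
- (* The power is [Q k] plus a fan vector, which is tiny. *)
  have nk : (n <= block_end k)%N.
    by case/andP: hn => _ /leq_trans; apply; exact: block_end_mono.
  have -> : 'X^(fan_start k) * A n = Q k * A n + A n * A (fan_start k).
    by rewrite (fan_start_polyE Q); ring.
  apply: le_trans (seminormD (nu_sn i) _ _) _.
  rewrite [2 * y]mulr_natl mulr2n lerD//.
    apply: le_trans (_ : coef_norm (Q k) * (block_const b k' / lam k' * b i.+1 n) <= _).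
      apply: seminorm_mul_le (nu_sn i) _ => -[|e] ek; first by rewrite Q0 eqxx.
      move=> _; apply: shift_le => //; last by rewrite /i; nat_lia.
      have := block_end_mono k0k'; nat_lia.
    apply: le_trans (to_y k' (block_const b k' * coef_norm (Q k)) erefl _).
      by rewrite le_eqVlt; apply/orP; left; apply/eqP; ring.
    apply: leD => //; apply: le_trans Qg _; apply: le_trans (_ : 1 + gam k' <= _).
      by rewrite lerD2l (gam_mono lc).
    by rewrite lerDl.
  apply: le_trans (_ : coef_norm (A n) * (b 0%N n / lam k) <= _).
    apply: seminorm_mul_le (nu_sn i) _ => e en _.
    rewrite size_fan_poly// in en.
    have ek : (e <= block_end k)%N by nat_lia.
    have -> : 'X^e * A (fan_start k) = A (fan_start k + e)%N.
      by rewrite fan_poly_fan// -[X in A X]addn0 fan_poly_fan// expr0 mul1r.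
    rewrite nu_fan ler_pdivlMr ?lam_gt0//; exact: (weight_fan gb ek nk).
  rewrite mulrA mulrAC.
  apply: ler_pM; rewrite ?divr_ge0 ?coef_norm_ge0 ?(ltW (lam_gt0 k))//.
  apply: le_trans (_ : (1 + fan_size k) / lam k <= _).
    rewrite ler_pM2r ?invr_gt0 ?lam_gt0//.
    rewrite /fan_size (bigD1 (Ordinal (nk : (n < (block_end k).+1)%N)))//=.
    rewrite addrCA lerDl addr_ge0// sumr_ge0// => j _; exact: coef_norm_ge0.
  apply: le_trans (_ : k.+1%:R^-1 * (2 ^+ block_end k.+1)^-1 <= _).
    apply: le_trans (block_ratio_le k).
    rewrite ler_pM2r ?invr_gt0 ?lam_gt0// ler_peMl ?addr_ge0//.
    by rewrite mulr_ege1// -addrA lerDl addr_ge0.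
  rewrite ler_pM ?invr_ge0 ?exprn_ge0 ?half_le ?inv_le//; first by nat_lia.
  by have := block_end_lt k; nat_lia.
- (* For these blocks the power is a low one. *)
  apply: le_trans y2; apply: le_trans (shift_le hn _ _) _.
  + by have := block_end_mono kk; rewrite block_endS; have := fan_start_gt k; nat_lia.
  + by rewrite /i; nat_lia.
  apply: le_trans (to_y k' (block_const b k' * 1) erefl _); first by rewrite mulr1.
  by apply: leD => //; rewrite -addrA lerDl addr_ge0.
(* The power goes past the end of the block, into the first window of the
   next one. *)
apply: le_trans y2; rewrite {}kk in hn to_y k0k' D1' W0' g0' q0'.
have lamSS : (lam k.+1)^-1 <= (lam k)^-1.
  by rewrite lef_pV2 ?posrE ?lam_gt0// (lam_mono lc).
have next m : (block_end k.+1 < m <= 3 * block_end k.+1)%N ->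
    nu b i 'X^m <= b i.+1 n / lam k.
  move=> hm; apply: le_trans (_ : b 0%N n / lam k.+1 <= _).
    apply: (@nu_Xn_start _ k.+1) => //; first by rewrite /i; nat_lia.
    by case/andP: hn => _ ->.
  by rewrite ler_pM ?invr_ge0// ltW ?lam_gt0.
have ck := fan_start_gt k.
case: (block_case n) hn => [->|[k2 bk2 hn2]|[k2 [j [bk2 jk nE]]]]; first by nat_lia.
- move=> hn; have kk2 : k2 = k by rewrite -bk2 (block_ofE hn).
  rewrite {k2 bk2}kk2 in hn2; rewrite (fan_poly_pure Q hn2) -exprD.
  apply: le_trans (next _ _) _; first by rewrite block_endS; nat_lia.
  rewrite mulrC; apply: le_trans (to_y k (block_const b k * 1) _ _) => //.
    by rewrite mulr1 ler_wpM2r// ler_peMl// invr_ge0 ltW ?lam_gt0.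
  by apply: leD => //; rewrite -addrA lerDl addr_ge0.
move=> hn; have kk2 : k2 = k by rewrite -bk2 (block_ofE hn).
rewrite {k2 bk2}kk2 in jk nE.
have -> : 'X^(fan_start k) * A n =
    'X^(fan_start k + n) - Q k * Q k * 'X^j - Q k * A n.
  by rewrite nE fan_poly_fan// !exprD; ring.
apply: le_trans (seminormB _ _ (nu_sn i)) _.
apply: le_trans (lerD (seminormB _ _ (nu_sn i)) (lexx _)) _.
have h1 : nu b i 'X^(fan_start k + n) <= b i.+1 n / lam k.
  by apply: next; rewrite nE block_endS; nat_lia.
have h2 : nu b i (Q k * Q k * 'X^j) <=
    coef_norm (Q k) ^+ 2 * initial_norm b k / lam k * b i.+1 n.
  apply: le_trans (_ : coef_norm (Q k) ^+ 2 * initial_norm b k <= _).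
    rewrite -mulrA expr2 -mulrA; apply: seminorm_mul_le (nu_sn i) _ => e ek _.
    rewrite mulrCA; apply: seminorm_mul_le (nu_sn i) _ => e' e'k _.
    rewrite -!exprD; apply: nu_Xn_early; first by rewrite /i.
    by have := size_Q k; nat_lia.
  rewrite -mulrA ler_peMr ?mulr_ge0 ?sqr_ge0 ?(le_trans _ (initial_norm_ge1 k))//.
  rewrite mulrC ler_pdivlMr ?lam_gt0// mul1r nE; exact: (weight_in_fan gb jk).
have h3 : nu b i (Q k * A n) <=
    coef_norm (Q k) * (block_const b k / lam k * b i.+1 n).
  apply: seminorm_mul_le (nu_sn i) _ => -[|e] ek; first by rewrite Q0 eqxx.
  move=> _; apply: shift_le => //; last by rewrite /i.
  by have := size_Q k; nat_lia.
apply: le_trans (lerD (lerD h1 h2) h3) _.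
apply: le_trans (to_y k (block_const b k * (1 + coef_norm (Q k))) _ _) => //.
  have hD : 1 + coef_norm (Q k) ^+ 2 * initial_norm b k <= block_const b k.
    have := block_const_ge k; have := initial_norm_ge1 k; nra.
  rewrite -subr_ge0.
  have -> : block_const b k * (1 + coef_norm (Q k)) / lam k * b i.+1 n -
      (b i.+1 n / lam k +
       coef_norm (Q k) ^+ 2 * initial_norm b k / lam k * b i.+1 n +
       coef_norm (Q k) * (block_const b k / lam k * b i.+1 n)) =
     (block_const b k - (1 + coef_norm (Q k) ^+ 2 * initial_norm b k)) *
       (b i.+1 n / lam k) by ring.
  by rewrite mulr_ge0 ?subr_ge0// divr_ge0// ltW ?lam_gt0.
by apply: leD; [rewrite addr_ge0|rewrite lerD2r lerDl].
Qed.

Hypothesis schedule : forall i q k,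
  exists2 k', (k <= k')%N & foc k' = i /\ Q k' = poly_of_rats R s q.

Hypothesis inverses : forall k (P : {poly K}) r, (r <= block_end k)%N ->
  coef_norm P <= trunc_size b k.+1 ->
  (2 * k.+1%:R * coords_size k)^-1 <= modulus P`_r ->
  exists U : {poly K}, [/\ (size U <= (block_end k.+1).+1)%N, U`_0 = 0,
    coef_norm U <= gam k.+1 &
    forall d, (d <= block_end k.+1)%N ->
      modulus (U * P - 'X^(fan_start k))`_d
        <= (k.+1%:R * initial_norm b k.+1)^-1].

(** The power ['X^(fan_start k)] differs from [Q k] by the first vector of the
    fan, whose norm is at most the inverse of [lam k]; and [Q k] can be chosen
    close to [f] with [k] as large as one likes. *)
Lemma orbit_one_dense f i (e : R) : 0 < e ->
  exists c, nu b i ('X^c - f) <= e.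
Proof.
move=> e0; have e20 : 0 < e / 2 by rewrite divr_gt0.
pose D := 1 + \sum_(m < size f) nu b i 'X^m.
have D0 : 0 < D by rewrite ltr_pwDl// sumr_ge0.
have [q [sq _ hq]] := poly_of_rats_dense f (divr_gt0 e20 D0).
have [n hn] : exists n : nat, (e / 2)^-1 <= n%:R.
  exists (Num.truncn (e / 2)^-1).+1; apply/ltW/truncnS_gt.
have [k nk [ki kQ]] := schedule i q n.
exists (fan_start k).
have -> : 'X^(fan_start k) - f = A (fan_start k) - (f - Q k).
  by rewrite (fan_start_polyE Q); ring.
apply: le_trans (seminormB _ _ (nu_sn i)) _; rewrite (splitr e) lerD//.
  rewrite nu_fan; apply: le_trans (_ : (lam k)^-1 <= _).
    rewrite -ki -[fan_start k]addn0 -[leRHS]mul1r ler_pdivlMr ?lam_gt0//.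
    exact: (weight_fan1 gb (leq0n _)).
  rewrite -[leRHS]invrK lef_pV2 ?posrE ?invr_gt0 ?lam_gt0//.
  apply: le_trans hn _; apply: le_trans (lam_ge k).
  by rewrite ler_nat leqW.
rewrite -[f - Q k]mulr1.
apply: le_trans (_ : e / 2 / D * D <= _); last by rewrite divfK// gt_eqF.
apply: le_trans (@seminorm_mul_le _ _ _ _ _ D (nu_sn i) _) _.
  move=> m ms _; rewrite mulr1 /D.
  have mf : (m < size f)%N.
    apply: leq_trans ms _; rewrite (leq_trans (size_polyD _ _))// geq_max leqnn.
    by rewrite size_polyN kQ (leq_trans (size_poly_of_rats _ _ _)).
  by rewrite (bigD1 (Ordinal mf))//= addrCA lerDl addr_ge0// sumr_ge0.
by rewrite ler_wpM2r ?(ltW D0)// kQ.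
Qed.

(** The coefficients of low degree determine the coordinates of index at most
    [block_end k]. They are those of a truncation before block [k], up to the
    coordinates of [x] in the fan, which are negligible since the weights of
    the fan are large at index [(foc k).+1]. *)
Lemma trunc_coef_large k n0 (x : nat -> K) :
  Q k = 1 -> (n0 <= block_end k)%N -> k.+1%:R^-1 <= modulus (x n0) ->
  (forall n, modulus (x n) * b (foc k).+1 n <= k.+1%:R) ->
  exists2 r, (r <= block_end k)%N & (2 * k.+1%:R * coords_size k)^-1 <=
    modulus (\sum_(n < (block_end k.+1).+1) x n *: A n)`_r.
Proof.
move=> Qk n0k xn0 xB; set P := \sum_(n < _) _; set rho := _^-1.
have k0 : 0 < k.+1%:R :> R by rewrite ltr0n.
have C1 := coords_size_ge1 k; have C0 : 0 < coords_size k by apply: lt_le_trans C1.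
have rho0 : 0 < rho by rewrite invr_gt0 !mulr_gt0.
pose P' := \sum_(n < (block_end k).+1) x n *: A n.
have PE r : (r <= block_end k)%N -> P`_r = P'`_r - x (fan_start k + r)%N.
  move=> rk; rewrite /P; have ck := fan_start_gt k.
  have -> : (block_end k.+1).+1 = ((block_end k).+1 +
    (fan_start k - (block_end k).+1) + (block_end k).+1)%N.
    by rewrite block_endS; nat_lia.
  rewrite !big_split_ord/= !coefD -addrA; congr (_ + _).
  rewrite coef_sum big1 ?add0r => [|j _].
    have rk' : (r < (block_end k).+1)%N by [].
    rewrite coef_sum (bigD1 (Ordinal rk'))//= big1 ?addr0 => [|j jr].
      rewrite subnKC; last by nat_lia.
      rewrite coefZ fan_poly_fan// Qk coefXnM ltnn subnn coefB coef1 coefXn.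
      by rewrite ltn_eqF ?sub0r ?mulrN1//; nat_lia.
    rewrite subnKC; last by nat_lia.
    have jk : (j <= block_end k)%N by rewrite -ltnS.
    rewrite coefZ fan_poly_fan// Qk coefXnM; case: ltnP => h; first by rewrite mulr0.
    rewrite coefB coef1 coefXn.
    have rj : (r - j == 0)%N = false.
      apply/negbTE; apply: contra jr; rewrite subn_eq0 => h'.
      by apply/eqP/val_inj => /=; apply/eqP; rewrite eqn_leq h h'.
    by rewrite rj ltn_eqF ?subrr ?mulr0//; nat_lia.
  have hj := ltn_ord j.
  rewrite coefZ (@fan_poly_pure _ _ Q k); last by nat_lia.
  by rewrite coefXn ltn_eqF ?mulr0//; nat_lia.
apply: contrapT => no.
have small r : (r <= block_end k)%N -> modulus P'`_r <= 2 * rho.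
  move=> rk; have -> : P'`_r = P`_r + x (fan_start k + r)%N by rewrite PE// subrK.
  apply: le_trans (modulusD _ _) _; rewrite mulr_natl mulr2n lerD//.
    by rewrite leNgt; apply/negP => h; apply: no; exists r => //; exact: ltW.
  have w0 := weight_in_fan gb rk.
  have l0 := lam_gt0 k.
  apply: le_trans (_ : k.+1%:R / lam k <= _).
    rewrite ler_pdivlMr//; apply: le_trans (xB (fan_start k + r)%N).
    by rewrite ler_wpM2l ?modulus_ge0.
  rewrite /rho ler_pdivrMr// -ler_pdivrMl ?invr_gt0 ?mulr_gt0// invrK.
  apply: le_trans (lam_coords lc k); rewrite expr2 -!mulrA.
  by rewrite le_eqVlt; apply/orP; left; apply/eqP; ring.
have sP' : (size P' <= (block_end k).+1)%N by exact: size_fan_sum.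
have : modulus (x n0) <= 2 * rho * (coords_size k - 1).
  have -> : x n0 = (coords size_Q P')`_n0.
    by rewrite coords_fan_sum coef_poly ltnS n0k.
  rewrite (coordsE size_Q sP') coef_sum; apply: le_trans (modulus_sum _ _ _) _.
  rewrite /coords_size addrC addKr mulr_sumr; apply: ler_sum => r _.
  rewrite coefZ modulusM; apply: ler_pM; rewrite ?modulus_ge0//.
    by apply: small; rewrite -ltnS.
  exact: modulus_coef_le.
apply/negP; rewrite -ltNge; apply: lt_le_trans xn0.
have -> : k.+1%:R^-1 = 2 * rho * coords_size k.
  by rewrite /rho; field; rewrite !gt_eqF.
by rewrite ltr_pM2l ?mulr_gt0// gtrBl.
Qed.

Let nu_low_high (f : {poly K}) l k (z : R) : (l <= k)%N -> 0 <= z ->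
  (size f <= (block_end k).+1 + block_end k)%N ->
  (forall d, (d <= block_end k)%N -> modulus f`_d <= z) ->
  nu b l f <= z * initial_norm b k + coef_norm f / lam k.
Proof.
move=> lk z0 sf hf; rewrite {1}(poly_sumE sf) big_split_ord/=.
apply: le_trans (seminormD (nu_sn l) _ _) _; rewrite lerD//.
  apply: le_trans (seminorm_sum _ _ _ (nu_sn l)) _.
  rewrite /initial_norm mulrDr mulr1 mulr_sumr -[leLHS]add0r lerD//.
  apply: ler_sum => d _; rewrite (seminormZ (nu_sn l)).
  by rewrite ler_pM ?modulus_ge0 ?nu_mono ?hf// -ltnS.
apply: le_trans (seminorm_sum _ _ _ (nu_sn l)) _.
rewrite (coef_normE sf) [X in _ <= X / _]big_split_ord/= mulrDl -[leLHS]add0r.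
apply: lerD.
  by rewrite divr_ge0 ?sumr_ge0 ?ltW ?lam_gt0// => d _; exact: modulus_ge0.
rewrite mulr_suml; apply: ler_sum => d _; rewrite (seminormZ (nu_sn l)).
rewrite ler_wpM2l ?modulus_ge0//; have hd := ltn_ord d.
have ck := fan_start_gt k.
have hm : (block_end k < (block_end k).+1 + d <= 3 * block_end k)%N.
  by nat_lia.
rewrite -(@fan_poly_pure _ _ Q k); last by nat_lia.
rewrite nu_fan -[leRHS]mul1r ler_pdivlMr ?lam_gt0//.
apply: le_trans (weight_start1 gb hm).
by rewrite ler_wpM2r ?(weight_mono gb)// ltW ?lam_gt0.
Qed.

Lemma sum_half_le m n : \sum_(m <= i < n) (2 ^+ i)^-1 <= 2 :> R.
Proof.
apply: le_trans (_ : \sum_(0 <= i < n) (2 ^+ i)^-1 <= _); last first.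
  suff -> : \sum_(0 <= i < n) (2 ^+ i)^-1 = 2 - 2 * (2 ^+ n)^-1 :> R.
    by rewrite gerBl mulr_ge0// invr_ge0 exprn_ge0.
  elim: n => [|n ih]; first by rewrite big_geq// expr0 invr1 mulr1 subrr.
  rewrite big_nat_recr//= ih exprS; field.
  by rewrite expf_eq0 pnatr_eq0 andbF.
have [mn|nm] := leqP m n; last by rewrite big_geq ?sumr_ge0 1?ltnW.
by rewrite [leRHS](big_cat_nat (leq0n m) mn)/= lerDr sumr_ge0.
Qed.

(** A fan with polynomial [1] makes some power ['X^a] close to [1]; the
    truncation [P] of the vector after this fan divides ['X^a] up to a small
    error and terms of large degree, which are small too as they lie in the
    first window of the next block; a later fan realizes the multiplication by
    the quotient as a power of the variable, and this power is small on the rest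
    of the vector by [jump_tail]. *)
Lemma orbit_near_one (x : nat -> K) (B : nat -> R) n0 i (e : R) :
  x n0 != 0 -> (forall l n, modulus (x n) * b l n <= B l) -> 0 < e ->
  exists c L0, forall L, (L0 <= L)%N ->
    nu b i ('X^c * (\sum_(n < L) x n *: A n) - 1) <= e.
Proof.
move=> xn0 xB e0; set B1 := B i.+1.
have B10 : 0 <= B1.
  by apply: le_trans (xB i.+1 0%N); rewrite mulr_ge0 ?modulus_ge0.
pose C := (modulus (x n0))^-1 + B1 + (5 + 4 * B1) / e.
have mx0 : 0 < modulus (x n0) by exact: modulus_gt0.
have C0 : 0 <= (5 + 4 * B1) / e by apply: divr_ge0; [lra|exact: ltW].
have [k0 k0n [foc0 Qk0]] := schedule i [:: (1, 0)] (n0 + (Num.truncn C).+1)%N.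
rewrite poly_of_rats1 in Qk0.
set y : R := k0.+1%:R.
have y0 : 0 < y by rewrite ltr0n.
have Cy : C <= y.
  apply/ltW; apply: lt_le_trans (truncnS_gt _) _; rewrite ler_nat.
  exact: leq_trans (leq_addl _ _) (leqW k0n).
have y1 : (modulus (x n0))^-1 <= y.
  by apply: le_trans Cy; rewrite /C -addrA lerDl addr_ge0.
have y2 : B1 <= y.
  by apply: le_trans Cy; rewrite /C addrAC lerDr addr_ge0 ?invr_ge0 ?modulus_ge0.
have y3 : (5 + 4 * B1) / y <= e.
  rewrite ler_pdivrMr// -ler_pdivrMl// [e^-1 * _]mulrC; apply: le_trans Cy.
  by rewrite lerDr addr_ge0 ?invr_ge0 ?modulus_ge0.
have n0k : (n0 <= block_end k0)%N.
  exact: leq_trans (leq_trans (leq_addr _ _) k0n) (leq_block_end k0).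
have ik0 : (i <= k0)%N by rewrite -foc0.
set N := block_end k0.+1; pose P : {poly K} := \sum_(n < N.+1) x n *: A n.
have T0 : 0 <= trunc_size b k0.+1 by exact: trunc_size_ge0.
have g0 := gam_ge0 lc k0.+1.
have PT : coef_norm P <= trunc_size b k0.+1.
  apply: le_trans (seminorm_sum _ _ _ (coef_norm_is_seminorm _ _)) _.
  rewrite /trunc_size mulr_sumr; apply: ler_sum => n _.
  rewrite (seminormZ (coef_norm_is_seminorm _ _)) mulrC mulrCA.
  rewrite ler_wpM2l ?coef_norm_ge0// ler_pdivlMr ?(weight_gt0 gb)//.
  apply: le_trans y2; apply: le_trans (xB i.+1 n).
  by rewrite ler_wpM2l ?modulus_ge0.
have [r rk Pr] : exists2 r, (r <= block_end k0)%N &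
    (2 * k0.+1%:R * coords_size k0)^-1 <= modulus P`_r.
  apply: (@trunc_coef_large k0 n0) => //.
    by rewrite -[leRHS]invrK lef_pV2 ?posrE ?invr_gt0 ?ltr0n.
  by move=> n; rewrite foc0; apply: le_trans (xB _ _) y2.
have [U [sU U0 Ug hU]] := inverses rk PT Pr.
rewrite -/N in sU hU.
pose D := 1 + \sum_(d < N.+1) nu b i ('X^d * P).
have D0 : 0 < D by rewrite ltr_pwDl// sumr_ge0.
have d0 : 0 < Num.min 1 (y * D)^-1 by rewrite lt_min ltr01 invr_gt0 mulr_gt0.
have [q [sq q0 qU]] := poly_of_rats_dense U d0.
have [k k0k [fock Qk]] := schedule i q k0.+1.
have sq' : (size (Q k) <= N.+1)%N.
  by rewrite Qk (leq_trans (size_poly_of_rats _ _ _))// (leq_trans sq).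
have kN : (N <= block_end k)%N by exact: block_end_mono.
have trunc_le : (1 + gam k0.+1) * (1 + trunc_size b k0.+1) / lam k0.+1 <= y^-1.
  apply: le_trans (_ : k0.+2%:R^-1 <= _).
    rewrite ler_pdivrMr ?lam_gt0// ler_pdivlMl ?ltr0n// mulrC.
    exact: (lam_trunc lc k0.+1).
  by rewrite lef_pV2 ?posrE ?ltr0n// ler_nat.
have small_T : trunc_size b k0.+1 / lam k0.+1 <= y^-1.
  apply: le_trans trunc_le; rewrite ler_pM2r ?invr_gt0 ?lam_gt0//.
  by rewrite -[leLHS]mul1r ler_pM// ?lerDl ?lerDr.
exists (fan_start k), N.+1 => L NL.
pose tail : {poly K} := \sum_(N.+1 <= n < L) x n *: ('X^(fan_start k) * A n).
have -> : 'X^(fan_start k) * (\sum_(n < L) x n *: A n) - 1 =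
    (Q k - U) * P + (U * P - 'X^(fan_start k0)) + A (fan_start k0)
    + P * A (fan_start k) + tail.
  rewrite -(big_mkord predT (fun n => x n *: A n)).
  rewrite (big_cat_nat (leq0n N.+1) NL)/= big_mkord.
  rewrite -/P mulrDr [_ * \sum_(_ <= _ < _) _]mulr_sumr.
  under eq_bigr do rewrite -scalerAr.
  rewrite -/tail {1}(fan_start_polyE Q) (fan_start_polyE Q k0) Qk0; ring.
have sn := seminormD (nu_sn i).
have step1 : nu b i ((Q k - U) * P) <= y^-1.
  have sQU : (size (Q k - U)%R <= N.+1)%N.
    by rewrite (leq_trans (size_polyD _ _))// geq_max size_polyN sq' sU.
  apply: le_trans (_ : coef_norm (Q k - U) * D <= _).
    apply: seminorm_mul_le (nu_sn i) _ => d dQ _.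
    have dN : (d < N.+1)%N by exact: leq_trans dQ sQU.
    by rewrite /D (bigD1 (Ordinal dN))//= addrCA lerDl addr_ge0// sumr_ge0.
  apply: le_trans (_ : (y * D)^-1 * D <= _); last first.
    by rewrite invfM -mulrA mulVf ?mulr1// gt_eqF.
  rewrite ler_wpM2r ?(ltW D0)// -(seminormN _ (coef_norm_is_seminorm _ _)) opprB Qk.
  by apply: le_trans qU _; rewrite ge_min lexx orbT.
have step2 : nu b i (U * P - 'X^(fan_start k0)) <= 2 * y^-1.
  have hf := fan_start_gt k0.
  apply: le_trans (@nu_low_high _ i k0.+1 (y * initial_norm b k0.+1)^-1 _ _ _ _) _.
  - exact: leqW.
  - by rewrite invr_ge0 mulr_ge0 ?ltW// (lt_le_trans ltr01)// initial_norm_ge1.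
  - have sP : (size P <= N.+1)%N by exact: size_fan_sum.
    rewrite -/N (leq_trans (size_polyD _ _))// geq_max size_polyN size_polyXn.
    have -> : (size (U * P)%R <= N.+1 + N)%N.
      apply: leq_trans (size_polyMleq U P) _; rewrite -subn1 leq_subLR.
      by apply: leq_trans (leq_add sU sP) _; rewrite add1n addnS.
    by rewrite /N block_endS; nat_lia.
  - exact: hU.
  have I1 := initial_norm_ge1 k0.+1.
  rewrite [2 * _]mulr_natl mulr2n lerD//.
    by rewrite invfM -mulrA mulVf ?mulr1// gt_eqF// (lt_le_trans ltr01).
  apply: le_trans trunc_le; rewrite ler_pM2r ?invr_gt0 ?lam_gt0//.
  apply: le_trans (seminormB _ _ (coef_norm_is_seminorm _ _)) _.
  have -> : coef_norm ('X^(fan_start k0) : {poly K}) = 1.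
    by rewrite -['X^_]mulr1 coef_norm_XnM coef_norm1.
  apply: le_trans (_ : gam k0.+1 * trunc_size b k0.+1 + 1 <= _); last by nra.
  rewrite lerD2r; apply: le_trans (coef_normM _ _) _.
  by rewrite ler_pM ?coef_norm_ge0.
have step3 : nu b i (A (fan_start k0)) <= y^-1.
  rewrite nu_fan; apply: le_trans (_ : (lam k0)^-1 <= _).
    rewrite -foc0 -[fan_start k0]addn0 -[leRHS]mul1r ler_pdivlMr ?lam_gt0//.
    exact: (weight_fan1 gb (leq0n _)).
  by rewrite lef_pV2 ?posrE ?lam_gt0// lam_ge.
have step4 : nu b i (P * A (fan_start k)) <= y^-1.
  apply: le_trans small_T.
  apply: le_trans (_ : coef_norm P * (lam k)^-1 <= _).
    apply: seminorm_mul_le (nu_sn i) _ => d dP _.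
    have dk : (d <= block_end k)%N.
      by apply: leq_trans kN; rewrite -ltnS (leq_trans dP)// size_fan_sum.
    have -> : 'X^d * A (fan_start k) = A (fan_start k + d)%N.
      by rewrite fan_poly_fan// -[X in A X]addn0 fan_poly_fan// expr0 mul1r.
    rewrite nu_fan -fock -[leRHS]mul1r ler_pdivlMr ?lam_gt0//.
    exact: (weight_fan1 gb dk).
  rewrite ler_pM ?coef_norm_ge0 ?invr_ge0 ?(ltW (lam_gt0 _))//.
  by rewrite lef_pV2 ?posrE ?lam_gt0// (lam_mono lc).
have step5 : nu b i tail <= 4 * B1 / y.
  apply: le_trans (seminorm_sum _ _ _ (nu_sn i)) _.
  apply: le_trans (_ : \sum_(N.+1 <= n < L) 2 * B1 / y * (2 ^+ n)^-1 <= _).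
    rewrite big_nat_cond [leRHS]big_nat_cond; apply: ler_sum => n /andP[/andP[Nn _] _].
    rewrite (seminormZ (nu_sn i)).
    have := @jump_tail k0 k n k0k sq' _ _ _ Nn; rewrite fock => h.
    apply: le_trans (ler_wpM2l (modulus_ge0 _) (h _ _ ik0)) _.
    - by rewrite Qk q0.
    - have -> : Q k = U - (U - Q k) by ring.
      apply: le_trans (seminormB _ _ (coef_norm_is_seminorm _ _)) _.
      rewrite addrC lerD// Qk; apply: le_trans qU _.
      by rewrite ge_min lexx.
    have -> : modulus (x n) * (2 / k0.+1%:R / 2 ^+ n * b i.+1 n) =
      modulus (x n) * b i.+1 n * (2 / y / 2 ^+ n) by rewrite /y; ring.
    have -> : 2 * B1 / y / 2 ^+ n = B1 * (2 / y / 2 ^+ n) by ring.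
    by rewrite ler_wpM2r ?xB// !divr_ge0 ?exprn_ge0 ?(ltW y0).
  rewrite -mulr_sumr; apply: le_trans (_ : 2 * B1 / y * 2 <= _); last first.
    by rewrite le_eqVlt; apply/orP; left; apply/eqP; ring.
  rewrite ler_wpM2l ?divr_ge0 ?mulr_ge0 ?(ltW y0)//.
  exact: sum_half_le.
apply: le_trans (sn _ _) _; apply: le_trans (lerD (sn _ _) step5) _.
apply: le_trans (lerD (lerD (sn _ _) step4) (lexx _)) _.
apply: le_trans (lerD (lerD (lerD (sn _ _) step3) (lexx _)) (lexx _)) _.
apply: le_trans (lerD (lerD (lerD (lerD step1 step2) (lexx _)) (lexx _)) (lexx _)) _.
apply: le_trans y3; rewrite le_eqVlt; apply/orP; left; apply/eqP; ring.
Qed.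

End Estimates.

(** * The schedule of fan polynomials *)

Lemma injective_unbounded (f : nat -> nat) : injective f ->
  forall m, exists j, (m <= f j)%N.
Proof.
move=> finj m; apply: contrapT => no.
have fm j : (f j < m)%N.
  by rewrite ltnNge; apply/negP => h; apply: no; exists j.
have /leq_card : injective (fun j : 'I_m.+1 => Ordinal (fm j)).
  by move=> i j [] /finj /val_inj.
by rewrite !card_ord ltnn.
Qed.

Section Schedule.
Variables (R : realType) (s : scalar_kind).
Local Notation K := (scalars R s).

(** The third entry of the decoded triple is there to make every pair occur
    infinitely often. *)
Definition schedule_item (k : nat) : nat * seq (rat * rat) :=
  if (unpickle k : option (nat * seq (rat * rat) * nat)) is Some (i, q, _) then
    if (i <= k)%N && (size q <= (block_end k).+1)%N
    then (i, q) else (0%N, [::])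
  else (0%N, [::]).

Lemma schedule_exists : exists (foc : nat -> nat) (Q : nat -> {poly K}),
  [/\ forall k, (foc k <= k)%N,
      forall k, (size (Q k) <= (block_end k).+1)%N &
      forall i q k, exists2 k', (k <= k')%N &
        foc k' = i /\ Q k' = poly_of_rats R s q].
Proof.
exists (fun k => (schedule_item k).1).
exists (fun k => poly_of_rats R s (schedule_item k).2); split.
- by move=> k; rewrite /schedule_item; case: unpickle => [[[i q] _]|]//; case: ifP => // /andP[].
- move=> k; apply: leq_trans (size_poly_of_rats _ _ _) _.
  by rewrite /schedule_item; case: unpickle => [[[i q] _]|]//; case: ifP => // /andP[].
move=> i q k.
have [|j hj] := @injective_unbounded (fun j => pickle (i, q, j)) _ (k + i + size q)%N.
  by move=> j j' /(pcan_inj pickleK) [].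
exists (pickle (i, q, j)).
  by apply: leq_trans hj; rewrite -addnA leq_addr.
rewrite /schedule_item pickleK.
have -> : (i <= pickle (i, q, j))%N.
  by apply: leq_trans hj; rewrite addnAC leq_addl.
have -> // : (size q <= (block_end (pickle (i, q, j))).+1)%N.
apply: leqW; apply: leq_trans (leq_block_end _); apply: leq_trans hj.
exact: leq_addl.
Qed.

End Schedule.

(** * Choosing the basis vectors *)

Section Selection.
Variable R : realType.

(** The predicate is stated on an infinite history to avoid dependent types;
    the second hypothesis says that it looks at the past only. *)
Lemma choice_along_history (T : Type) (t0 : T) (P : nat -> (nat -> T) -> T -> Prop) :
  (forall n h, exists t, P n h t) ->
  (forall n h h' t, (forall m, (m < n)%N -> h m = h' m) -> P n h t -> P n h' t) ->
  exists u : nat -> T, forall n, P n u (u n).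
Proof.
move=> ex loc.
have /choice[g hg] : forall nh : nat * (nat -> T), exists t, P nh.1 nh.2 t.
  by move=> [n h]; exact: ex.
pose fix hist n : seq T :=
  if n is n'.+1 then rcons (hist n') (g (n', nth t0 (hist n'))) else [::].
have size_hist n : size (hist n) = n by elim: n => //= n ih; rewrite size_rcons ih.
pose u n := nth t0 (hist n.+1) n.
have histE n m : (m < n)%N -> nth t0 (hist n) m = u m.
  elim: n => // n ih; rewrite ltnS leq_eqVlt => /predU1P[->//|mn].
  by rewrite /= nth_rcons size_hist mn ih.
exists u => n; apply: (loc n (nth t0 (hist n))).
  by move=> m; exact: histE.
by rewrite /u /= nth_rcons size_hist ltnn eqxx; exact: (hg (n, _)).
Qed.

Variable a : nat -> nat -> R.
Hypothesis a_gt0 : forall l k, 0 < a l k.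
Hypothesis a_ratio : forall l C, exists k, C * a l k < a l.+1 k.

Let a_ratio_fresh l C (avoid : seq nat) :
  exists2 k, k \notin avoid & C * a l k <= a l.+1 k.
Proof.
pose D := \sum_(j <- avoid) a l.+1 j / a l j.
have D0 : 0 <= D by apply: sumr_ge0 => j _; rewrite divr_ge0 ?ltW.
have [k hk] := a_ratio l (`|C| + D); exists k; last first.
  apply: ltW; apply: le_lt_trans hk; rewrite ler_pM2r//.
  by apply: le_trans (ler_norm _) _; rewrite lerDl.
apply/negP => ka; move: hk; apply/negP; rewrite -leNgt -ler_pdivrMr//.
rewrite /D (big_rem k)//= addrCA lerDl addr_ge0// sumr_ge0// => j _.
by rewrite divr_ge0 ?ltW.
Qed.

Variables (I : Type) (rank lev top : I -> nat).
Hypothesis rank_inj : injective rank.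
Variable const : I -> (I -> nat -> R) -> R.
Hypothesis const_gt0 : forall w c, (forall u l, 0 < c u l) -> 0 < const w c.
Hypothesis const_local : forall w c c',
  (forall u, (rank u < rank w)%N -> c u = c' u) -> const w c = const w c'.

Definition scaled (kap : I -> nat) (xi : I -> R) (w : I) (l : nat) : R :=
  xi w * a l (kap w).

(** The scale [xi w] makes the weight of [w] at its level as small as the
    finitely many previous choices require. Since the ratio of consecutive
    weights is unbounded, the coordinate [kap w] can be taken so that the next
    weight is nevertheless as large as they require. *)
Lemma selection : exists (kap : I -> nat) (xi : I -> R),
  [/\ injective kap, forall w, 0 < xi w &
  forall w, let c := scaled kap xi in
    [/\ c w (lev w) * const w c <= 1,
        const w c <= c w (lev w).+1 &
        forall u, (rank u < rank w)%N ->
          c w (lev w) * const w c <= c u 0%N /\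
          const w c * c u (top w) <= c w (lev w).+1]].
Proof.
pose val (t : nat * R) l := t.2 * a l t.1.
pose hval (h : nat -> nat * R) (w : I) := val (h (rank w)).
pose pos (h : nat -> nat * R) : nat -> nat * R :=
  fun m => if 0 < (h m).2 then h m else (0%N, 1).
have pos_gt0 h m : 0 < (pos h m).2 by rewrite /pos; case: ifP.
have val_gt0 h m l : 0 < val (pos h m) l by rewrite mulr_gt0.
pose P n (h : nat -> nat * R) (t : nat * R) :=
  [/\ 0 < t.2, forall m, (m < n)%N -> t.1 <> (h m).1 &
  forall w, rank w = n -> let L := const w (hval (pos h)) in
    [/\ val t (lev w) * L <= 1, L <= val t (lev w).+1 &
     forall m, (m < n)%N -> val t (lev w) * L <= val (pos h m) 0%N /\
       L * val (pos h m) (top w) <= val t (lev w).+1]].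
have [n h|n h h' t hh|u hu] := @choice_along_history _ (0%N, 1) P.
- pose av := [seq (h m).1 | m <- iota 0 n].
  have avP k : k \notin av -> forall m, (m < n)%N -> k <> (h m).1.
    move=> kav m mn kE; move/negP: kav; apply; rewrite kE.
    by apply: map_f; rewrite mem_iota.
  case: (pselect (exists w, rank w = n)) => [[w wn]|no]; last first.
    have [k kav _] := a_ratio_fresh 0 0 av.
    exists (k, 1); split=> //; first exact: avP.
    by move=> w wn; case: no; exists w.
  set L := const w (hval (pos h)).
  have L0 : 0 < L by apply: const_gt0 => u l; exact: val_gt0.
  pose S := 1 + \sum_(m < n) (val (pos h m) 0%N)^-1.
  pose S' := 1 + \sum_(m < n) val (pos h m) (top w).
  have S0 : 0 < S by rewrite ltr_pwDl// sumr_ge0// => m _; rewrite invr_ge0 ltW.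
  have S1 : 1 <= S by rewrite lerDl sumr_ge0// => m _; rewrite invr_ge0 ltW.
  have S'1 : 1 <= S' by rewrite lerDl sumr_ge0// => m _; rewrite ltW.
  pose d := (L * S)^-1; have d0 : 0 < d by rewrite invr_gt0 mulr_gt0.
  have dL : d * L = S^-1 by rewrite /d invfM mulrAC mulVf ?mul1r// gt_eqF.
  have [k kav hk] := a_ratio_fresh (lev w) (L * S' / d) av.
  exists (k, d / a (lev w) k); split=> /=; first by rewrite divr_gt0.
    exact: avP.
  move=> w' w'n; have -> : w' = w by apply: rank_inj; rewrite w'n.
  rewrite -/L.
  have v1 : val (k, d / a (lev w) k) (lev w) = d.
    by rewrite /val /= divfK// gt_eqF.
  have v2 : L * S' <= val (k, d / a (lev w) k) (lev w).+1.
    rewrite /val /= mulrAC ler_pdivlMr// -ler_pdivrMl//.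
    by apply: le_trans hk; rewrite le_eqVlt; apply/orP; left; apply/eqP; ring.
  rewrite v1 dL; split.
  - by rewrite invf_le1.
  - by apply: le_trans v2; rewrite ler_peMr// ltW.
  move=> m mn; split.
    rewrite -[leRHS]invrK lef_pV2 ?posrE ?invr_gt0//.
    rewrite /S (bigD1 (Ordinal mn))//= addrCA lerDl addr_ge0// sumr_ge0//.
    by move=> j _; rewrite invr_ge0 ltW.
  apply: le_trans v2; rewrite ler_pM2l//.
  rewrite /S' (bigD1 (Ordinal mn))//= addrCA lerDl addr_ge0// sumr_ge0//.
  by move=> j _; rewrite ltW.
- have hhp m : (m < n)%N -> pos h m = pos h' m by move=> mn; rewrite /pos hh.
  move=> [t0 tn hw]; split=> //; first by move=> m mn; rewrite -hh//; exact: tn.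
  move=> w wn; have [h1 h2 h3] := hw w wn.
  have -> : const w (hval (pos h')) = const w (hval (pos h)).
    by apply: const_local => u; rewrite wn => /hhp; rewrite /hval => ->.
  by split=> // m mn; rewrite -hhp//; exact: h3.
have posu m : pos u m = u m by rewrite /pos; case: (hu m) => ->.
have hvalE : hval (pos u) = scaled (fun w => (u (rank w)).1) (fun w => (u (rank w)).2).
  by apply/funext => w; rewrite /hval posu.
exists (fun w => (u (rank w)).1), (fun w => (u (rank w)).2); split.
- move=> w w' /= ww'; apply: rank_inj; case: (ltngtP (rank w) (rank w')) => //.
    by move=> lt; have [_ /(_ _ lt) + _] := hu (rank w'); rewrite ww'.
  by move=> lt; have [_ /(_ _ lt) + _] := hu (rank w); rewrite ww'.
- by move=> w; case: (hu (rank w)).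
move=> w /=; have [_ _ /(_ w erefl)] := hu (rank w).
rewrite hvalE => -[h1 h2 h3]; split=> // v vw.
by have := h3 _ vw; rewrite posu.
Qed.

End Selection.

(** * Ranks and levels *)

Section RanksLevels.
Local Open Scope nat_scope.
Variable foc : nat -> nat.
Hypothesis foc_le : forall k, foc k <= k.

(** Every basis vector has two components, indexed by [(n, false)] and
    [(n, true)]; the rank is the order in which their weights are chosen. A
    component that is chosen later is negligible up to its level, and huge
    above it, with respect to those chosen earlier. Hence the first components
    of a block come before the second ones, and its fan before its first
    window; the first components increase with respect to [n] so that their
    weights decrease, and the second components are taken backwards so that,
    above their levels, their weights decrease too. *)
Definition slot_rank (w : nat * bool) : nat :=
  let: (n, c) := w in
  if n == 0 then nat_of_bool c else
  let k := block_of n in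
  2 * (block_end k).+1 +
  (if c then fan_start k + (block_end k.+1 - n)
   else if fan_start k <= n then n - fan_start k else n).

(** A shift by at most [block_end k] meets at most two windows, so that it
    changes the level of a second component by at most one. The windows bring
    this level from [k], at the start of the block, down to [0] just before the
    fan. *)
Definition slot_level (w : nat * bool) : nat :=
  let: (n, c) := w in
  let k := block_of n in
  if c then
    if fan_start k <= n then foc k
    else k - (n - (block_end k).+1) %/ (2 * block_end k).+1
  else k.

Lemma slot_rank_gen n c k : block_end k < n <= block_end k.+1 ->
  slot_rank (n, c) = 2 * (block_end k).+1 +
  (if c then fan_start k + (block_end k.+1 - n)
   else if fan_start k <= n then n - fan_start k else n).
Proof.
by move=> h; rewrite /slot_rank (block_ofE h); case: n h.
Qed.

Lemma slot_rank_block n c k : block_end k < n <= block_end k.+1 ->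
  2 * (block_end k).+1 <= slot_rank (n, c) < 2 * (block_end k.+1).+1.
Proof.
move=> h; rewrite (slot_rank_gen c h); rewrite !block_endS in h *.
have := fan_start_gt k; case: c; first by lia.
by case: ifP; lia.
Qed.

Lemma slot_rank_early n c k : n <= block_end k ->
  slot_rank (n, c) < 2 * (block_end k).+1.
Proof.
case: (posnP n) => [-> _|n0 nk]; first by rewrite /slot_rank /=; case: c; lia.
have hn := block_ofP n0; have /andP[_ h] := slot_rank_block c hn.
apply: leq_trans h _; have : block_of n < k.
  rewrite ltnNge; apply/negP => /block_end_mono; lia.
by move/block_end_mono; lia.
Qed.

Lemma slot_rank_inj : injective slot_rank.
Proof.
suff wlog_le n c m d : n <= m -> slot_rank (n, c) = slot_rank (m, d) ->
    (n, c) = (m, d).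
  move=> [n c] [m d] e; case: (leqP n m) => h; first exact: wlog_le.
  by apply/esym/wlog_le; [exact: ltnW|].
case: (posnP m) => [->|m0].
  by rewrite leqn0 => /eqP->; rewrite /slot_rank /=; case: c d => [] [].
move=> nm e; have hm := block_ofP m0; set k := block_of m in hm.
have /andP[rm rm'] := slot_rank_block d hm.
case: (leqP n (block_end k)) => nk.
  by have := slot_rank_early c nk; rewrite e; lia.
have hn : block_end k < n <= block_end k.+1.
  by rewrite nk; case/andP: hm => _; exact: leq_trans.
move: e; rewrite (slot_rank_gen c hn) (slot_rank_gen d hm).
have := fan_start_gt k; rewrite !block_endS in hm hn *.
clear rm rm'; case: c; case: d; do ?[case: ifP => ?] => ? ?;
  first [congr (_, _); lia | exfalso; lia].
Qed.

Lemma slot_level_fan k j c : j <= block_end k ->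
  slot_level (fan_start k + j, c) = if c then foc k else k.
Proof.
move=> jk; rewrite /slot_level; have h := fan_start_gt k.
by rewrite (@block_ofE k) ?block_endS ?leq_addr//; lia.
Qed.

Lemma slot_level_pure k n : block_end k < n < fan_start k ->
  slot_level (n, true) = k - (n - (block_end k).+1) %/ (2 * block_end k).+1.
Proof.
move=> /andP[h1 h2]; rewrite /slot_level (@block_ofE k).
  by rewrite leqNgt h2.
by rewrite h1 block_endS; lia.
Qed.

Lemma slot_level_first k n : block_end k < n <= block_end k.+1 ->
  slot_level (n, false) = k.
Proof. by move=> h; rewrite /slot_level (block_ofE h). Qed.

Lemma slot_level_before_fan k n : fan_start k <= n + block_end k ->
  n < fan_start k -> slot_level (n, true) = 0.
Proof.
move=> h1 h2; have hf := fan_start_gt k.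
rewrite (@slot_level_pure k) ?h2 ?andbT; last by lia.
apply/eqP; rewrite subn_eq0 leq_divRL//.
by rewrite fan_startE in h1; nia.
Qed.

Lemma slot_level_start k n : block_end k < n <= 3 * block_end k ->
  slot_level (n, true) = k.
Proof.
move=> h; have hf := fan_start_gt k.
rewrite (@slot_level_pure k); last by lia.
by rewrite divn_small ?subn0//; lia.
Qed.

Lemma slot_level_chain k n m : block_end k < n -> n < m ->
  m <= block_end k.+1 -> m <= n + block_end k ->
  slot_level (n, true) <= (slot_level (m, true)).+1.
Proof.
move=> kn nm mk mn; rewrite block_endS in mk.
case: (ltnP n (fan_start k)) => hn; last first.
  have -> : n = fan_start k + (n - fan_start k) by rewrite subnKC.
  have -> : m = fan_start k + (m - fan_start k) by lia.
  by rewrite !slot_level_fan//; lia.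
case: (ltnP m (fan_start k)) => hm; last first.
  by rewrite (@slot_level_before_fan k n)//; lia.
rewrite !(@slot_level_pure k) ?kn ?hn ?hm ?andbT//; last by lia.
set W := (2 * block_end k).+1.
have h : (m - (block_end k).+1) %/ W <= ((n - (block_end k).+1) %/ W).+1.
  rewrite -ltnS ltn_divLR//.
  have := ltn_ceil (n - (block_end k).+1) (isT : 0 < W); rewrite /W; nia.
lia.
Qed.

End RanksLevels.

(** * Construction of the weights *)

Lemma ler_sum_ord (R : realType) (F : nat -> R) m n :
  (forall i, 0 <= F i) -> (m <= n)%N -> \sum_(i < m) F i <= \sum_(i < n) F i.
Proof.
move=> F0 mn; rewrite -!(big_mkord predT) (big_cat_nat (leq0n m) mn)/= lerDl.
exact: sumr_ge0.
Qed.

Section Weights.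
Variables (R : realType) (s : scalar_kind).
Local Notation K := (scalars R s).
Variable a : nat -> nat -> R.
Hypothesis a_gt0 : forall l k, 0 < a l k.
Hypothesis a_mono : forall l l' k, (l <= l')%N -> a l k <= a l' k.
Hypothesis a_ratio : forall l C, exists k, C * a l k < a l.+1 k.

Definition pair_weight (c : nat * bool -> nat -> R) (l n : nat) : R :=
  Num.max (c (n, false) l) (c (n, true) l).

Section FixedSchedule.
Variables (foc : nat -> nat) (Q : nat -> {poly K}).
Hypothesis foc_le : forall k, (foc k <= k)%N.
Hypothesis size_Q : forall k, (size (Q k) <= (block_end k).+1)%N.

(** The constants [lam] enter the choice of the weights, so the bounds of
    [approx_inverse] are needed as a function of the data that will be known
    when the choice is made. *)
Lemma inverse_bounds : exists G : nat -> R * R -> R,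
  forall k B eta, 0 <= B -> 0 < eta -> 0 <= G k (B, eta) /\
  forall (P : {poly K}) r, (r <= block_end k)%N -> coef_norm P <= B ->
    (2 * k.+1%:R * coords_size size_Q k)^-1 <= modulus P`_r ->
    exists U : {poly K}, [/\ (size U <= (block_end k.+1).+1)%N, U`_0 = 0,
      coef_norm U <= G k (B, eta) &
      forall d, (d <= block_end k.+1)%N ->
        modulus (U * P - 'X^(fan_start k))`_d <= eta].
Proof.
suff /choice[G hG] : forall kBe : nat * (R * R), exists G : R,
    0 <= kBe.2.1 -> 0 < kBe.2.2 -> 0 <= G /\
    forall (P : {poly K}) r, (r <= block_end kBe.1)%N -> coef_norm P <= kBe.2.1 ->
    (2 * kBe.1.+1%:R * coords_size size_Q kBe.1)^-1 <= modulus P`_r ->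
    exists U : {poly K}, [/\ (size U <= (block_end kBe.1.+1).+1)%N, U`_0 = 0,
      coef_norm U <= G &
      forall d, (d <= block_end kBe.1.+1)%N ->
        modulus (U * P - 'X^(fan_start kBe.1))`_d <= kBe.2.2].
  by exists (fun k Be => G (k, Be)) => k B eta B0 eta0; exact: (hG (k, (B, eta))).
move=> [k [B eta]] /=.
case: (pselect (0 <= B /\ 0 < eta)) => [[B0 eta0]|no]; last first.
  by exists 0 => B0 eta0; case: no.
pose rho : R := (2 * k.+1%:R * coords_size size_Q k)^-1.
have rho0 : 0 < rho.
  rewrite invr_gt0 !mulr_gt0 ?ltr0n//; apply: lt_le_trans ltr01 _.
  exact: coords_size_ge1.
have Ma : (block_end k < fan_start k)%N by have := fan_start_gt k; nat_lia.
have /choice[G hG] : forall r : 'I_(block_end k).+1, exists G : R, 0 <= G /\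
    forall P : {poly K}, coef_norm P <= B -> rho <= modulus P`_r ->
    exists U : {poly K}, [/\ (size U <= (fan_start k + block_end k).+1)%N,
      U`_0 = 0, coef_norm U <= G &
      forall d, (d <= fan_start k + block_end k)%N ->
        modulus (U * P - 'X^(fan_start k))`_d <= eta].
  move=> r; have rk : (r <= block_end k)%N by rewrite -ltnS.
  by have [G G0 hG] := approx_inverse s Ma rk rho0 B0 eta0; exists G.
exists (\sum_r G r) => _ _; split.
  by apply: sumr_ge0 => r _; case: (hG r).
move=> P r rk PB Pr.
have [_ /(_ P PB Pr)[U [sU U0 UG hU]]] := hG (Ordinal (rk : (r < (block_end k).+1)%N)).
exists U; split; rewrite ?block_endS//.
apply: le_trans UG _; rewrite (bigD1 (Ordinal (rk : (r < (block_end k).+1)%N)))//=.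
by rewrite lerDl sumr_ge0// => r' _; case: (hG r').
Qed.

Section Constants.
Variable G : nat -> R * R -> R.

Definition inverse_const (b : nat -> nat -> R) (k : nat) : R :=
  \sum_(j < k) G j (trunc_size Q b j.+1,
                    (j.+1%:R * initial_norm size_Q b j.+1)^-1).

Definition const_step (b : nat -> nat -> R) (k : nat) : R :=
  block_const size_Q b k * (1 + inverse_const b k + coef_norm (Q k)) *
    (1 + fan_size Q k) * (k.+1%:R * 2 ^+ block_end k.+1) +
  (1 + inverse_const b k) * (1 + trunc_size Q b k) * k.+1%:R +
  2 * k.+1%:R ^+ 2 * coords_size size_Q k.

(** The sum makes the constants nondecreasing in [k]. *)
Definition block_constant (b : nat -> nat -> R) (k : nat) : R :=
  \sum_(j < k.+1) const_step b j.

(** This allows the recursive choice of the weights: the constant of a block is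
    known before the weights of the block are. *)
Lemma block_constant_local b b' k :
  (forall l n, (n <= block_end k)%N -> b l n = b' l n) ->
  block_constant b k = block_constant b' k.
Proof.
have ini j : (j <= k)%N -> (forall l n, (n <= block_end k)%N -> b l n = b' l n) ->
    initial_norm size_Q b j = initial_norm size_Q b' j /\
    trunc_size Q b j = trunc_size Q b' j.
  move=> /block_end_mono jk bb; split.
    congr (_ + _); apply: eq_bigr => m _; apply: eq_coord_norm => n.
    rewrite size_polyXn ltnS => nm; apply: bb; apply: leq_trans jk.
    by apply: leq_trans nm _; rewrite -ltnS.
  congr (_ * _); apply: eq_bigr => n _; rewrite bb//.
  by apply: leq_trans jk; rewrite -ltnS.
move=> bb; apply: eq_bigr => j _.
have jk : (j <= k)%N by rewrite -ltnS.
have inv : inverse_const b j = inverse_const b' j.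
  apply: eq_bigr => i _; have ik : (i.+1 <= k)%N by exact: leq_trans (ltn_ord i) jk.
  by have [-> ->] := ini _ ik bb.
by have [e1 e2] := ini _ jk bb; rewrite /const_step /block_const e1 e2 inv.
Qed.

End Constants.

Let cw (kap : nat * bool -> nat) xi := scaled a kap xi.

Lemma weights_for_schedule : exists (kap : nat * bool -> nat) xi gam lam,
  let b := pair_weight (cw kap xi) in
  [/\ injective kap, forall w, 0 < xi w, good_weights foc b lam,
      large_constants size_Q b gam lam &
      forall k (P : {poly K}) r, (r <= block_end k)%N ->
        coef_norm P <= trunc_size Q b k.+1 ->
        (2 * k.+1%:R * coords_size size_Q k)^-1 <= modulus P`_r ->
        exists U : {poly K}, [/\ (size U <= (block_end k.+1).+1)%N, U`_0 = 0,
          coef_norm U <= gam k.+1 &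
          forall d, (d <= block_end k.+1)%N ->
            modulus (U * P - 'X^(fan_start k))`_d
              <= (k.+1%:R * initial_norm size_Q b k.+1)^-1]].
Proof.
have [G hG] := inverse_bounds.
have G_ge0 (b : nat -> nat -> R) j : (forall l n, 0 < b l n) ->
    0 <= G j (trunc_size Q b j.+1, (j.+1%:R * initial_norm size_Q b j.+1)^-1).
  move=> b0; have b0' l n : 0 <= b l n by exact: ltW.
  have [||h _] := hG j (trunc_size Q b j.+1) (j.+1%:R * initial_norm size_Q b j.+1)^-1;
    last exact: h.
    by rewrite /trunc_size mulr_ge0// sumr_ge0// => i _; rewrite divr_ge0 ?coef_norm_ge0.
  rewrite invr_gt0 mulr_gt0 ?ltr0n// /initial_norm ltr_pwDl// sumr_ge0// => i _.
  exact: seminorm_ge0 (coord_norm_is_seminorm _ (b0' _)) _.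
have inv_ge0 b k : (forall l n, 0 < b l n) -> 0 <= inverse_const G b k.
  by move=> b0; apply: sumr_ge0 => j _; exact: G_ge0.
have step_parts b k : (forall l n, 0 < b l n) ->
  [/\ 0 <= block_const size_Q b k * (1 + inverse_const G b k + coef_norm (Q k)) *
        (1 + fan_size Q k) * (k.+1%:R * 2 ^+ block_end k.+1),
      0 <= (1 + inverse_const G b k) * (1 + trunc_size Q b k) * k.+1%:R &
      0 < 2 * k.+1%:R ^+ 2 * coords_size size_Q k].
  move=> b0; have b0' l n : 0 <= b l n by exact: ltW.
  have i0 := inv_ge0 b k b0; have q0 := coef_norm_ge0 (Q k).
  have t0 : 0 <= trunc_size Q b k.
    by rewrite /trunc_size mulr_ge0// sumr_ge0// => i _; rewrite divr_ge0 ?coef_norm_ge0.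
  have f0 : 0 <= fan_size Q k by apply: sumr_ge0 => i _; exact: coef_norm_ge0.
  have n0 : 0 <= initial_norm size_Q b k.
    rewrite /initial_norm addr_ge0// sumr_ge0// => i _.
    exact: seminorm_ge0 (coord_norm_is_seminorm _ (b0' _)) _.
  split.
  - have D0 : 0 <= block_const size_Q b k.
      by apply: mulr_ge0 => //; rewrite exprn_ge0// addr_ge0.
    apply: mulr_ge0; last by rewrite mulr_ge0 ?exprn_ge0.
    apply: mulr_ge0; last by rewrite addr_ge0.
    by apply: mulr_ge0 => //; rewrite !addr_ge0.
  - by rewrite !mulr_ge0 ?addr_ge0 ?ler0n.
  - rewrite !mulr_gt0 ?exprn_gt0 ?ltr0n//; apply: lt_le_trans ltr01 _.
    exact: coords_size_ge1.
have step_gt0 b k : (forall l n, 0 < b l n) -> 0 < const_step G b k.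
  by move=> /(step_parts _ k)[h1 h2 h3]; rewrite /const_step ltr_wpDl// addr_ge0.
have lam_gt0 b k : (forall l n, 0 < b l n) -> 0 < block_constant G b k.
  move=> b0; rewrite /block_constant big_ord_recr/= ltr_wpDl ?step_gt0//.
  by apply: sumr_ge0 => j _; exact/ltW/step_gt0.
have pair_gt0 (c : nat * bool -> nat -> R) : (forall w l, 0 < c w l) ->
    forall l n, 0 < pair_weight c l n.
  by move=> c0 l n; rewrite lt_max c0.
pose const (w : nat * bool) (c : nat * bool -> nat -> R) : R :=
  if w.1 == 0%N then 1 else block_constant G (pair_weight c) (block_of w.1).
have [|w c c' cc'|kap [xi [kap_inj xi_gt0 sel]]] := @selection R a a_gt0 a_ratio
  (nat * bool)%type slot_rank (slot_level foc) (fun w => block_of w.1)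
  slot_rank_inj const.
- by move=> w c c0; rewrite /const; case: ifP => // _; apply: lam_gt0; exact: pair_gt0.
- rewrite /const; case: eqP => // /eqP; rewrite -lt0n => w0.
  apply: block_constant_local => l n nw.
  have hw := block_ofP w0.
  have early d : (slot_rank (n, d) < slot_rank w)%N.
    apply: leq_trans (slot_rank_early d nw) _.
    by case: w {w0 cc' nw} hw => w1 w2 hw; case/andP: (slot_rank_block w2 hw).
  by rewrite /pair_weight !cc'.
pose b := pair_weight (cw kap xi).
pose lam := block_constant G b; pose gam := inverse_const G b.
have c_gt0 w l : 0 < cw kap xi w l by rewrite mulr_gt0.
have c_mono w l l' : (l <= l')%N -> cw kap xi w l <= cw kap xi w l'.
  by move=> ll; rewrite ler_pM2l// a_mono.
have b_gt0 l n : 0 < b l n by exact: pair_gt0.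
have b_ge c l n : cw kap xi (n, c) l <= b l n.
  by rewrite /b /pair_weight; case: c; rewrite le_max lexx ?orbT.
have b_le l n z : cw kap xi (n, false) l <= z -> cw kap xi (n, true) l <= z ->
    b l n <= z by move=> h1 h2; rewrite /b /pair_weight ge_max h1.
have lam0 k : 0 < lam k by exact: lam_gt0.
have b_mul_le l n k z : cw kap xi (n, false) l * lam k <= z ->
    cw kap xi (n, true) l * lam k <= z -> b l n * lam k <= z.
  by move=> h1 h2; rewrite -ler_pdivlMr// b_le// ler_pdivlMr.
have selb k n c : (block_end k < n <= block_end k.+1)%N ->
  let lev := slot_level foc (n, c) in
  [/\ cw kap xi (n, c) lev * lam k <= 1,
      lam k <= cw kap xi (n, c) lev.+1 &
      forall u, (slot_rank u < slot_rank (n, c))%N ->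
        cw kap xi (n, c) lev * lam k <= cw kap xi u 0%N /\
        lam k * cw kap xi u k <= cw kap xi (n, c) lev.+1].
  move=> hn; have := sel (n, c); rewrite /= /const /= (block_ofE hn).
  by have -> : (n == 0)%N = false by apply/negbTE; rewrite -lt0n; nat_lia.
exists kap, xi, gam, lam; split=> //.
- split=> //.
  + move=> l l' n ll; apply: b_le.
      by apply: le_trans (c_mono _ _ _ ll) (b_ge _ _ _).
    by apply: le_trans (c_mono _ _ _ ll) (b_ge _ _ _).
  + (* The first component of [m] is compared with the first one of [n], unless
       [m] is in the fan and [n] is not: the fan is chosen before, and the second
       component of [n], whose level is [0], takes over. The second component
       of [m] is negligible up to its level; beyond, the second component of
       [n] is huge at the next index. *)
    move=> k n m l kn nm mk mn lk.
    have hn : (block_end k < n <= block_end k.+1)%N by nat_lia.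
    have hm : (block_end k < m <= block_end k.+1)%N by nat_lia.
    have levc := slot_level_chain foc kn nm mk mn.
    have hend := block_endS k.
    have hfan := fan_start_gt k.
    have lamC x y z : x <= y -> lam k * y <= z -> x * lam k <= z.
      by move=> xy; apply: le_trans; rewrite mulrC ler_pM2l.
    apply: b_mul_le.
      have [_ _ h] := selb k m false hm; rewrite (slot_level_first foc hm) in h.
      case: (boolP ((n < fan_start k) && (fan_start k <= m))%N) => hnm.
        have nf : slot_level foc (n, true) = 0%N.
          by apply: (@slot_level_before_fan _ k); nat_lia.
        have [_ _ h'] := selb k n true hn; rewrite nf in h'.
        have [|_ hh] := h' (m, false).
          by rewrite !(slot_rank_gen _ hn) !(slot_rank_gen _ hm); case: ifP; nat_lia.
        apply: lamC (c_mono _ _ _ lk) _; apply: le_trans hh _.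
        by apply: le_trans (b_ge true _ _); exact: c_mono.
      have [|hh _] := h (n, false).
        rewrite !(slot_rank_gen _ hn) !(slot_rank_gen _ hm).
        by move: hnm; do ?case: ifP; nat_lia.
      apply: le_trans (le_trans hh (le_trans (c_mono _ _ _ (leq0n l.+1)) (b_ge false _ _))).
      by rewrite ler_pM2r// c_mono.
    have [_ _ h] := selb k m true hm.
    case: (leqP l (slot_level foc (m, true))) => lm.
      have [|hh _] := h (n, false).
        rewrite !(slot_rank_gen _ hn) !(slot_rank_gen _ hm).
        by case: ifP; nat_lia.
      apply: le_trans (le_trans hh (le_trans (c_mono _ _ _ (leq0n l.+1)) (b_ge false _ _))).
      by rewrite ler_pM2r// c_mono.
    have [_ _ h'] := selb k n true hn.
    have [|_ hh] := h' (m, true).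
      by rewrite !(slot_rank_gen _ hn) !(slot_rank_gen _ hm); nat_lia.
    apply: lamC (c_mono _ _ _ lk) _; apply: le_trans hh _.
    apply: le_trans (b_ge true _ _); apply: c_mono.
    by nat_lia.
  + move=> k n m hm hn; have hfan := fan_start_gt k.
    have hm' : (block_end k < m <= block_end k.+1)%N.
      by rewrite block_endS; nat_lia.
    have low c : (slot_rank (n, false) < slot_rank (m, c))%N.
      case/orP: hn => hn.
        apply: leq_trans (slot_rank_early false hn) _.
        by case/andP: (slot_rank_block c hm').
      have hn' : (block_end k < n <= block_end k.+1)%N by nat_lia.
      rewrite (slot_rank_gen _ hn') (slot_rank_gen _ hm').
      have hend := block_endS k.
      by case: c; do ?case: ifP; nat_lia.
    apply: b_mul_le.
      have [_ _ /(_ _ (low false))[h _]] := selb k m false hm'.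
      by rewrite (slot_level_first foc hm') in h; exact: le_trans h (b_ge false _ _).
    have [_ _ /(_ _ (low true))[h _]] := selb k m true hm'.
    by rewrite (slot_level_start foc hm) in h; exact: le_trans h (b_ge false _ _).
  + move=> k m hm; have hfan := fan_start_gt k.
    have hm' : (block_end k < m <= block_end k.+1)%N.
      by rewrite block_endS; nat_lia.
    apply: b_mul_le.
      by have [h _ _] := selb k m false hm'; rewrite (slot_level_first foc hm') in h.
    by have [h _ _] := selb k m true hm'; rewrite (slot_level_start foc hm) in h.
  + move=> k n j jk nk; have hfan := fan_start_gt k.
    have hm : (block_end k < fan_start k + j <= block_end k.+1)%N.
      by rewrite block_endS; nat_lia.
    have low c : (slot_rank (n, false) < slot_rank (fan_start k + j, c))%N.
      apply: leq_trans (slot_rank_early false nk) _.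
      by case/andP: (slot_rank_block c hm).
    apply: b_mul_le.
      have [_ _ /(_ _ (low false))[h _]] := selb k _ false hm.
      rewrite (slot_level_fan foc) // in h.
      apply: le_trans (le_trans h (b_ge false _ _)).
      by rewrite ler_pM2r// c_mono.
    have [_ _ /(_ _ (low true))[h _]] := selb k _ true hm.
    by rewrite (slot_level_fan foc) // in h; exact: le_trans h (b_ge false _ _).
  + move=> k j jk; have hfan := fan_start_gt k.
    have hm : (block_end k < fan_start k + j <= block_end k.+1)%N.
      by rewrite block_endS; nat_lia.
    apply: b_mul_le.
      have [h _ _] := selb k _ false hm; rewrite (slot_level_fan foc) // in h.
      by apply: le_trans h; rewrite ler_pM2r// c_mono.
    by have [h _ _] := selb k _ true hm; rewrite (slot_level_fan foc) // in h.
  + move=> k n h1 h2; have hfan := fan_start_gt k.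
    have hn : (block_end k < n <= block_end k.+1)%N by rewrite block_endS; nat_lia.
    have [_ h _] := selb k n true hn; rewrite (slot_level_before_fan foc h1 h2) in h.
    exact: le_trans h (b_ge _ _ _).
  + move=> k j jk; have hfan := fan_start_gt k.
    have hm : (block_end k < fan_start k + j <= block_end k.+1)%N.
      by rewrite block_endS; nat_lia.
    have [_ h _] := selb k _ true hm; rewrite (slot_level_fan foc) // in h.
    exact: le_trans h (b_ge _ _ _).
- have step_le k : const_step G b k <= lam k.
    rewrite /lam /block_constant big_ord_recr/= lerDr sumr_ge0// => j _.
    exact/ltW/step_gt0.
  have three (x y z : R) : 0 <= x -> 0 <= y -> 0 <= z ->
    [/\ x <= x + y + z, y <= x + y + z & z <= x + y + z] by split; lra.
  split.
  + by move=> k; exact: inv_ge0.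
  + move=> k k' kk; rewrite /gam /inverse_const.
    exact: (ler_sum_ord (fun j => G_ge0 b j b_gt0) kk).
  + move=> k k' kk; rewrite /lam /block_constant.
    by apply: (ler_sum_ord (fun j => ltW (step_gt0 b j b_gt0))).
  + move=> k; apply: le_trans (step_le k); have [h1 h2 h3] := step_parts b k b_gt0.
    by case: (three _ _ _ h1 h2 (ltW h3)).
  + move=> k; apply: le_trans (step_le k); have [h1 h2 h3] := step_parts b k b_gt0.
    by case: (three _ _ _ h1 h2 (ltW h3)).
  + move=> k; apply: le_trans (step_le k); have [h1 h2 h3] := step_parts b k b_gt0.
    by case: (three _ _ _ h1 h2 (ltW h3)).
move=> k P r rk PT Pr.
have [||_ h] := hG k (trunc_size Q b k.+1) (k.+1%:R * initial_norm size_Q b k.+1)^-1.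
- rewrite /trunc_size mulr_ge0// sumr_ge0// => i _.
  by rewrite divr_ge0 ?coef_norm_ge0// ltW.
- rewrite invr_gt0 mulr_gt0 ?ltr0n// /initial_norm ltr_pwDl// sumr_ge0// => i _.
  by apply: seminorm_ge0; apply: coord_norm_is_seminorm => n; exact: ltW.
have [U [sU U0 UG hU]] := h P r rk PT Pr.
exists U; split=> //; apply: le_trans UG _.
rewrite /gam /inverse_const big_ord_recr/= lerDr sumr_ge0// => j _.
exact: G_ge0.
Qed.

End FixedSchedule.

(** The polynomials are fixed first, as they only depend on an enumeration; the
    weights are then adapted to them. The last three items are all that the
    operator requires: continuity, density of the orbit of [1], and return to
    [1] from every nonzero vector, stated on its truncations. *)
Theorem cyclic_weights : exists (kap : nat * bool -> nat) (xi : nat * bool -> R)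
    (Q : nat -> {poly K})
    (size_Q : forall k, (size (Q k) <= (block_end k).+1)%N),
  let b := pair_weight (scaled a kap xi) in
  [/\ injective kap, forall w, 0 < xi w,
   forall l, exists2 C : R, 0 <= C & forall n,
     coord_norm size_Q (b l) ('X * fan_poly Q n) <= C * (2 ^+ n)^-1 * b l.+1 n,
   forall f i (e : R), 0 < e ->
     exists c, coord_norm size_Q (b i) ('X^c - f) <= e &
   forall (x : nat -> K) (B : nat -> R) n0 i (e : R), x n0 != 0 ->
     (forall l n, modulus (x n) * b l n <= B l) -> 0 < e ->
     exists c L0, forall L, (L0 <= L)%N -> coord_norm size_Q (b i)
       ('X^c * (\sum_(n < L) x n *: fan_poly Q n) - 1) <= e].
Proof.
have [foc [Q [foc_le size_Q sched]]] := schedule_exists R s.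
have [kap [xi [gam [lam [kap_inj xi_gt0 gb lc inv]]]]] :=
  weights_for_schedule foc_le size_Q.
exists kap, xi, Q, size_Q; split=> //.
- exact: shift_continuous gb lc.
- by move=> f i e e0; exact: (orbit_one_dense gb lc sched f i e0).
- by move=> x B n0 i e x0 xB e0; exact: (orbit_near_one gb lc foc_le sched inv i x0 xB e0).
Qed.

End Weights.

(** * Köthe spaces, abstractly *)

Section KoetheSpace.
Variables (R : realType) (s : scalar_kind).
Local Notation K := (scalars R s).
Local Open Scope classical_set_scope.

Lemma crd_trunc (X : lmodType K) (crd : X -> nat -> K) (delta : nat -> X)
    (z : nat -> K) n k :
  (forall x y k, crd (x + y) k = crd x k + crd y k) ->
  (forall c x k, crd (c *: x) k = c * crd x k) ->
  (forall k k', crd (delta k) k' = (k == k')%:R) ->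
  crd (\sum_(m < n) z m *: delta m) k = if (k < n)%N then z k else 0.
Proof.
move=> crdD crdZ crd_delta.
have crd0 : crd 0 k = 0 by rewrite -(scale0r 0) crdZ mul0r.
have -> : crd (\sum_(m < n) z m *: delta m) k = \sum_(m < n) crd (z m *: delta m) k.
  by elim/big_rec2: _ => // i y x _ <-; rewrite crdD.
case: ltnP => h.
  rewrite (bigD1 (Ordinal h))//= big1 ?addr0 => [|m mk].
    by rewrite crdZ crd_delta eqxx mulr1.
  rewrite crdZ crd_delta; have -> : (m == k :> nat) = false; last by rewrite mulr0.
  by apply/negbTE; apply: contra mk => /eqP mk; apply/eqP/val_inj.
rewrite big1// => m _; rewrite crdZ crd_delta.
by rewrite ltn_eqF ?mulr0//; exact: leq_trans h.
Qed.

(** What the spaces of type [l^p] and [c_0] have in common: coordinates, unit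
    vectors, solid seminorms, convergence of the truncations, and a form of
    completeness that is stated on truncations only. *)
Record koethe_space (X : preTopologicalLmodType K) (p : nat -> X -> R)
    (a : nat -> nat -> R) (crd : X -> nat -> K) (delta : nat -> X) : Prop :=
  KoetheSpace {
  ks_ge0 : forall j k, 0 <= a j k;
  ks_mono : forall i j k, (i <= j)%N -> a i k <= a j k;
  ks_neq0 : forall k, exists j, 0 < a j k;
  ks_seminorm : forall j, is_seminorm (p j);
  ks_nbhs : forall x : X, nbhs x = seminorms_nbhs p x;
  ks_crdD : forall x y k, crd (x + y) k = crd x k + crd y k;
  ks_crdZ : forall c x k, crd (c *: x) k = c * crd x k;
  ks_inj : forall x y, (forall k, crd x k = crd y k) -> x = y;
  ks_delta : forall k k', crd (delta k) k' = (k == k')%:R;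
  ks_p_delta : forall j k, p j (delta k) <= a j k;
  ks_crd_le : forall j k x, modulus (crd x k) * a j k <= p j x;
  ks_solid : forall i j x y,
    (forall k, modulus (crd x k) * a i k <= modulus (crd y k) * a j k) ->
    p i x <= p j y;
  ks_tail : forall j x e, 0 < e -> exists N, forall n, (N <= n)%N ->
    p j (x - \sum_(k < n) crd x k *: delta k) <= e;
  ks_complete : forall z : nat -> K, (forall j e, 0 < e -> exists y, forall n,
    p j (\sum_(k < n) (z k - crd y k) *: delta k) <= e) ->
    exists x, forall k, crd x k = z k }.

Section Facts.
Variables (X : preTopologicalLmodType K) (p : nat -> X -> R).
Variables (a : nat -> nat -> R) (crd : X -> nat -> K) (delta : nat -> X).
Hypothesis ks : koethe_space p a crd delta.
Implicit Types x y : X.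

Lemma ks_p_mono i j x : (i <= j)%N -> p i x <= p j x.
Proof.
move=> ij; apply: (ks_solid ks) => k.
by rewrite ler_wpM2l ?modulus_ge0 ?(ks_mono ks).
Qed.

Lemma ks_crd0 k : crd 0 k = 0.
Proof. by rewrite -(scale0r 0) (ks_crdZ ks) mul0r. Qed.

Lemma ks_crdN x k : crd (- x) k = - crd x k.
Proof. by rewrite -scaleN1r (ks_crdZ ks) mulN1r. Qed.

Lemma ks_crdB x y k : crd (x - y) k = crd x k - crd y k.
Proof. by rewrite (ks_crdD ks) ks_crdN. Qed.

Lemma ks_crd_sum (I : Type) (r : seq I) (P : pred I) (F : I -> X) k :
  crd (\sum_(i <- r | P i) F i) k = \sum_(i <- r | P i) crd (F i) k.
Proof.
elim/big_rec2: _ => [|i y x _ <-]; first exact: ks_crd0.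
by rewrite (ks_crdD ks).
Qed.

Lemma ks_crd_trunc (z : nat -> K) n k :
  crd (\sum_(m < n) z m *: delta m) k = if (k < n)%N then z k else 0.
Proof. exact: (crd_trunc _ _ _ (ks_crdD ks) (ks_crdZ ks) (ks_delta ks)). Qed.

Lemma ks_eq x y : (forall j e, 0 < e -> p j (x - y) <= e) -> x = y.
Proof.
move=> h; apply: (ks_inj ks) => k; apply/eqP; rewrite -subr_eq0 -ks_crdB.
have [j aj] := ks_neq0 ks k; apply/eqP/modulus_eq0/eqP.
rewrite eq_le modulus_ge0 andbT leNgt; apply/negP => c0.
have := h j (modulus (crd (x - y) k) * a j k / 2) (divr_gt0 (mulr_gt0 c0 aj) (ltr0n _ 2)).
move=> /(le_trans (ks_crd_le ks j k (x - y))).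
have : 0 < modulus (crd (x - y) k) * a j k by rewrite mulr_gt0.
by lra.
Qed.

(** A seminorm that dominates a continuous norm has positive weights. *)
Lemma continuous_norm_weights : has_continuous_norm X ->
  exists l, forall k, 0 < a l k.
Proof.
move=> [N [[Nsn N0] Ncont]].
have := Ncont 0 _ (nbhsx_ballx (N 0) 1 ltr01).
rewrite /= nbhs_simpl /= (ks_nbhs ks) => -[[n e] /= e0 ball_N].
exists n => k; rewrite lt_neqAle (ks_ge0 ks) andbT eq_sym; apply/eqP => ank.
have small (c : K) : modulus c * N (delta k) < 1.
  have /ball_N : seminorms_ball p 0 (n, e) (c *: delta k).
    move=> j jn /=; rewrite subr0 (seminormZ (ks_seminorm ks j)).
    apply: le_lt_trans e0; rewrite -(mulr0 (modulus c)) ler_wpM2l ?modulus_ge0//.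
    by rewrite -ank; apply: le_trans (ks_p_delta ks j k) (ks_mono ks _ jn).
  rewrite /= -ball_normE /= (seminorm0 Nsn) sub0r normrN.
  by rewrite ger0_norm ?(seminormZ Nsn)// mulr_ge0 ?modulus_ge0// (seminorm_ge0 Nsn).
have d0 : delta k = 0.
  apply: N0; apply/eqP; rewrite eq_le (seminorm_ge0 Nsn) andbT leNgt.
  apply/negP => Nd; have i0 : 0 <= (N (delta k))^-1 by rewrite invr_ge0 ltW.
  have [c cE] := modulus_surj s i0.
  by have := small c; rewrite cE mulVf ?ltxx// gt_eqF.
have := ks_delta ks k k; rewrite d0 ks_crd0 eqxx => /esym/eqP.
by rewrite oner_eq0.
Qed.

(** Otherwise [p l] would dominate all the seminorms and define the topology. *)
Lemma non_normable_ratio l : (forall k, 0 < a l k) -> ~ normable X ->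
  exists l', (l <= l')%N /\ forall C, exists k, C * a l k < a l' k.
Proof.
move=> al nn; apply: contrapT => no; apply: nn; exists (p l).
have dom j : exists2 C, 0 < C & forall x, p j x <= C * p l x.
  have [C hC] : exists C, forall k, a (maxn j l) k <= C * a l k.
    apply: contrapT => noC; apply: no; exists (maxn j l); split.
      exact: leq_maxr.
    move=> C; apply: contrapT => nok; apply: noC; exists C => k.
    by rewrite leNgt; apply/negP => h; apply: nok; exists k.
  have [c cE] := @modulus_surj R s (`|C| + 1) (addr_ge0 (normr_ge0 _) ler01).
  exists (`|C| + 1) => [|x]; first by rewrite ltr_wpDl.
  rewrite -cE -(seminormZ (ks_seminorm ks l)).
  apply: le_trans (ks_p_mono x (leq_maxl j l)) _; apply: (ks_solid ks) => k.
  rewrite (ks_crdZ ks) modulusM cE mulrAC [leRHS]mulrC.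
  rewrite ler_wpM2l ?modulus_ge0//; apply: le_trans (hC k) _.
  rewrite ler_wpM2r ?(ks_ge0 ks)//; apply: le_trans (ler_norm C) _.
  by rewrite lerDl.
split.
  split; first exact: ks_seminorm ks l.
  move=> x px; apply: ks_eq => j e e0; rewrite subr0.
  by have [C _ /(_ x)] := dom j; rewrite px mulr0 => h; exact: le_trans h (ltW e0).
move=> x; rewrite (ks_nbhs ks); apply/seteqP; split=> B.
  move=> [[n e] /= e0 hB].
  have [C C0 hC] := dom n.
  exists (e / C) => [|y /= py]; first by rewrite /= divr_gt0.
  apply: hB => j jn /=; apply: le_lt_trans (ks_p_mono _ jn) _.
  by apply: le_lt_trans (hC _) _; rewrite mulrC -ltr_pdivlMr.
move=> [e e0 hB]; exists (l, e) => // y hy; apply: hB => /=.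
exact: hy (leqnn l).
Qed.

Lemma ks_subsequence (sig : nat -> nat) :
  (forall i j, (i <= j)%N -> (sig i <= sig j)%N) ->
  (forall j, (j <= sig j)%N) ->
  koethe_space (fun j => p (sig j)) (fun j => a (sig j)) crd delta.
Proof.
move=> sig_mono sig_ge; split.
- by move=> j k; exact: ks_ge0 ks _ _.
- by move=> i j k ij; exact: (ks_mono ks _ (sig_mono _ _ ij)).
- move=> k; have [j aj] := ks_neq0 ks k; exists j.
  exact: lt_le_trans aj (ks_mono ks _ (sig_ge _)).
- by move=> j; exact: ks_seminorm ks _.
- move=> x; rewrite (ks_nbhs ks); apply/seteqP; split=> B [[n e] /= e0 hB].
    exists (n, e) => //= y hy; apply: hB => j jn /=.
    apply: le_lt_trans (hy n (leqnn n)); apply: ks_p_mono.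
    exact: leq_trans jn (sig_ge n).
  exists (sig n, e) => //= y hy; apply: hB => j jn /=.
  exact: hy _ (sig_mono _ _ jn).
- exact: ks_crdD ks.
- exact: ks_crdZ ks.
- exact: ks_inj ks.
- exact: ks_delta ks.
- by move=> j k; exact: ks_p_delta ks _ _.
- by move=> j k x; exact: ks_crd_le ks _ _ _.
- by move=> i j x y h; apply: (ks_solid ks).
- by move=> j x e e0; exact: ks_tail ks _ _ _ e0.
- move=> z hz; apply: (ks_complete ks) => j e e0.
  have [y hy] := hz j e e0; exists y => n; apply: le_trans (hy n).
  exact: ks_p_mono.
Qed.

(** [continuous_norm_weights] tells where to start, and [non_normable_ratio]
    where to go next. *)
Lemma ks_good_subsequence : has_continuous_norm X -> ~ normable X ->
  exists (p' : nat -> X -> R) (a' : nat -> nat -> R),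
  [/\ koethe_space p' a' crd delta, forall l k, 0 < a' l k &
      forall l C, exists k, C * a' l k < a' l.+1 k].
Proof.
move=> /continuous_norm_weights[l0 al0] nn.
have apos l k : (l0 <= l)%N -> 0 < a l k.
  by move=> ll; apply: lt_le_trans (al0 k) (ks_mono ks _ ll).
have /choice[g hg] : forall l, exists l', (l0 <= l)%N ->
    (l < l')%N /\ forall C, exists k, C * a l k < a l' k.
  move=> l; case: (leqP l0 l) => [ll|_]; last by exists 0%N.
  have [l' [ll' hl']] := non_normable_ratio (fun k => apos l k ll) nn.
  exists l' => _; split=> //; rewrite ltn_neqAle ll' andbT.
  apply: contraPneq hl' => <- /(_ 1)[k].
  by rewrite mul1r ltxx.
pose sig l := iter l g l0.
have sig_ge0 l : (l0 <= sig l)%N.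
  elim: l => // l ih; have [lt_sig _] := hg _ ih.
  exact: leq_trans ih (ltnW lt_sig).
have sig_lt l : (sig l < sig l.+1)%N by case: (hg _ (sig_ge0 l)).
exists (fun j => p (sig j)), (fun j => a (sig j)); split.
- apply: ks_subsequence.
    move=> i j /subnK<-; elim: (j - i)%N => // n ih.
    exact: leq_trans ih (ltnW (sig_lt _)).
  by elim=> // j ih; exact: leq_ltn_trans ih (sig_lt j).
- by move=> l k; exact: apos.
- by move=> l; case: (hg _ (sig_ge0 l)).
Qed.

(** The sum is built coordinate by coordinate; [ks_complete] shows that it
    belongs to the space, with the partial sums as approximations. *)
Lemma ks_series (w : nat -> X) : (forall k, 0 < a 0%N k) ->
  (forall j, exists D, forall n, p j (w n) <= D * (2 ^+ n)^-1) ->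
  exists x, forall j e, 0 < e -> exists N, forall n, (N <= n)%N ->
    p j (x - \sum_(m < n) w m) <= e.
Proof.
move=> a0 hw; pose S n := \sum_(m < n) w m.
have aj0 j k : 0 < a j k by apply: lt_le_trans (a0 k) (ks_mono ks _ (leq0n j)).
have sn := ks_seminorm ks.
have cauchy j e : 0 < e -> exists N, forall m n, (N <= m)%N -> (N <= n)%N ->
    p j (S m - S n) <= e.
  move=> e0; have [D hD] := hw j.
  have D0 : 0 <= D.
    by have := le_trans (seminorm_ge0 (sn j) _) (hD 0%N); rewrite expr0 invr1 mulr1.
  have tail m n : (m <= n)%N -> p j (S n - S m) <= 2 * D * (2 ^+ m)^-1.
    move=> mn; have -> : S n - S m = \sum_(m <= i < n) w i.
      rewrite /S -!(big_mkord predT w) (big_cat_nat (leq0n m) mn)/=.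
      by rewrite addrAC subrr add0r.
    apply: le_trans (seminorm_sum _ _ _ (sn j)) _.
    rewrite -{1}[m]add0n big_addn.
    apply: le_trans (_ : \sum_(0 <= i < n - m) D * (2 ^+ m)^-1 * (2 ^+ i)^-1 <= _).
      apply: ler_sum => i _; apply: le_trans (hD _) _.
      by rewrite addnC exprD invfM mulrA.
    rewrite -mulr_sumr.
    have -> : 2 * D * (2 ^+ m)^-1 = D * (2 ^+ m)^-1 * 2 by ring.
    rewrite ler_wpM2l ?mulr_ge0 ?invr_ge0 ?exprn_ge0//.
    exact: sum_half_le.
  have [N hN] : exists N : nat, 4 * D / e <= 2 ^+ N.
    exists (Num.truncn (4 * D / e)).+1; apply/ltW.
    apply: lt_le_trans (truncnS_gt _) _; rewrite -natrX ler_nat.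
    exact/ltnW/ltn_expl.
  have tN m : (N <= m)%N -> p j (S m - S N) <= e / 2.
    move=> Nm; apply: le_trans (tail _ _ Nm) _.
    rewrite ler_pdivrMr ?exprn_gt0// mulrAC ler_pdivlMr//.
    by move: hN; rewrite ler_pdivrMr//; lra.
  exists N => m n Nm Nn.
  have -> : S m - S n = (S m - S N) - (S n - S N) by rewrite opprB addrA subrK.
  by apply: le_trans (seminormB _ _ (sn j)) _; rewrite (splitr e) lerD// tN.
have /choice[z hz] : forall k, exists z, forall e : R, 0 < e -> exists N,
    forall n, (N <= n)%N -> modulus (crd (S n) k - z) <= e.
  move=> k; apply: scalar_cauchy => e e0.
  have [N hN] := cauchy 0%N _ (mulr_gt0 e0 (a0 k)); exists N => m n Nm Nn.
  rewrite -ks_crdB -(ler_pM2r (a0 k)).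
  exact: le_trans (ks_crd_le ks _ _ _) (hN _ _ Nm Nn).
have near j e : 0 < e -> exists N, forall M, (N <= M)%N -> forall n,
    p j (\sum_(k < n) (z k - crd (S M) k) *: delta k) <= e.
  move=> e0; have e20 : 0 < e / 2 by rewrite divr_gt0.
  have [N hN] := cauchy j _ e20; exists N => M NM n.
  pose d := e / 2 / n.+1%:R; have d0 : 0 < d by rewrite divr_gt0// ltr0n.
  have /choice[N' hN'] : forall k, exists N', forall m, (N' <= m)%N ->
      modulus (z k - crd (S m) k) * a j k <= d.
    move=> k; have [N' h] := hz k _ (divr_gt0 d0 (aj0 j k)); exists N' => m N'm.
    by rewrite -ler_pdivlMr// modulusBC h.
  pose M' := (N + \sum_(k < n) N' k)%N.
  have -> : \sum_(k < n) (z k - crd (S M) k) *: delta k =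
      \sum_(k < n) (z k - crd (S M') k) *: delta k +
      \sum_(k < n) crd (S M' - S M) k *: delta k.
    rewrite -big_split/=; apply: eq_bigr => k _.
    by rewrite -scalerDl ks_crdB addrA subrK.
  apply: le_trans (seminormD (sn j) _ _) _; rewrite (splitr e) lerD//.
    apply: le_trans (seminorm_sum _ _ _ (sn j)) _.
    apply: le_trans (_ : \sum_(k < n) d <= _).
      apply: ler_sum => k _; rewrite (seminormZ (sn j)).
      apply: le_trans (ler_wpM2l (modulus_ge0 _) (ks_p_delta ks j k)) _.
      by apply: hN'; rewrite /M' (bigD1 k)//= addnCA leq_addr.
    rewrite sumr_const card_ord -[_ *+ n]mulr_natr /d -mulrA ler_piMr ?(ltW e20)//.
    by rewrite ler_pdivrMl ?ltr0n// mulr1 ler_nat.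
  apply: le_trans (hN M' M (leq_addr _ _) NM).
  apply: (ks_solid ks) => k; rewrite ks_crd_trunc.
  by case: ifP => // _; rewrite modulus0 mul0r mulr_ge0 ?modulus_ge0 ?ltW.
have [|x hx] := ks_complete ks (z := z).
  by move=> j e e0; have [N hN] := near j e e0; exists (S N) => n; exact: hN.
exists x => j e e0; have e20 : 0 < e / 2 by rewrite divr_gt0.
have [N hN] := near j _ e20; exists N => M NM.
rewrite -/(S M); set u := x - S M.
have [n hn] := ks_tail ks j u e20.
rewrite -(subrK (\sum_(k < n) crd u k *: delta k) u).
apply: le_trans (seminormD (sn j) _ _) _; rewrite (splitr e) lerD ?hn//.
apply: le_trans (hN M NM n); rewrite le_eqVlt; apply/orP; left; apply/eqP.
by congr p; apply: eq_bigr => k _; rewrite /u ks_crdB hx.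
Qed.

End Facts.
End KoetheSpace.

(** * The operator without invariant subsets *)

Section Operator.
Variables (R : realType) (s : scalar_kind).
Local Notation K := (scalars R s).
Local Open Scope classical_set_scope.

Variables (X : preTopologicalLmodType K) (p : nat -> X -> R).
Variables (a : nat -> nat -> R) (crd : X -> nat -> K) (delta : nat -> X).
Hypothesis ks : koethe_space p a crd delta.
Hypothesis a_gt0 : forall l k, 0 < a l k.

Variables (kap : nat * bool -> nat) (xi : nat * bool -> R).
Hypothesis kap_inj : injective kap.
Hypothesis xi_gt0 : forall w, 0 < xi w.
Variables (Q : nat -> {poly K}).
Hypothesis size_Q : forall k, (size (Q k) <= (block_end k).+1)%N.
Local Notation b := (pair_weight (scaled a kap xi)).
Local Notation A := (fan_poly Q).
Local Notation nu l := (coord_norm size_Q (b l)).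
Hypothesis shift_cont : forall l, exists2 C : R, 0 <= C & forall n,
  nu l ('X * A n) <= C * (2 ^+ n)^-1 * b l.+1 n.
Hypothesis one_dense : forall f i (e : R), 0 < e -> exists c, nu i ('X^c - f) <= e.
Hypothesis near_one : forall (x : nat -> K) (B : nat -> R) n0 i (e : R),
  x n0 != 0 -> (forall l n, modulus (x n) * b l n <= B l) -> 0 < e ->
  exists c L0, forall L, (L0 <= L)%N ->
    nu i ('X^c * (\sum_(n < L) x n *: A n) - 1) <= e.

Let sn j : is_seminorm (p j) := ks_seminorm ks j.

Definition coef (w : nat * bool) : K :=
  projT1 (cid (modulus_surj s (ltW (xi_gt0 w)))).

Let coefE w : modulus (coef w) = xi w.
Proof. by rewrite /coef; case: cid. Qed.

Let coef_neq0 w : coef w != 0.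
Proof. by apply/negP => /eqP h; have := xi_gt0 w; rewrite -coefE h modulus0 ltxx. Qed.

Definition pair_vector (n : nat) : X :=
  coef (n, false) *: delta (kap (n, false)) +
  coef (n, true) *: delta (kap (n, true)).
Local Notation v := pair_vector.

Let b_ge0 l n : 0 <= b l n.
Proof. by rewrite le_max; apply/orP; left; rewrite mulr_ge0 ?ltW. Qed.

Let nu_sn l : is_seminorm (nu l). Proof. exact: coord_norm_is_seminorm. Qed.

Let crd_delta w k : crd (delta (kap w)) k = (kap w == k)%:R.
Proof. exact: ks_delta ks _ _. Qed.

Let crd_v n k : crd (v n) k =
  coef (n, false) * (kap (n, false) == k)%:R +
  coef (n, true) * (kap (n, true) == k)%:R.
Proof. by rewrite (ks_crdD ks) !(ks_crdZ ks) !crd_delta. Qed.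

Let crd_v_kap n m c : crd (v n) (kap (m, c)) = if n == m then coef (m, c) else 0.
Proof.
rewrite crd_v !(inj_eq kap_inj) !xpair_eqE.
by case: eqP => [->|_]; case: c; rewrite ?mulr0 ?mulr1 ?addr0 ?add0r.
Qed.

Let crd_v_out n k : (forall w, kap w <> k) -> crd (v n) k = 0.
Proof.
move=> hk; rewrite crd_v.
by do 2!(case: eqP => [/hk//|_]); rewrite !mulr0 addr0.
Qed.

Lemma p_pair_vector l n : p l (v n) <= 2 * b l n.
Proof.
apply: le_trans (seminormD (sn l) _ _) _; rewrite !(seminormZ (sn l)) !coefE.
rewrite mulr_natl mulr2n; apply: lerD.
  apply: le_trans (ler_wpM2l (ltW (xi_gt0 _)) (ks_p_delta ks l _)) _.
  by rewrite le_max lexx.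
apply: le_trans (ler_wpM2l (ltW (xi_gt0 _)) (ks_p_delta ks l _)) _.
by rewrite le_max lexx orbT.
Qed.

(** The closed span of the vectors [v n]. Its description by linear equations
    makes it easy to see that it is closed; [vcoord_expansion] shows that it is the span. *)
Definition pair_span : set X :=
  [set x | (forall k, (forall w, kap w <> k) -> crd x k = 0) /\
    forall n, crd x (kap (n, true)) * coef (n, false) =
              crd x (kap (n, false)) * coef (n, true)].

Definition vcoord (x : X) (n : nat) : K := crd x (kap (n, false)) / coef (n, false).

Lemma vcoordE x n c : pair_span x -> crd x (kap (n, c)) = vcoord x n * coef (n, c).
Proof.
move=> [_ hx]; rewrite /vcoord; case: c; last by rewrite divfK.
by rewrite mulrAC -hx mulfK.
Qed.

Lemma vcoord_le x l n : pair_span x -> modulus (vcoord x n) * b l n <= p l x.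
Proof.
move=> hx; have h c : modulus (vcoord x n) * scaled a kap xi (n, c) l <= p l x.
  apply: le_trans (ks_crd_le ks l (kap (n, c)) x).
  by rewrite vcoordE// modulusM coefE mulrA.
by rewrite /pair_weight maxr_pMr ?modulus_ge0// ge_max !h.
Qed.

Lemma pair_span_linear : linear_subspace pair_span.
Proof.
split.
  rewrite inE; split=> [k _|n]; rewrite !(ks_crd0 ks) ?mul0r//.
move=> c x y; rewrite !inE => -[x1 x2] [y1 y2]; split=> [k hk|n].
  by rewrite (ks_crdD ks) (ks_crdZ ks) x1// y1// mulr0 addr0.
by rewrite !(ks_crdD ks) !(ks_crdZ ks) !mulrDl -!mulrA x2 y2.
Qed.

Lemma pair_span_limit x :
  (forall j e, 0 < e -> exists2 y, pair_span y & p j (x - y) <= e) -> pair_span x.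
Proof.
move=> hx.
have crd_close k k' (e : R) : 0 < e -> exists2 y, pair_span y &
    modulus (crd x k - crd y k) <= e /\ modulus (crd x k' - crd y k') <= e.
  move=> e0; pose m := Num.min (a 0%N k) (a 0%N k').
  have m0 : 0 < m by rewrite lt_min !a_gt0.
  have [y hy yx] := hx 0%N _ (mulr_gt0 e0 m0); exists y => //.
  split; rewrite -(ks_crdB ks).
    rewrite -(ler_pM2r (a_gt0 0%N k)).
    apply: le_trans (ks_crd_le ks _ _ _) (le_trans yx _).
    by rewrite ler_pM2l// ge_min lexx.
  rewrite -(ler_pM2r (a_gt0 0%N k')).
  apply: le_trans (ks_crd_le ks _ _ _) (le_trans yx _).
  by rewrite ler_pM2l// ge_min lexx orbT.
have small0 (z : K) (C : R) : 0 <= C ->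
    (forall e, 0 < e -> modulus z <= C * e) -> z = 0.
  move=> C0 hz; apply/modulus_eq0/eqP; rewrite eq_le modulus_ge0 andbT leNgt.
  apply/negP => z0; have C1 : 0 < C + 1 by rewrite ltr_wpDl.
  have := hz _ (divr_gt0 z0 C1); rewrite mulrA ler_pdivlMr// [C * _]mulrC.
  by rewrite ler_pM2l// gerDl ler10.
split=> [k hk|n].
  apply: (small0 _ 1) => // e e0; have [y [y1 _] [h _]] := crd_close k k e e0.
  by rewrite mul1r; rewrite y1 ?subr0 in h.
apply/eqP; rewrite -subr_eq0; apply/eqP.
apply: (small0 _ (xi (n, false) + xi (n, true))).
  by rewrite addr_ge0 ?ltW.
move=> e e0.
have [y [_ y2] [h1 h2]] := crd_close (kap (n, true)) (kap (n, false)) e e0.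
have -> : crd x (kap (n, true)) * coef (n, false) -
    crd x (kap (n, false)) * coef (n, true) =
  (crd x (kap (n, true)) - crd y (kap (n, true))) * coef (n, false) -
  (crd x (kap (n, false)) - crd y (kap (n, false))) * coef (n, true).
  by rewrite !mulrBl y2; ring.
apply: le_trans (modulusB _ _) _; rewrite !modulusM !coefE mulrDl.
by apply: lerD; rewrite mulrC ler_wpM2l// ltW.
Qed.

Lemma pair_span_closed : closed pair_span.
Proof.
move=> x hx; apply: pair_span_limit => j e e0.
have : nbhs x [set y | p j (x - y) <= e].
  rewrite (ks_nbhs ks); exists (j, e) => // y /(_ j (leqnn j)) /=.
  by rewrite -(seminormN _ (sn j)) opprB; exact: ltW.
by move=> /hx [y [hy1 hy2]]; exists y.
Qed.

Lemma pair_span_sum (I : Type) (r : seq I) (P : pred I) (F : I -> X) :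
  (forall i, P i -> pair_span (F i)) -> pair_span (\sum_(i <- r | P i) F i).
Proof.
have [h0 hS] := pair_span_linear; rewrite inE in h0.
move=> hF; elim/big_rec: _ => // i x Pi hx.
by have := hS 1 (F i) x; rewrite !inE scale1r; apply => //; exact: hF.
Qed.

Lemma pair_spanZ c x : pair_span x -> pair_span (c *: x).
Proof.
have [h0 hS] := pair_span_linear; rewrite inE in h0.
by have := hS c x 0; rewrite !inE addr0 => h hx; exact: h.
Qed.

Lemma pair_span_v n : pair_span (v n).
Proof.
split=> [k hk|m]; first exact: crd_v_out.
by rewrite !crd_v_kap; case: eqP => _; rewrite ?mul0r// mulrC.
Qed.

Lemma vcoordD x y n : vcoord (x + y) n = vcoord x n + vcoord y n.
Proof. by rewrite /vcoord (ks_crdD ks) mulrDl. Qed.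

Lemma vcoordZ c x n : vcoord (c *: x) n = c * vcoord x n.
Proof. by rewrite /vcoord (ks_crdZ ks) mulrA. Qed.

Lemma vcoord_sum (z : nat -> K) L n :
  vcoord (\sum_(m < L) z m *: v m) n = if (n < L)%N then z n else 0.
Proof.
rewrite /vcoord (ks_crd_sum ks).
under eq_bigr do rewrite (ks_crdZ ks) crd_v_kap.
case: ltnP => h.
  rewrite (bigD1 (Ordinal h))//= big1 ?addr0 => [|m mn].
    by rewrite eqxx mulfK.
  case: eqP => [mn'|_]; last by rewrite mulr0.
  by case/eqP: mn; apply/val_inj.
rewrite big1 ?mul0r// => m _; rewrite ltn_eqF ?mulr0//.
exact: leq_trans h.
Qed.

Lemma vcoord_expansion x j e : pair_span x -> 0 < e ->
  exists N, forall n, (N <= n)%N -> p j (x - \sum_(m < n) vcoord x m *: v m) <= e.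
Proof.
move=> hx e0; have [K0 hK0] := ks_tail ks j x e0.
have /choice[g hg] : forall k, exists N, forall w, kap w = k -> (w.1 < N)%N.
  move=> k; case: (pselect (exists w, kap w = k)) => [[w wk]|no].
    by exists w.1.+1 => w' w'k; have -> : w' = w by apply: kap_inj; rewrite w'k.
  by exists 0%N => w wk; case: no; exists w.
exists (\sum_(k < K0) g k)%N => n hn.
apply: le_trans (hK0 K0 (leqnn _)); apply: (ks_solid ks) => k.
rewrite ler_wpM2r ?(ltW (a_gt0 _ _))// !(ks_crdB ks) (ks_crd_trunc ks).
case: (pselect (exists w, kap w = k)) => [[[m c] <-]|no]; last first.
  have hk w : kap w <> k by move=> wk; apply: no; exists w.
  rewrite (ks_crd_sum ks) big1 ?subr0 => [|i _].
    by rewrite (hx.1 _ hk) modulus0 modulus_ge0.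
  by rewrite (ks_crdZ ks) crd_v_out ?mulr0.
have -> : crd (\sum_(i < n) vcoord x i *: v i) (kap (m, c)) =
    vcoord (\sum_(i < n) vcoord x i *: v i) m * coef (m, c).
  rewrite vcoordE//; apply: pair_span_sum => i _.
  exact/pair_spanZ/pair_span_v.
rewrite vcoord_sum vcoordE//; case: (ltnP m n) => mn.
  by rewrite subrr modulus0 modulus_ge0.
rewrite mul0r subr0; case: ltnP => h; last by rewrite subr0.
have := hg _ (m, c) erefl => /= /leq_trans/(_ _)/(leq_trans _).
have : (g (kap (m, c)) <= n)%N.
  by apply: leq_trans hn; rewrite (bigD1 (Ordinal h))//= leq_addr.
move=> h1; have := hg _ (m, c) erefl => /= h2.
by have := leq_trans (leq_trans h2 h1) mn; rewrite ltnn.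
Qed.

(** The identification of the polynomials with the finite combinations of the
    [v n], under which [fan_poly Q n] is [v n]. *)
Definition realize (f : {poly K}) : X :=
  \sum_(n < size (coords size_Q f)) (coords size_Q f)`_n *: v n.

Lemma realizeE f L : (size (coords size_Q f) <= L)%N ->
  realize f = \sum_(n < L) (coords size_Q f)`_n *: v n.
Proof.
move=> fL; rewrite /realize.
rewrite (big_ord_widen L (fun n => (coords size_Q f)`_n *: v n))// big_mkcond.
by apply: eq_bigr => i _; case: ltnP => // h; rewrite nth_default// scale0r.
Qed.

Lemma realizeD f g : realize (f + g) = realize f + realize g.
Proof.
pose L := maxn (size (coords size_Q f)) (size (coords size_Q g)).
rewrite (@realizeE (f + g) L); last by rewrite coordsD size_polyD.
rewrite (@realizeE f L) ?leq_maxl// (@realizeE g L) ?leq_maxr// -big_split/=.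
by apply: eq_bigr => i _; rewrite coordsD coefD scalerDl.
Qed.

Lemma realizeZ c f : realize (c *: f) = c *: realize f.
Proof.
rewrite (@realizeE _ (size (coords size_Q f))); last by rewrite coordsZ size_scale_leq.
by rewrite scaler_sumr; apply: eq_bigr => i _; rewrite coordsZ coefZ scalerA.
Qed.

Lemma realizeB f g : realize (f - g) = realize f - realize g.
Proof. by rewrite realizeD -scaleN1r realizeZ scaleN1r. Qed.

Lemma realize_sum (x : nat -> K) L :
  realize (\sum_(n < L) x n *: A n) = \sum_(n < L) x n *: v n.
Proof.
rewrite (@realizeE _ L) coords_fan_sum ?size_poly//.
by apply: eq_bigr => i _; rewrite coef_poly ltn_ord.
Qed.

Lemma realize_fan n : realize (A n) = v n.
Proof.
rewrite /realize coords_fan_poly size_polyXn big_ord_recr/= big1 => [|i _].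
  by rewrite coefXn eqxx scale1r add0r.
by rewrite coefXn (ltn_eqF (ltn_ord i)) scale0r.
Qed.

Lemma p_realize l f : p l (realize f) <= 2 * nu l f.
Proof.
apply: le_trans (seminorm_sum _ _ _ (sn l)) _.
rewrite /coord_norm mulr_sumr; apply: ler_sum => n _.
rewrite (seminormZ (sn l)) mulrCA ler_wpM2l ?modulus_ge0//.
exact: p_pair_vector.
Qed.

Lemma realize_span f : pair_span (realize f).
Proof. by apply: pair_span_sum => n _; exact/pair_spanZ/pair_span_v. Qed.

Lemma vcoord_realize f n : vcoord (realize f) n = (coords size_Q f)`_n.
Proof.
by rewrite vcoord_sum; case: ltnP => // h; rewrite nth_default.
Qed.

Let shift_term (x : X) n : X := vcoord x n *: realize ('X * A n).

Let shift_limit (x y : X) := forall j e, 0 < e -> exists N, forall n, (N <= n)%N ->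
  p j (y - \sum_(m < n) shift_term x m) <= e.

Let shift_limit_unique x y y' : shift_limit x y -> shift_limit x y' -> y = y'.
Proof.
move=> h h'; apply: (ks_eq ks) => j e e0; have e20 : 0 < e / 2 by rewrite divr_gt0.
have [N hN] := h j _ e20; have [N' hN'] := h' j _ e20.
pose n := maxn N N'; pose S := \sum_(m < n) shift_term x m.
have -> : y - y' = (y - S) - (y' - S) by rewrite opprB addrA subrK.
apply: le_trans (seminormB _ _ (sn j)) _; rewrite (splitr e) lerD//.
  by apply: hN; exact: leq_maxl.
by apply: hN'; exact: leq_maxr.
Qed.

Lemma shift_bound l : exists2 C : R, 0 <= C & forall x n, pair_span x ->
  p l (shift_term x n) <= C * p l.+1 x * (2 ^+ n)^-1.
Proof.
have [C C0 hC] := shift_cont l; exists (2 * C); first by rewrite mulr_ge0.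
move=> x n hx; rewrite /shift_term (seminormZ (sn l)).
apply: le_trans (ler_wpM2l (modulus_ge0 _) (p_realize l _)) _.
apply: le_trans (ler_wpM2l (modulus_ge0 _) (ler_wpM2l (ler0n _ 2) (hC n))) _.
have -> : modulus (vcoord x n) * (2 * (C / 2 ^+ n * b l.+1 n)) =
  2 * C * (2 ^+ n)^-1 * (modulus (vcoord x n) * b l.+1 n) by ring.
have -> : 2 * C * p l.+1 x / 2 ^+ n = 2 * C * (2 ^+ n)^-1 * p l.+1 x by ring.
by rewrite ler_wpM2l ?vcoord_le// !mulr_ge0 ?invr_ge0 ?exprn_ge0.
Qed.

Let shift_limit_exists x : pair_span x -> exists y, pair_span y /\ shift_limit x y.
Proof.
move=> hx; have [|y hy] := ks_series ks (w := shift_term x) (a_gt0 0%N).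
  move=> j; have [C _ hC] := shift_bound j; exists (C * p j.+1 x) => n.
  exact: hC.
exists y; split=> //; apply: pair_span_limit => j e e0.
have [N hN] := hy j e e0; exists (\sum_(m < N) shift_term x m); last exact: hN.
by apply: pair_span_sum => m _; exact/pair_spanZ/realize_span.
Qed.

Local Notation Y := (subspace_type pair_span_linear).

Let valY (y : Y) : X := subspace_val y.
Let spanY (y : Y) : pair_span (valY y).
Proof. by have := subspaceP y; rewrite inE. Qed.

Let mkY (x : X) (hx : pair_span x) : Y := SubspaceType _ (mem_set hx).

Definition shift_fun (y : Y) : Y :=
  let e := cid (shift_limit_exists (spanY y)) in mkY (projT2 e).1.

Let shift_funP y : shift_limit (valY y) (valY (shift_fun y)).
Proof. by rewrite /shift_fun /=; case: cid => x []. Qed.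

Lemma shift_fun_linear : linear shift_fun.
Proof.
move=> c x y; apply/val_inj; apply: (@shift_limit_unique (valY (c *: x + y))).
  exact: shift_funP.
move=> j e e0; have e20 : 0 < e / 2 by rewrite divr_gt0.
have c0 : 0 < modulus c + 1 by rewrite ltr_wpDl ?modulus_ge0.
have [N hN] := shift_funP x j (divr_gt0 e20 c0).
have [N' hN'] := shift_funP y j e20.
exists (maxn N N') => n; rewrite geq_max => /andP[Nn N'n].
have -> : val (c *: shift_fun x + shift_fun y) -
    \sum_(m < n) shift_term (valY (c *: x + y)) m =
  c *: (valY (shift_fun x) - \sum_(m < n) shift_term (valY x) m) +
  (valY (shift_fun y) - \sum_(m < n) shift_term (valY y) m).
  rewrite scalerBr scaler_sumr addrACA -opprD -big_split/=; congr (_ - _).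
  apply: eq_bigr => m _; rewrite /shift_term scalerA -scalerDl; congr (_ *: _).
  by rewrite -vcoordZ -vcoordD.
apply: le_trans (seminormD (sn j) _ _) _; rewrite (splitr e) lerD ?hN'//.
rewrite (seminormZ (sn j)).
apply: le_trans (ler_wpM2l (modulus_ge0 _) (hN n Nn)) _.
rewrite mulrCA ler_piMr ?(ltW e20)// ler_pdivrMr// mul1r lerDl.
exact: ler01.
Qed.

HB.instance Definition _ := GRing.isLinear.Build K Y Y _ shift_fun shift_fun_linear.

Lemma shift_fun_bound l : exists2 C : R, 0 <= C & forall y : Y,
  p l (valY (shift_fun y)) <= C * p l.+1 (valY y).
Proof.
have [C C0 hC] := shift_bound l; exists (C * 2); first by rewrite mulr_ge0.
move=> y; apply/ler_addgt0Pr => e e0; have [N /(_ N (leqnn N)) hN] := shift_funP y l e0.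
rewrite -(subrK (\sum_(m < N) shift_term (valY y) m) (valY (shift_fun y))).
apply: le_trans (seminormD (sn l) _ _) _; rewrite addrC lerD//.
apply: le_trans (seminorm_sum _ _ _ (sn l)) _.
apply: le_trans (_ : \sum_(m < N) C * p l.+1 (valY y) * (2 ^+ m)^-1 <= _).
  by apply: ler_sum => m _; exact: hC.
rewrite -mulr_sumr [leRHS]mulrAC ler_wpM2l ?mulr_ge0 ?(seminorm_ge0 (sn _))//.
by have := sum_half_le R 0 N; rewrite big_mkord.
Qed.

Lemma nbhsY (y : Y) (B : set Y) : nbhs y B <->
  exists l e, 0 < e /\ forall z : Y, p l (valY z - valY y) < e -> B z.
Proof.
split.
  move=> [_ [[U Uo <-] Uy UB]].
  have : nbhs (valY y) U by rewrite nbhsE; exists U.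
  rewrite (ks_nbhs ks) => -[[n e] /= e0 hU]; exists n, e; split=> // z zy.
  apply: UB; apply: hU => j jn /=; apply: le_lt_trans zy.
  exact: (ks_p_mono ks _ jn).
move=> [l [e [e0 hB]]].
have : nbhs (valY y) [set x | p l (x - valY y) < e].
  by rewrite (ks_nbhs ks); exists (l, e) => // x; exact.
rewrite nbhsE => -[U [Uo Uy] UB]; exists ((@subspace_val _ _ _ pair_span_linear) @^-1` U).
by split=> //; [exists U|move=> z /UB; exact: hB].
Qed.

Lemma shift_fun_continuous : continuous shift_fun.
Proof.
move=> y B /nbhsY[l [e [e0 hB]]]; have [C C0 hC] := shift_fun_bound l.
apply/nbhsY; exists l.+1, (e / (C + 1)).
have C1 : 0 < C + 1 by rewrite ltr_wpDl.
split; first by rewrite divr_gt0.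
move=> z zy; apply: hB.
have -> : valY (shift_fun z) - valY (shift_fun y) = valY (shift_fun (z - y)).
  by rewrite raddfB.
apply: le_lt_trans (hC _) _.
have h : C * p l.+1 (valY (z - y)) <= (C + 1) * p l.+1 (valY (z - y)).
  by rewrite ler_wpM2r ?(seminorm_ge0 (sn _))// lerDl.
by apply: le_lt_trans h _; rewrite mulrC -ltr_pdivlMr.
Qed.

Let vecY (f : {poly K}) : Y := mkY (realize_span f).

Lemma shift_fun_realize f : shift_fun (vecY f) = vecY ('X * f).
Proof.
apply/val_inj; apply: (@shift_limit_unique (realize f)); first exact: shift_funP.
move=> j e e0; exists (size (coords size_Q f)) => n hn.
suff -> : \sum_(m < n) shift_term (realize f) m = realize ('X * f).
  by rewrite subrr (seminorm0 (sn j)) ltW.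
rewrite -[in RHS](coordsK size_Q f) (of_coordsE Q hn) mulr_sumr.
elim/big_rec2: _ => [|i x g _ ->].
  by rewrite -(scale0r (0 : {poly K})) realizeZ scale0r.
by rewrite realizeD -scalerAr realizeZ /shift_term vcoord_realize.
Qed.

Lemma iter_shift_realize c f : iter c shift_fun (vecY f) = vecY ('X^c * f).
Proof.
elim: c => [|c ih]; first by rewrite expr0 mul1r.
by rewrite iterS ih shift_fun_realize mulrA -exprS.
Qed.

Lemma iter_shift_bound c l : exists2 C : R, 0 <= C & forall y z : Y,
  p l (valY (iter c shift_fun y) - valY (iter c shift_fun z))
    <= C * p (l + c)%N (valY y - valY z).
Proof.
elim: c l => [|c ih] l.
  by exists 1 => // y z; rewrite addn0 mul1r.
have [C C0 hC] := shift_fun_bound l; have [D D0 hD] := ih l.+1.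
exists (C * D); first exact: mulr_ge0.
move=> y z; rewrite !iterS.
have -> : valY (shift_fun (iter c shift_fun y)) - valY (shift_fun (iter c shift_fun z))
    = valY (shift_fun (iter c shift_fun y - iter c shift_fun z)).
  by rewrite raddfB.
apply: le_trans (hC _) _; rewrite -mulrA ler_wpM2l//.
by rewrite addnS -addSn; exact: hD.
Qed.

Let invariant (M : set Y) := shift_fun @` M `<=` M.

Let invariant_iter M c y : invariant M -> M y -> M (iter c shift_fun y).
Proof. by move=> hM My; elim: c => //= c ih; apply: hM; exists (iter c shift_fun y). Qed.

Let closed_mem (M : set Y) (y : Y) : closed M ->
  (forall j e, 0 < e -> exists2 z, M z & p j (valY z - valY y) < e) -> M y.
Proof.
move=> clM h; apply: clM => B /nbhsY[l [e [e0 hB]]].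
by have [z Mz zy] := h l e e0; exists z; split=> //; exact: hB.
Qed.

(** [near_one] provides a power of the operator that sends the long truncations
    of [y] near [1]; as this power is continuous, it sends [y] there too. *)
Lemma invariant_cyclic (M : set Y) (y : Y) : closed M -> invariant M -> M y ->
  y <> 0 -> M (vecY 1).
Proof.
move=> clM inv My y0; apply: closed_mem => // j e e0.
have [n0 xn0] : exists n0, vcoord (valY y) n0 != 0.
  apply: contrapT => no; apply: y0; apply/val_inj; apply: (ks_inj ks) => k.
  rewrite (ks_crd0 ks).
  case: (pselect (exists w, kap w = k)) => [[[n c] <-]|nk]; last first.
    by apply: (spanY y).1 => w wk; apply: nk; exists w.
  rewrite (vcoordE _ _ (spanY y)); case: (eqVneq (vcoord (valY y) n) 0) => [->|h].
    by rewrite mul0r.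
  by case: no; exists n.
have e60 : 0 < e / 6 by rewrite divr_gt0.
have [c [L0 hc]] := near_one j xn0 (fun l n => vcoord_le l n (spanY y)) e60.
have [C C0 hC] := iter_shift_bound c j.
have C1 : 0 < C + 1 by rewrite ltr_wpDl.
have e30 : 0 < e / 3 by rewrite divr_gt0.
have [N hN] := vcoord_expansion (j + c)%N (spanY y) (divr_gt0 e30 C1).
pose L := maxn N L0; pose f := \sum_(n < L) vcoord (valY y) n *: A n.
exists (iter c shift_fun y); first exact: invariant_iter.
have -> : valY (iter c shift_fun y) - valY (vecY 1) =
    (valY (iter c shift_fun y) - valY (iter c shift_fun (vecY f))) +
    realize ('X^c * f - 1).
  by rewrite iter_shift_realize realizeB addrA subrK.
apply: le_lt_trans (seminormD (sn j) _ _) _.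
apply: le_lt_trans (_ : e / 3 + 2 * (e / 6) < e); last by lra.
apply: lerD.
  apply: le_trans (hC _ _) _.
  have -> : valY (vecY f) = \sum_(m < L) vcoord (valY y) m *: v m.
    exact: realize_sum.
  apply: le_trans (ler_wpM2l C0 (hN L (leq_maxl _ _))) _.
  by rewrite mulrCA ler_piMr ?(ltW e30)// ler_pdivrMr// mul1r lerDl.
apply: le_trans (p_realize _ _) _; rewrite ler_wpM2l//.
exact: hc (leq_maxr _ _).
Qed.

(** The polynomials are dense in the subspace, and [one_dense] approaches each
    of them by powers of the variable. *)
Lemma cyclic_dense (M : set Y) : closed M -> invariant M -> M (vecY 1) -> M = setT.
Proof.
move=> clM inv M1; apply/seteqP; split=> // y _.
apply: closed_mem => // j e e0.
have e30 : 0 < e / 3 by rewrite divr_gt0.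
have e60 : 0 < e / 6 by rewrite divr_gt0.
have [N /(_ N (leqnn N)) hN] := vcoord_expansion j (spanY y) e30.
pose f := \sum_(n < N) vcoord (valY y) n *: A n.
have [c hc] := one_dense f j e60.
exists (iter c shift_fun (vecY 1)); first exact: invariant_iter.
have -> : valY (iter c shift_fun (vecY 1)) - valY y =
    realize ('X^c - f) - (valY y - \sum_(m < N) vcoord (valY y) m *: v m).
  by rewrite iter_shift_realize mulr1 realizeB realize_sum opprB addrA subrK.
apply: le_lt_trans (seminormB _ _ (sn j)) _.
apply: le_lt_trans (_ : 2 * (e / 6) + e / 3 < e); last by lra.
rewrite lerD//; apply: le_trans (p_realize _ _) _.
by rewrite ler_wpM2l.
Qed.

Lemma pair_span_infinite_dimensional : ~ finite_dimensional Y.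
Proof.
move=> [n [g hg]].
have /choice[c hc] : forall m : 'I_n.+1, exists c : 'rV[K]_n,
    vecY (A m) = \sum_(i < n) c 0 i *: g i.
  move=> m; have [c cE] := hg (vecY (A m)); exists (\row_i c i).
  by rewrite cE; apply: eq_bigr => i _; rewrite mxE.
pose C := \matrix_(m < n.+1) c m.
have [u /sub_kermxP uC u0] : exists2 u : 'rV[K]_n.+1, (u <= kermx C)%MS & u != 0.
  apply/rowV0Pn; rewrite -mxrank_eq0 mxrank_ker subn_eq0 -ltnNge.
  exact: leq_ltn_trans (rank_leq_col C) (ltnSn n).
have sum0 : \sum_m u 0 m *: vecY (A m) = 0.
  under eq_bigr => m _ do rewrite hc scaler_sumr.
  rewrite exchange_big/= big1// => i _.
  under eq_bigr => m _ do rewrite scalerA.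
  rewrite -scaler_suml; have := congr1 (fun M : 'rV_n => M 0 i) uC.
  rewrite !mxE; under eq_bigr => m _ do rewrite mxE.
  by move=> ->; rewrite scale0r.
have valE : \sum_(m < n.+1) u 0 (inord m) *: v m = 0.
  have := congr1 valY sum0.
  have -> : valY (\sum_m u 0 m *: vecY (A m)) = \sum_m u 0 m *: v m.
    rewrite -[valY _]/(val _) raddf_sum; apply: eq_bigr => m _.
    by rewrite -[RHS]/(u 0 m *: v m) -realize_fan.
  move=> h; rewrite -[RHS]/(valY 0) -h.
  by apply: eq_bigr => m _; rewrite inord_val.
move/negP: u0; apply; apply/eqP/rowP => m; rewrite mxE.
have := vcoord_sum (fun k => u 0 (inord k)) n.+1 m.
rewrite valE ltn_ord inord_val => <-.
by rewrite /vcoord (ks_crd0 ks) mul0r.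
Qed.

Theorem not_hereditary : ~ hereditary_invariant_subset_property X.
Proof.
move=> /(_ _ pair_span_linear pair_span_closed pair_span_infinite_dimensional).
move=> /(_ shift_fun shift_fun_continuous)[M [[y My] clM M0 MT inv]].
case: (pselect (exists2 z, M z & z <> 0)) => [[z Mz z0]|no].
  by apply: MT; apply: cyclic_dense => //; exact: invariant_cyclic clM inv Mz z0.
apply: M0; apply/seteqP; split=> z /=.
  by move=> Mz; apply: contrapT => z0; apply: no; exists z.
move=> ->; have <- // : y = 0.
by apply: contrapT => y0; apply: no; exists y.
Qed.

End Operator.

(** * The two families of Köthe spaces *)

Section Instances.
Variables (R : realType) (s : scalar_kind) (A : koethe_matrix R).
Local Notation K := (scalars R s).
Local Open Scope classical_set_scope.

Lemma koethe_space_not_hereditary (X : preTopologicalLmodType K)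
    (p : nat -> X -> R) (a : nat -> nat -> R) (crd : X -> nat -> K)
    (delta : nat -> X) : koethe_space p a crd delta ->
  has_continuous_norm X -> ~ normable X ->
  ~ hereditary_invariant_subset_property X.
Proof.
move=> ks cn nn; have [p' [a' [ks' a_gt0 a_ratio]]] := ks_good_subsequence ks cn nn.
have [kap [xi [Q [size_Q [kap_inj xi_gt0 cont dense near]]]]] :=
  cyclic_weights s a_gt0 (fun l l' k ll => ks_mono ks' k ll) a_ratio.
exact: (not_hereditary ks' a_gt0 kap_inj xi_gt0 cont dense near).
Qed.

Definition unit_seq (k : nat) : nat -> K^o := fun n => (k == n)%:R : K.

Lemma modulus_unit_seq k n : modulus (unit_seq k n : K) = (k == n)%:R.
Proof. by rewrite /unit_seq; case: eqP => _; rewrite ?modulus1 ?modulus0. Qed.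

Section C0.
Local Notation X := (koethe_c0 s A).
Local Notation p := (@c0_seminorm R s A).
Implicit Types x y : X.

Let term_ge0 j (x : nat -> K^o) k : 0 <= modulus (x k : K) * A j k.
Proof. by rewrite mulr_ge0 ?modulus_ge0 ?koethe_ge0. Qed.

Lemma c0_term_le j x k : modulus (x k : K) * A j k <= p j x.
Proof.
apply: sup_upper_bound; last by exists k.
split; first by exists (modulus (x 0%N : K) * A j 0%N); exists 0%N.
have := koethe_c0P x; rewrite inE => /(_ j) /cvgP /cvg_seq_bounded.
move=> [M [_ hM]]; exists (M + 1) => _ [n _ <-].
by apply: le_trans (ler_norm _) _; apply: hM => //; rewrite ltrDl.
Qed.

Lemma c0_seminorm_le j x (M : R) :
  (forall k, modulus (x k : K) * A j k <= M) -> p j x <= M.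
Proof.
move=> hM; apply: ge_sup; last by move=> _ [k _ <-].
by exists (modulus (x 0%N : K) * A j 0%N); exists 0%N.
Qed.

Lemma mem_c0 (x : nat -> K^o) :
  (forall j e, 0 < e -> exists N, forall n, (N <= n)%N ->
    modulus (x n : K) * A j n <= e) <-> x \in koethe_c0_set A.
Proof.
rewrite inE; split=> h j.
  apply/cvgrPdist_le => e e0; have [N hN] := h j e e0; exists N => // n /hN.
  by rewrite sub0r normrN ger0_norm.
move=> e e0; have /cvgrPdist_le/(_ e e0)[N _ hN] := h j.
by exists N => n /hN; rewrite /= sub0r normrN ger0_norm.
Qed.

Lemma unit_seq_c0 k : unit_seq k \in koethe_c0_set A.
Proof.
apply/mem_c0 => j e e0; exists k.+1 => n kn.
by rewrite modulus_unit_seq ltn_eqF// mul0r ltW.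
Qed.

Let delta k : X := KoetheC0 (unit_seq_c0 k).
Let crd x : nat -> K := x.

Lemma c0_koethe_space : koethe_space p A crd delta.
Proof.
have crdD x y k : crd (x + y) k = crd x k + crd y k by [].
have crdZ c x k : crd (c *: x) k = c * crd x k by [].
have crd_delta k k' : crd (delta k) k' = (k == k')%:R by [].
have truncE := fun z n k => crd_trunc z n k crdD crdZ crd_delta.
split => //.
- exact: koethe_ge0.
- by move=> i j k; exact: koethe_nondecreasing.
- exact: koethe_neq0.
- exact: c0_seminorm_is_seminorm.
- by move=> x y xy; apply/val_inj/funext.
- move=> j k; apply: c0_seminorm_le => n; rewrite modulus_unit_seq.
  by case: eqP => [->|_]; rewrite ?mul1r// mul0r koethe_ge0.
- by move=> j k x; exact: c0_term_le.
- move=> i j x y xy; apply: c0_seminorm_le => k; apply: le_trans (xy k) _.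
  exact: c0_term_le.
- move=> j x e e0; have /mem_c0/(_ j e e0)[N hN] := koethe_c0P x.
  exists N => n Nn; apply: c0_seminorm_le => k.
  rewrite [modulus _](_ : _ =
    modulus (crd x k - crd (\sum_(m < n) crd x m *: delta m) k)) //.
  rewrite truncE; case: ltnP => h; first by rewrite subrr modulus0 mul0r ltW.
  by rewrite subr0 hN// (leq_trans Nn).
- move=> z hz; suff zc : (z : nat -> K^o) \in koethe_c0_set A.
    by exists (KoetheC0 zc).
  apply/mem_c0 => j e e0; have e20 : 0 < e / 2 by rewrite divr_gt0.
  have [y hy] := hz j _ e20.
  have /mem_c0/(_ j _ e20)[N hN] := koethe_c0P y; exists N => n Nn.
  have -> : z n = (z n - crd y n) + crd y n by rewrite subrK.
  apply: le_trans (ler_wpM2r (koethe_ge0 _ _ _) (modulusD _ _)) _.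
  rewrite mulrDl (splitr e); apply: lerD; last exact: hN.
  apply: le_trans (hy n.+1); apply: le_trans (c0_term_le _ _ n).
  rewrite [leRHS](_ : _ =
    modulus (crd (\sum_(k < n.+1) (z k - crd y k) *: delta k) n) * A j n) //.
  by rewrite (truncE (fun k => z k - crd y k)) ltnSn.
Qed.

End C0.

Section Lp.
Variables (p : R) (p1 : 1 <= p).
Local Notation X := (koethe_lp s A p1).
Local Notation q := (@lp_seminorm R s A p p1).
Implicit Types x y : X.

Let p0 : 0 < p. Proof. exact: lt_le_trans p1. Qed.
Let term_ge0 j (x : nat -> K^o) k : 0 <= modulus (x k : K) * A j k.
Proof. by rewrite mulr_ge0 ?modulus_ge0 ?koethe_ge0. Qed.

Definition lp_partial_sum (j : nat) (x : nat -> K^o) (n : nat) : R :=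
  \sum_(k < n) (modulus (x k : K) * A j k) `^ p.

Lemma lp_eseminorm_le j (x : nat -> K^o) e : 0 <= e ->
  (forall n, lp_partial_sum j x n <= e `^ p) -> (lp_eseminorm A p j x <= e%:E)%E.
Proof.
move=> e0 hx.
have t0 k : (0%N <= k)%N -> true -> (0 <= ((modulus (x k : K) * A j k) `^ p)%:E)%E.
  by move=> _ _; rewrite lee_fin powR_ge0.
have -> : e%:E = ((e `^ p)%:E `^ p^-1)%E.
  by rewrite poweR_EFin -powRrM divff ?gt_eqF// powRr1.
apply: gt0_ler_poweR.
- by rewrite invr_ge0 ltW.
- by rewrite in_itv/= leey andbT nneseries_ge0.
- by rewrite in_itv/= leey andbT lee_fin powR_ge0.
apply: lime_le; first exact: is_cvg_nneseries.
by near=> n; rewrite sumEFin lee_fin big_mkord; exact: hx.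
Unshelve. all: by end_near. Qed.

Lemma lp_seminormE j x : (q j x)%:E = lp_eseminorm A p j x.
Proof.
rewrite /lp_seminorm fineK// ge0_fin_numE ?lp_eseminorm_ge0//.
by have := koethe_lpP x; rewrite inE; exact.
Qed.

Lemma lp_partial_sum_le j x n : lp_partial_sum j x n <= q j x `^ p.
Proof.
rewrite -lee_fin -poweR_EFin lp_seminormE /lp_eseminorm -poweRrM mulVf ?gt_eqF//.
rewrite poweRe1; last by apply: nneseries_ge0 => k _ _; rewrite lee_fin powR_ge0.
rewrite /lp_partial_sum -sumEFin -(big_mkord predT (fun k => ((modulus (x k : K) * A j k) `^ p)%:E)).
by apply: nneseries_lim_ge => k _ _; rewrite lee_fin powR_ge0.
Qed.

Lemma lp_seminorm_le j x e : 0 <= e -> (forall n, lp_partial_sum j x n <= e `^ p) ->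
  q j x <= e.
Proof. by move=> e0 hx; rewrite -lee_fin lp_seminormE lp_eseminorm_le. Qed.

Let q_ge0 j x : 0 <= q j x.
Proof. exact: seminorm_ge0 (@lp_seminorm_is_seminorm R s A p p1 j) x. Qed.

Let powR_le (u w : R) : 0 <= u -> 0 <= w -> u <= w -> u `^ p <= w `^ p.
Proof. by move=> u0 w0; apply: ge0_ler_powR => //; exact: ltW. Qed.

Lemma lp_term_le j x k : modulus (x k : K) * A j k <= q j x.
Proof.
have h : (modulus (x k : K) * A j k) `^ p <= q j x `^ p.
  apply: le_trans (lp_partial_sum_le j x k.+1).
  by rewrite /lp_partial_sum big_ord_recr/= lerDr sumr_ge0// => i _; rewrite powR_ge0.
have : ((modulus (x k : K) * A j k) `^ p) `^ p^-1 <= (q j x `^ p) `^ p^-1.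
  by apply: ge0_ler_powR; rewrite ?invr_ge0 ?nnegrE ?powR_ge0// ltW.
by rewrite -!powRrM divff ?gt_eqF// !powRr1.
Qed.

Lemma unit_seq_sum j k n : lp_partial_sum j (unit_seq k) n <= A j k `^ p.
Proof.
have h i : i != k -> (modulus (unit_seq k i : K) * A j i) `^ p = 0.
  by move=> ik; rewrite modulus_unit_seq eq_sym (negPf ik) mul0r powR0 ?gt_eqF.
rewrite /lp_partial_sum; case: (ltnP k n) => kn.
  rewrite (bigD1 (Ordinal kn))//= big1 ?addr0 => [|i ik].
    by rewrite modulus_unit_seq eqxx mul1r.
  by apply: h; apply: contra ik => /eqP ik; apply/eqP/val_inj.
rewrite big1 ?powR_ge0// => i _; apply: h.
by rewrite ltn_eqF//; exact: leq_trans kn.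
Qed.

Lemma unit_seq_lp k : unit_seq k \in koethe_lp_set A p.
Proof.
rewrite inE => j; apply: le_lt_trans (ltry (A j k)).
by apply: lp_eseminorm_le; [exact: koethe_ge0|exact: unit_seq_sum].
Qed.

Let delta k : X := KoetheLp p1 (unit_seq_lp k).
Let crd x : nat -> K := x.

Lemma lp_koethe_space : koethe_space q A crd delta.
Proof.
have crdD x y k : crd (x + y) k = crd x k + crd y k by [].
have crdZ c x k : crd (c *: x) k = c * crd x k by [].
have crd_delta k k' : crd (delta k) k' = (k == k')%:R by [].
have truncE := fun z n k => crd_trunc z n k crdD crdZ crd_delta.
split => //.
- exact: koethe_ge0.
- by move=> i j k; exact: koethe_nondecreasing.
- exact: koethe_neq0.
- exact: lp_seminorm_is_seminorm.
- by move=> x y xy; apply/val_inj/funext.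
- by move=> j k; apply: lp_seminorm_le; [exact: koethe_ge0|exact: unit_seq_sum].
- by move=> j k x; exact: lp_term_le.
- move=> i j x y xy; apply: lp_seminorm_le => // n.
  apply: le_trans (lp_partial_sum_le j y n); apply: ler_sum => k _.
  by apply: powR_le => //; exact: xy.
- move=> j x e e0.
  have bounded : has_sup (range (lp_partial_sum j x)).
    split; first by exists (lp_partial_sum j x 0), 0%N.
    by exists (q j x `^ p) => _ [n _ <-]; exact: lp_partial_sum_le.
  have [_ [N _ <-] hN] := sup_adherent (powR_gt0 p e0) bounded.
  exists N => n Nn; apply: lp_seminorm_le => [|m]; first exact: ltW.
  have tail : lp_partial_sum j (x - \sum_(k < n) crd x k *: delta k : X) m + lp_partial_sum j x n
      <= lp_partial_sum j x (maxn m n).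
    rewrite /lp_partial_sum.
    have -> : \sum_(k < m) (modulus ((x - \sum_(k < n) crd x k *: delta k : X) k : K) * A j k) `^ p
      = \sum_(k < m) (if (k < n)%N then 0 else (modulus (x k : K) * A j k) `^ p).
      apply: eq_bigr => k _.
      rewrite [modulus _](_ : _ =
    modulus (crd x k - crd (\sum_(m < n) crd x m *: delta m) k)) //.
      rewrite truncE; case: ifP => // _; last by rewrite subr0.
      by rewrite subrr modulus0 mul0r powR0 ?gt_eqF.
    pose F k := (modulus (x k : K) * A j k) `^ p.
    have F0 k : 0 <= F k by exact: powR_ge0.
    have -> : \sum_(k < n) F k = \sum_(k < maxn m n) (if (k < n)%N then F k else 0).
      by rewrite (big_ord_widen (maxn m n) F) ?leq_maxr// big_mkcond.
    apply: le_trans (_ : \sum_(k < maxn m n) (if (k < n)%N then 0 else F k) +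
        \sum_(k < maxn m n) (if (k < n)%N then F k else 0) <= _).
      rewrite lerD2r; apply: (@ler_sum_ord _ (fun k => if (k < n)%N then 0 else F k)).
        by move=> k; case: ifP.
      exact: leq_maxl.
    rewrite -big_split/=; apply: ler_sum => k _.
    by case: ifP => _; rewrite ?add0r ?addr0.
  have h1 : lp_partial_sum j x (maxn m n) <= sup (range (lp_partial_sum j x)).
    by apply: sup_upper_bound => //; exists (maxn m n).
  have h2 : lp_partial_sum j x N <= lp_partial_sum j x n.
    by apply: (@ler_sum_ord _ (fun k => (modulus (x k : K) * A j k) `^ p)) => // k; exact: powR_ge0.
  have := le_trans tail h1; lra.
- move=> z hz; suff zl : (z : nat -> K^o) \in koethe_lp_set A p.
    by exists (KoetheLp p1 zl).
  rewrite inE => j; have [y hy] := hz j 1 ltr01.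
  have -> : (z : nat -> K^o) = ((fun k => z k - crd y k) : nat -> K^o) + (y : nat -> K^o).
    by apply/funext => k; rewrite /= [RHS]subrK.
  apply: le_lt_trans (lp_eseminormD _ _ _ _ p1) _.
  rewrite lte_add_pinfty//; last by rewrite -lp_seminormE ltry.
  apply: le_lt_trans (ltry 1); apply: lp_eseminorm_le => // n.
  apply: le_trans (le_trans (lp_partial_sum_le j (\sum_(k < n) (z k - crd y k) *: delta k) n) _).
    apply: ler_sum => k _; apply: powR_le; rewrite ?mulr_ge0 ?modulus_ge0 ?koethe_ge0//.
    rewrite [leRHS](_ : _ =
      modulus (crd (\sum_(k < n) (z k - crd y k) *: delta k) k) * A j k) //.
    by rewrite (truncE (fun k => z k - crd y k)) ltn_ord.
  exact: powR_le (q_ge0 _ _) ler01 (hy n).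
Qed.

End Lp.
End Instances.

Unset Implicit Arguments.

Theorem corollary3p14 (R : realType) (s : scalar_kind) (A : koethe_matrix R) :
  (forall (p : R) (p1 : 1 <= p),
     has_continuous_norm (koethe_lp s A p1) ->
     ~ normable (koethe_lp s A p1) ->
     ~ hereditary_invariant_subset_property (koethe_lp s A p1)) /\
  (has_continuous_norm (koethe_c0 s A) ->
   ~ normable (koethe_c0 s A) ->
   ~ hereditary_invariant_subset_property (koethe_c0 s A)).
Proof.
split=> [p p1|].
  exact: koethe_space_not_hereditary (lp_koethe_space s A p1).
exact: koethe_space_not_hereditary (c0_koethe_space s A).
Qed.
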